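(* Let $N\ge 2$, let $\Omega\subseteq\mathbb R^N$ be a bounded domain containing the origin $O$, and let $\Sigma\subseteq\mathbb R^N$ be a cone $\Sigma=\{tx: x\in\omega,\ t\in(0,+\infty)\}$ over a domain $\omega\subseteq\mathbb S^{N-1}$, such that, if $\omega\subsetneq\mathbb S^{N-1}$, $\partial\Sigma\setminus\{O\}$ is a hypersurface of class $C^1$ (and therefore possesses an outward normal $\nu$); the case $\omega=\mathbb S^{N-1}$, $\Sigma=\mathbb R^N$ is allowed. Put $\Gamma_0=\Sigma\cap\partial\Omega$ and $\Gamma_1=\partial(\Sigma\cap\Omega)\setminus\overline{\Gamma}_0$. Let $H$ be a norm on $\mathbb R^N$ of class $C^1(\mathbb R^N\setminus\{O\})$ such that the function $V(\xi)=\frac12H^2(\xi)$ is strictly convex, and let $H_0$ be the norm whose dual norm is $H$. Let $q(r)$ be a positive, real-valued function of $r>0$ such that the ratio $q(r)/r$ is strictly increasing in $r>0$. Suppose there exists a weak solution $u\in C^1\big((\Sigma\cap\Omega)\cup(\Gamma_1\setminus\{O\})\big)\cap C^0\big(\overline{\Sigma\cap\Omega}\setminus\{O\}\big)$ of the problem $$ \begin{cases} -\Delta_H u=1 & \text{in }\Sigma\cap\Omega,\\ u=0 & \text{on }\Gamma_0,\\ DV(Du(x))\cdot\nu=0 & \text{on }\Gamma_1\setminus\{O\}, \end{cases} $$ satisfying the condition $$ \lim_{x\to z}H(Du(x))=q(H_0(z))\quad\text{for all }z\in\overline{\Gamma}_0 $$ (the limit being taken over $x\in\Sigma\cap\Omega$).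 Then $\Sigma\cap\Omega=\Sigma\cap B_R(O,H_0)$ for some $R>0$.
   Context: A domain is an open, connected, nonempty set. When $\omega=\mathbb S^{N-1}$, the cone $\Sigma$ is understood to be all of $\mathbb R^N$; in that case $\Gamma_0=\partial\Omega$, $\Gamma_1=\emptyset$, and the condition on $\Gamma_1\setminus\{O\}$ is void. Dual norm: $H(\xi)=\sup_{x\neq 0}\frac{x\cdot\xi}{H_0(x)}$ for $\xi\in\mathbb R^N$; equivalently $H_0$ is the dual norm of $H$. The Wulff shape is $B_R(x_0,H_0)=\{x\in\mathbb R^N: H_0(x-x_0)<R\}$. With $V=\frac12H^2$, which is of class $C^1(\mathbb R^N)$ with $DV(0)=0$, the Finsler Laplacian is formally $\Delta_Hu(x)=\operatorname{div}\big(DV(Du(x))\big)$, where $DV(Du(x))$ is the field $DV(\xi)$ evaluated at $\xi=Du(x)$. Function space: $W^{1,2}_{\Gamma_0}(\Omega\cap\Sigma)$ is the set of functions $v:\Omega\cap\Sigma\to\mathbb R$ that are restrictions to $\Omega\cap\Sigma$ of some $w\in W^{1,2}_0(\Omega)$. Weak solution: for $f\in L^2(\Omega\cap\Sigma)$ (here $f\equiv1$), a weak solution of the boundary value problem $-\Delta_Hu=f$ in $\Omega\cap\Sigma$, $u=0$ on $\Gamma_0$, $DV(Du)\cdot\nu=0$ on $\Gamma_1\setminus\{O\}$ is a function $u\in W^{1,2}_{\Gamma_0}(\Omega\cap\Sigma)$ such that $$\int_{\Omega\cap\Sigma}Dv(x)\cdot DV(Du(x))\,dx=\int_{\Omega\cap\Sigma}f(x)\,v(x)\,dx\quad\text{for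 every }v\in W^{1,2}_{\Gamma_0}(\Omega\cap\Sigma).$$ In the theorem, $u\in C^1\big((\Sigma\cap\Omega)\cup(\Gamma_1\setminus\{O\})\big)$ means that $u$ and $Du$ extend continuously up to $\Gamma_1\setminus\{O\}$, and the condition $DV(Du)\cdot\nu=0$ holds pointwise there. *)

(* Defs.v *)
From HB Require Import structures.
From mathcomp Require Import all_boot all_order all_algebra.
From mathcomp Require Import all_classical all_reals all_analysis.

Set Implicit Arguments.
Unset Strict Implicit.
Unset Printing Implicit Defensive.

Import Order.TTheory GRing.Theory Num.Theory.
Import numFieldNormedType.Exports.

Local Open Scope classical_set_scope.
Local Open Scope ring_scope.

(* The sigma-algebra on R^n is the one generated by the n coordinates; it is
   the Borel sigma-algebra, like the library's sigma-algebra on n.-tuple T. *)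
Definition rV_display : measure_display.
Proof. exact: default_measure_display. Qed.

Section measurable_rV.
Context {R : realType} (n : nat).

Let coord : 'I_n -> 'rV[R]_n -> R := fun i x => x ord0 i.

Let rV_set0 : g_sigma_preimage coord set0.
Proof. exact: sigma_algebra0. Qed.

Let rV_setC A : g_sigma_preimage coord A -> g_sigma_preimage coord (~` A).
Proof. exact: sigma_algebraC. Qed.

Let rV_bigcup (F : (set 'rV[R]_n)^nat) :
  (forall i, g_sigma_preimage coord (F i)) ->
  g_sigma_preimage coord (\bigcup_i (F i)).
Proof. exact: sigma_algebra_bigcup. Qed.

HB.instance Definition _ := @isMeasurable.Build rV_display
  'rV[R]_n (g_sigma_preimage coord) rV_set0 rV_setC rV_bigcup.

End measurable_rV.

Lemma measurable_coord {R : realType} n (i : 'I_n) :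
  measurable_fun [set: 'rV[R]_n] (fun x : 'rV[R]_n => x ord0 i).
Proof.
move=> _ Y mY; rewrite setTI; apply: sub_sigma_algebra => /=.
rewrite -bigcup_seq/=; exists i => /=; first by rewrite mem_index_enum.
by exists Y => //; rewrite setTI.
Qed.

Lemma measurable_fun_rVP {R : realType} d (T : measurableType d) n
    (f : T -> 'rV[R]_n) :
  (forall i, measurable_fun [set: T] (fun t => f t ord0 i)) ->
  measurable_fun [set: T] f.
Proof.
move=> mf.
have mpre : measurable `<=` [set B : set 'rV[R]_n | measurable (f @^-1` B)].
  apply: smallest_sub.
    split => /=; first by rewrite preimage_set0.
      by move=> B mB; rewrite setTD -preimage_setC; exact: measurableC.
    by move=> F mF; rewrite preimage_bigcup; exact: bigcup_measurable.
  move=> B; rewrite -bigcup_seq/= => -[i _ [C mC <-]]; rewrite setTI.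
  by have := mf i measurableT C mC; rewrite setTI.
by move=> _ B mB; rewrite setTI; exact: mpre.
Qed.

Definition rV_cons {R : realType} n (p : measurableTypeR R * 'rV[R]_n) : 'rV[R]_n.+1 :=
  \row_i oapp (p.2 ord0) p.1 (unlift ord0 i).

Lemma measurable_rV_cons {R : realType} n :
  measurable_fun [set: measurableTypeR R * 'rV[R]_n] (@rV_cons R n).
Proof.
apply: measurable_fun_rVP => i; under eq_fun do rewrite mxE.
case: unliftP => [j _|_] /=; last exact: measurable_fst.
exact: (measurableT_comp (measurable_coord j) measurable_snd).
Qed.

HB.instance Definition _ {R : realType} n :=
  isMeasurableFun.Build _ _ _ _ (@rV_cons R n) (@measurable_rV_cons R n).

Section lebesgue_cons.
Context {R : realType} (n : nat) (mu : sigma_finite_measure 'rV[R]_n R).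

Definition lebesgue_cons : set 'rV[R]_n.+1 -> \bar R :=
  pushforward (lebesgue_measure \x mu)%E (@rV_cons R n).

Let lebesgue_cons0 : lebesgue_cons set0 = 0%E.
Proof. exact: measure0. Qed.

Let lebesgue_cons_ge0 A : (0 <= lebesgue_cons A)%E.
Proof. exact: measure_ge0. Qed.

Let lebesgue_cons_sigma_additive : semi_sigma_additive lebesgue_cons.
Proof. exact: measure_semi_sigma_additive. Qed.

HB.instance Definition _ := isMeasure.Build _ _ _ lebesgue_cons
  lebesgue_cons0 lebesgue_cons_ge0 lebesgue_cons_sigma_additive.

Let lebesgue_cons_sigma_finite : sigma_finite setT lebesgue_cons.
Proof.
pose uncons (x : 'rV[R]_n.+1) : measurableTypeR R * 'rV[R]_n :=
    (x ord0 ord0, \row_j x ord0 (lift ord0 j)).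
have unconsK p : uncons (rV_cons p) = p.
  case: p => a y; rewrite /uncons mxE unlift_none /=; congr (_, _).
  by apply/rowP => j; rewrite !mxE liftK.
have muncons : measurable_fun [set: 'rV[R]_n.+1] uncons.
  apply/measurable_fun_pairP; split; first exact: measurable_coord.
  apply: measurable_fun_rVP => j /=.
  by under eq_fun do rewrite mxE; exact: measurable_coord.
have /sigma_finiteP[F [TF ndF Foo]] := sigma_finiteT (@lebesgue_measure R).
have /sigma_finiteP[G [TG ndG Goo]] := sigma_finiteT mu.
exists (fun k => uncons @^-1` (F k `*` G k)).
  rewrite -preimage_bigcup (_ : \bigcup_k _ = setT) ?preimage_setT//.
  rewrite -setXTT TF TG predeqE => -[x y]; split.
    by move=> [k _ []/= ? ?]; split; exists k.
  move=> [/= [k _ Fkx] [l _ Gly]]; exists (maxn k l) => //; split.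
    by move: x Fkx; exact/subsetPset/ndF/leq_maxl.
  by move: y Gly; exact/subsetPset/ndG/leq_maxr.
move=> k; have [mF Fk] := Foo k; have [mG Gk] := Goo k; split.
  by rewrite -[X in measurable X]setTI; apply: muncons => //; exact: measurableX.
rewrite /lebesgue_cons /pushforward -comp_preimage.
rewrite (_ : uncons \o _ = id); last by apply/funext => p; exact: unconsK.
by rewrite product_measure1E// lte_mul_pinfty// ge0_fin_numE.
Qed.

HB.instance Definition _ := Measure_isSigmaFinite.Build _ _ _ lebesgue_cons
  lebesgue_cons_sigma_finite.

End lebesgue_cons.

(* Iterated product of the one-dimensional Lebesgue measure. *)
Fixpoint lebesgue_rV {R : realType} n : sigma_finite_measure 'rV[R]_n R :=
  match n with
  | 0 => dirac (0 : 'rV[R]_0)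
  | n'.+1 => lebesgue_cons (lebesgue_rV n')
  end.

Lemma measurable_box {R : realType} n (A : 'I_n -> set (measurableTypeR R)) :
  (forall i, measurable (A i)) ->
  measurable [set x : 'rV[R]_n | forall i, A i (x ord0 i)].
Proof.
move=> mA; rewrite (_ : mkset _ =
    \bigcap_(i in [set: 'I_n]) ((fun x : 'rV[R]_n => x ord0 i) @^-1` A i)).
  apply: fin_bigcap_measurable => [|i _]; first exact: finite_finset.
  by rewrite -[X in measurable X]setTI; exact: measurable_coord (mA i).
by apply/seteqP; split => x /= xA i; [move=> _; exact: xA|exact: xA].
Qed.

Lemma lebesgue_rV_box {R : realType} n (A : 'I_n -> set (measurableTypeR R)) :
  (forall i, measurable (A i)) ->
  lebesgue_rV n [set x | forall i, A i (x ord0 i)] =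
  (\prod_(i < n) lebesgue_measure (A i))%E.
Proof.
elim: n A => [|n ih] A mA.
  by rewrite big_ord0 /= diracE mem_set// => -[].
rewrite big_ord_recl -ih//= /lebesgue_cons /pushforward.
rewrite (_ : _ @^-1` _ = A ord0 `*`
    [set x : 'rV[R]_n | forall i, A (lift ord0 i) (x ord0 i)]).
  have mB := @measurable_box R n (fun i => A (lift ord0 i))
    (fun i => mA (lift ord0 i)).
  exact: product_measure1E.
apply/seteqP; split => -[a y] /= Aay.
  split; first by have := Aay ord0; rewrite mxE unlift_none.
  by move=> i; have := Aay (lift ord0 i); rewrite mxE liftK.
move=> i; rewrite mxE; case: unliftP => [j ->|->] /=; last exact: Aay.1.
exact: Aay.2.
Qed.

Section euclidean.
Context {R : realType} {N : nat}.
Implicit Types (A D M : set 'rV[R]_N) (f psi : 'rV[R]_N -> R).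

Definition dot (x y : 'rV[R]_N) : R := \sum_(i < N) x ord0 i * y ord0 i.

Definition unit_sphere : set 'rV[R]_N := [set x | dot x x = 1].

Definition boundary A : set 'rV[R]_N := closure A `\` A°.

Definition domain A := [/\ open A, connected A & A !=set0].

Definition sphere_domain (om : set 'rV[R]_N) :=
  [/\ exists2 U, open U & om = U `&` unit_sphere, connected om & om !=set0].

(* The first disjunct is the convention that the cone over the whole sphere is
   all of R^N, including the origin. *)
Definition cone (om : set 'rV[R]_N) : set 'rV[R]_N :=
  [set y | om = unit_sphere \/ exists t x, [/\ 0 < t, om x & y = t *: x]].

Definition partial (i : 'I_N) f (x : 'rV[R]_N) : R := 'D_(delta_mx ord0 i) f x.

Definition grad f (x : 'rV[R]_N) : 'rV[R]_N := \row_i partial i f x.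

Definition C1_on D f :=
  forall x, D x -> differentiable f x /\ {for x, continuous (grad f)}.

(* In the neighbourhood U the boundary of A is the regular C^1 level set
   psi = 0, and A lies on the side psi < 0 of it, so that the gradient of psi
   points out of A. *)
Definition defining_function A (U : set 'rV[R]_N) psi :=
  [/\ open U, C1_on U psi, forall x, U x -> grad psi x != 0,
      boundary A `&` U = [set x | psi x = 0] `&` U &
      A `&` U = [set x | psi x < 0] `&` U].

Definition C1_boundary_at A (z : 'rV[R]_N) :=
  exists U psi, defining_function A U psi /\ U z.

Definition outward_normal A (z nu : 'rV[R]_N) :=
  exists U psi, [/\ defining_function A U psi, U z, psi z = 0 &
    nu = (Num.sqrt (dot (grad psi z) (grad psi z)))^-1 *: grad psi z].

(* f is C^1 in the open set D, and f and its gradient extend continuously to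
   D `|` M; Df is the extended gradient. *)
Definition C1_upto D M f (Df : 'rV[R]_N -> 'rV[R]_N) :=
  [/\ C1_on D f, forall x, D x -> Df x = grad f x,
      {within D `|` M, continuous f} & {within D `|` M, continuous Df}].

Definition is_norm (H : 'rV[R]_N -> R) :=
  [/\ forall x y, H (x + y) <= H x + H y,
      forall a x, H (a *: x) = `|a| * H x &
      forall x, H x = 0 -> x = 0].

Definition strictly_convex f :=
  forall x y t, x != y -> 0 < t < 1 ->
    f (t *: x + (1 - t) *: y) < t * f x + (1 - t) * f y.

Definition dual_norm (H0 : 'rV[R]_N -> R) (xi : 'rV[R]_N) : R :=
  sup [set dot x xi / H0 x | x in [set x | x != 0]].

Definition wulff (H0 : 'rV[R]_N -> R) (x0 : 'rV[R]_N) (r : R) :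
  set 'rV[R]_N := [set x | H0 (x - x0) < r].

Definition half_sqr (H : 'rV[R]_N -> R) (xi : 'rV[R]_N) : R := H xi ^+ 2 / 2.

End euclidean.

Section sobolev.
Context {R : realType} {N : nat}.
Implicit Types (D Om Sig : set 'rV[R]_N) (f phi v w : 'rV[R]_N -> R).
Implicit Types g : 'rV[R]_N -> 'rV[R]_N.

Local Notation mu := (lebesgue_rV N : {measure set 'rV[R]_N -> \bar R}).

Definition smooth f :=
  forall (s : seq 'I_N) x, differentiable (foldr partial f s) x.

(* C^oo functions with compact support in D. *)
Definition test_function D phi :=
  [/\ smooth phi, compact (closure [set x | phi x != 0]) &
      closure [set x | phi x != 0] `<=` D].

(* f \_ D is f on D and 0 elsewhere. *)
Definition L2 D f := f \_ D \in Lfun mu 2%:E.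

Definition L2_cvg D (f_ : nat -> 'rV[R]_N -> R) f :=
  (fun k => 'N[mu]_2%:E[EFin \o ((f_ k \- f)%R \_ D)])%E @ \oo --> 0%E.

(* v belongs to W^{1,2}(D), with distributional gradient g. *)
Definition W12 D v g :=
  [/\ L2 D v, forall i, L2 D (fun x => g x ord0 i) &
      forall phi, test_function D phi -> forall i,
        (\int[mu]_(x in D) (v x * partial i phi x)%:E =
         - \int[mu]_(x in D) (g x ord0 i * phi x)%:E)%E].

(* The closure of the test functions in W^{1,2}(Om). *)
Definition W12_0 Om w :=
  exists g (phi_ : nat -> 'rV[R]_N -> R),
    [/\ W12 Om w g, forall k, test_function Om (phi_ k), L2_cvg Om phi_ w &
        forall i, L2_cvg Om (fun k => partial i (phi_ k)) (fun x => g x ord0 i)].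

(* v, with distributional gradient g, is the restriction to Om `&` Sig of a
   function of W^{1,2}_0(Om); as these are classes of functions, equality holds
   almost everywhere. *)
Definition W12_Gamma0 Om Sig v g :=
  W12 (Om `&` Sig) v g /\
  exists2 w, W12_0 Om w & {ae mu, forall x, (Om `&` Sig) x -> v x = w x}.

Definition weak_solution (H : 'rV[R]_N -> R) Om Sig f u :=
  exists2 Du, W12_Gamma0 Om Sig u Du &
  forall v Dv, W12_Gamma0 Om Sig v Dv ->
    (\int[mu]_(x in Om `&` Sig) (dot (Dv x) (grad (half_sqr H) (Du x)))%:E =
     \int[mu]_(x in Om `&` Sig) (f x * v x)%:E)%E.

End sobolev.

(* Main.v *)
(* Write D = Sig `&` Om and w_R = (R^2 - H0^2) / (2N), which solves the problem
   in the Wulff sector of radius R; let R1 and R2 be the extreme values of H0 on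
   the closure of Gamma0. A weak comparison principle for the monotone operator
   div (DV (Du)) shows that the positive part of the difference of two solutions
   is locally constant. Its proof needs test functions of class C^1 with compact
   support in D only: near Gamma1 they are cut off using the pointwise Neumann
   condition, and near O using N >= 2 and the integrability of |Du|^2. A positive
   difference would stay constant along rays up to Gamma0; hence u >= 0,
   u >= w_R1 on the Wulff sector of radius R1, and u <= w_R2 on D.
   Along rays ending on Gamma0 near a point where H0 = R1, the bound u >= w_R1
   and the mean value theorem give q(R1) >= R1/N. Near a point where H0 = R2,
   maximising u - k H0(. - x0) on a small ball, with R2/N < k < q(R2) and
   u(x0) > 0, gives an interior or Neumann contact point where H(Du) <= k; hence
   q(R2) <= R2/N. As q(r)/r is strictly increasing, R1 = R2. *)
From HB Require Import structures.
Require Import Defs.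
From mathcomp Require Import all_boot all_order all_algebra.
From mathcomp Require Import all_classical all_reals all_analysis.
From mathcomp Require Import measurable_realfun.
From mathcomp Require Import ring lra.
Set Implicit Arguments.
Unset Strict Implicit.
Unset Printing Implicit Defensive.

Import Order.TTheory GRing.Theory Num.Theory.
Import numFieldNormedType.Exports.

Local Open Scope classical_set_scope.
Local Open Scope ring_scope.


(** * Integration over boxes *)

(** The sector may be irregular where Gamma0 meets the lateral boundary of the cone, and admitting
    truncations of u as test functions there would require a trace argument. So only functions with
    compact support in D are inserted, and everything about the boundary comes from pointwise
    hypotheses: continuity of u at the closure of Gamma0, near which a smooth truncation of the
    difference vanishes, and the C^1 extension at Gamma1. The comparison function has flux DV (grad
    w) = - x / N, because DV inverts the gradient of H0^2 / 2. This linear field has divergence -1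
    and is tangent to the boundary of every cone, so w satisfies the Neumann condition whatever H
    is. Its slope H (grad w) = H0 / N is the origin of the threshold R / N. In the plane the
    Dirichlet energy of the cutoff at O is scale invariant and does not tend to 0; hence a large
    weight in Young's inequality is fixed first, and the energy of the solution on small annuli is
    sent to 0 afterwards. The extremal points of H0 may belong only to the closure of Gamma0, on the
    lateral boundary, so both slope estimates are carried out at nearby points. *)

Section boxes.
Context {R : realType} {n : nat}.
Implicit Types (a b x : 'rV[R]_n) (A : set 'rV[R]_n).

Lemma normr_rV_le x (r : R) : 0 <= r ->
  (`|x| <= r) <-> (forall i, `|x ord0 i| <= r).
Proof.
move=> r0; rewrite (_ : `|x| = mx_norm x)// mx_normrE; split.
  move=> h i; apply: le_trans h.
  by rewrite (bigD1 (ord0, i))//= le_max lexx.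
move=> h; elim/big_ind: _ => //; first by move=> p q; rewrite ge_max => -> ->.
by move=> -[j i] _ /=; rewrite (ord1 j).
Qed.

Lemma normr_rV_lt x (r : R) : 0 < r ->
  (`|x| < r) <-> (forall i, `|x ord0 i| < r).
Proof.
move=> r0; rewrite (_ : `|x| = mx_norm x)// mx_normrE; split.
  move=> h i; apply: le_lt_trans h.
  by rewrite (bigD1 (ord0, i))//= le_max lexx.
move=> h; elim/big_ind: _ => //; first by move=> p q; rewrite gt_max => -> ->.
by move=> -[j i] _ /=; rewrite (ord1 j).
Qed.

Lemma normr_coord_le x i : `|x ord0 i| <= `|x|.
Proof. by move: i; apply/normr_rV_le. Qed.

Definition box a b : set 'rV[R]_n :=
  [set x | forall i, a ord0 i < x ord0 i < b ord0 i].

Definition boxes : set (set 'rV[R]_n) := [set A | exists a b, A = box a b].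

Lemma boxE a b : box a b =
  [set x | forall i, ((`]a ord0 i, b ord0 i[%classic : set (measurableTypeR R)) (x ord0 i))].
Proof. by apply/seteqP; split => x xab i; have := xab i; rewrite /= in_itv. Qed.

Lemma measurable_open_box a b : measurable (box a b).
Proof.
rewrite boxE.
exact: (@measurable_box R n (fun i => (`]a ord0 i, b ord0 i[%classic : set (measurableTypeR R)))
  (fun i => measurable_itv _)).
Qed.

Lemma lebesgue_box a b : (forall i, a ord0 i <= b ord0 i) ->
  lebesgue_rV n (box a b) = (\prod_(i < n) (b ord0 i - a ord0 i))%:E.
Proof.
move=> ab; rewrite boxE.
rewrite (@lebesgue_rV_box R n (fun i => (`]a ord0 i, b ord0 i[%classic : set (measurableTypeR R)))); last first.
  by move=> i; exact: measurable_itv.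
rewrite -prodEFin; apply: eq_bigr => i _.
rewrite lebesgue_measure_itv/= lte_fin; case: ltP => //.
by move=> ba; have -> : b ord0 i = a ord0 i; [apply/eqP; rewrite eq_le ba ab|rewrite subrr].
Qed.

Lemma lebesgue_box_lty a b : (lebesgue_rV n (box a b) < +oo)%E.
Proof.
have [ab|/existsNP[i /negP]] := pselect (forall i, a ord0 i <= b ord0 i).
  by rewrite lebesgue_box// ltry.
rewrite -ltNge => bai; rewrite (_ : box a b = set0) ?measure0//.
apply/seteqP; split => // x /(_ i) /andP[/lt_trans h /h].
by rewrite ltNge (ltW bai).
Qed.

Lemma setI_boxes : setI_closed boxes.
Proof.
move=> _ _ [a [b ->]] [c [d ->]].
exists (\row_i Num.max (a ord0 i) (c ord0 i)), (\row_i Num.min (b ord0 i) (d ord0 i)).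
apply/seteqP; split => x /=.
  move=> [xab xcd] i; rewrite !mxE gt_max lt_min.
  by have /andP[-> ->] := xab i; have /andP[-> ->] := xcd i.
move=> xh; split => i; have := xh i; rewrite !mxE gt_max lt_min.
  by case/andP => /andP[-> _] /andP[-> _].
by case/andP => /andP[_ ->] /andP[_ ->].
Qed.

Definition cubek (k : nat) : set 'rV[R]_n := box (const_mx (- k%:R)) (const_mx k%:R).

Lemma cubek_cover : \bigcup_k cubek k = [set: 'rV[R]_n].
Proof.
apply/seteqP; split => // x _.
exists (Num.bound `|x|) => // i; rewrite !mxE -ltr_norml.
exact: le_lt_trans (normr_coord_le x i) (archi_boundP (normr_ge0 x)).
Qed.

(** The half-space where coordinate [i] exceeds [c] is a countable union of boxes truncated at [k],
    so boxes generate all coordinate preimages. Together with [setI_boxes] this makes them a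
    pi-system for [measure_unique] and [dynkin_induction]. *)
Lemma measurable_boxes : @measurable _ 'rV[R]_n = <<s boxes >>.
Proof.
apply/seteqP; split; last first.
  apply: smallest_sub; first exact: sigma_algebra_measurable.
  by move=> _ [a [b ->]]; exact: measurable_open_box.
pose T := g_sigma_algebraType boxes.
have mc (i : 'I_n) : measurable_fun [set: T] (fun x : T => (x : 'rV[R]_n) ord0 i : measurableTypeR R).
  apply: (measurability _ (@measurable_realfun.RGenOInfty.measurableE R)).
  move=> _ [_ [c ->] <-]; rewrite setTI.
  have -> : (fun x : 'rV[R]_n => x ord0 i) @^-1` `]c, +oo[%classic =
      \bigcup_k (box (\row_j if j == i then Num.max c (- k%:R) else - k%:R) (const_mx k%:R)).
    apply/seteqP; split => x /=.
      rewrite in_itv/= andbT => cx.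
      exists (Num.bound `|x|) => // j; rewrite !mxE.
      have : `|x ord0 j| < (Num.bound `|x|)%:R.
        exact: le_lt_trans (normr_coord_le x j) (archi_boundP (normr_ge0 x)).
      rewrite ltr_norml => /andP[h1 ->]; case: eqP => [ji|_]; rewrite ?h1//.
      by rewrite gt_max h1 ji cx.
    move=> [k _ /(_ i)]; rewrite !mxE eqxx gt_max in_itv/= andbT.
    by case/andP => /andP[].
  apply: bigcupT_measurable => k; apply: sub_sigma_algebra.
  by eexists; eexists; reflexivity.
apply: smallest_sub; first exact: smallest_sigma_algebra.
rewrite -bigcup_seq => A [i _ [B mB <-]].
exact: (mc i measurableT B mB).
Qed.

Lemma ball_rVP (x y : 'rV[R]_n) e : 0 < e ->
  ball x e y <-> forall i, `|x ord0 i - y ord0 i| < e.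
Proof.
move=> e0; rewrite -ball_normE /ball_/= normr_rV_lt//.
by split => h i; have := h i; rewrite !mxE.
Qed.

(** Every point of [A] lies in a box with rational corners contained in [A], and there are countably
    many such boxes. Measurability of continuous functions rests on this link between the topology
    and the coordinate sigma-algebra. *)
Lemma open_measurable_rV A : open A -> measurable A.
Proof.
move=> oA.
pose T := ('rV[rat]_n * 'rV[rat]_n)%type.
pose bx (p : T) := box (\row_i ratr (p.1 ord0 i)) (\row_i ratr (p.2 ord0 i)).
pose F (p : T) := if pselect (bx p `<=` A) then bx p else set0.
have -> : A = \bigcup_p F p.
  apply/seteqP; split => x; last first.
    by move=> [p _]; rewrite /F; case: pselect => // h /h.
  move=> Ax; have /nbhs_ballP[e /= e0 eA] : nbhs x A by exact: open_nbhs_nbhs.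
  have ex1 i : exists q : rat, ratr q \in `](x ord0 i - e), (x ord0 i)[.
    by apply: rat_in_itvoo; rewrite ltrBlDr ltrDl.
  have ex2 i : exists q : rat, ratr q \in `](x ord0 i), (x ord0 i + e)[.
    by apply: rat_in_itvoo; rewrite ltrDl.
  have [/= f hf] := choice ex1; have [/= g hg] := choice ex2.
  have h1 i : x ord0 i - e < ratr (f i) < x ord0 i by have := hf i; rewrite in_itv.
  have h2 i : x ord0 i < ratr (g i) < x ord0 i + e by have := hg i; rewrite in_itv.
  exists (\row_i f i, \row_i g i) => //; rewrite /F; case: pselect.
    by move=> _ i; rewrite !mxE; have /andP[_ ->] := h1 i; have /andP[->] := h2 i.
  case => y yb; apply: eA; apply/ball_rVP => // i.
  have := yb i; rewrite !mxE; have := h1 i; have := h2 i.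
  move=> /andP[? ?] /andP[? ?] /andP[? ?]; rewrite ltr_norml; lra.
apply: countable_bigcupT_measurable; first exact: countableP.
by move=> p; rewrite /F; case: pselect => ?; [exact: measurable_open_box|exact: measurable0].
Qed.

Lemma measurable_fun_open (D : set 'rV[R]_n) (f : 'rV[R]_n -> R) :
  open D -> (forall x, D x -> {for x, continuous f}) -> measurable_fun D f.
Proof.
move=> oD cf; have mD := open_measurable_rV oD.
apply: (measurability _ (@measurable_realfun.RGenOpens.measurableE R)).
move=> _ [_ [a [b ->]] <-]; apply: open_measurable_rV.
rewrite openE => x [Dx Ufx].
rewrite /interior; near=> y; split; first by near: y; exact: open_nbhs_nbhs.
by near: y; apply: (cf x Dx); apply: open_nbhs_nbhs; split => //; exact: interval_open.
Unshelve. all: by end_near.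
Qed.

Lemma measurable_fun_continuous (f : 'rV[R]_n -> R) :
  continuous f -> measurable_fun [set: 'rV[R]_n] f.
Proof. by move=> cf; apply: measurable_fun_open => [|x _]; [exact: openT|exact: cf]. Qed.

Lemma measurable_restrict_open (D : set 'rV[R]_n) (f : 'rV[R]_n -> R) :
  open D -> (forall x, D x -> {for x, continuous f}) ->
  measurable_fun [set: 'rV[R]_n] (f \_ D).
Proof.
move=> oD cf; apply/(measurable_restrictT _ _).1; first exact: open_measurable_rV.
exact: measurable_fun_open.
Qed.

End boxes.

Lemma continuous_atP {K : realFieldType} (U V : normedModType K) (f : U -> V) x :
  {for x, continuous f} <->
  forall e, 0 < e -> exists2 d, 0 < d & forall y, `|y - x| < d -> `|f y - f x| < e.
Proof.
split=> [cf e e0|h].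
  have /nbhs_normP[d d0 hd] : \forall y \near x, `|f y - f x| < e.
    have /cvgrPdist_lt/(_ e e0) := cf.
    by apply: filterS => y; rewrite distrC.
  by exists d => // y xy; apply: hd; rewrite /ball_/= distrC.
apply/cvgrPdist_lt => e /h[d d0 hd]; apply/nbhs_normP; exists d => // y.
by rewrite /ball_/= distrC => /hd; rewrite distrC.
Qed.

Lemma bounded_support_integrable d (T : measurableType d) (R : realType)
    (m : {measure set T -> \bar R}) (A : set T) (f : T -> R) (M : R) :
  measurable A -> (m A < +oo)%E -> measurable_fun [set: T] f ->
  (forall x, `|f x| <= M) -> (forall x, ~ A x -> f x = 0) ->
  m.-integrable [set: T] (EFin \o f).
Proof.
move=> mA mAoo mf fM f0.
have -> : EFin \o f = (EFin \o f) \_ A.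
  apply/funext => x; rewrite patchE; case: ifPn => //.
  by rewrite notin_setE => /f0 /= ->.
apply: (integrable_mkcond (EFin \o f) mA).1.
have mfA : measurable_fun A f by exact: measurable_funTS.
apply: (measurable_bounded_integrable mA mAoo mfA).
exists M; split; first exact: num_real.
by move=> N MN x _; apply: le_trans (fM x) (ltW MN).
Qed.

(** * Integrals of bounded functions with bounded support *)

Section bounded_functions.
Context {R : realType} {n : nat}.
Implicit Types (f g : 'rV[R]_n -> R).
Local Notation mu := (lebesgue_rV n : {measure set 'rV[R]_n -> \bar R}).

(* Bounded, measurable and with bounded support: on this class the integral is
   linear without side conditions. *)
Definition BM f := measurable_fun [set: 'rV[R]_n] f /\
  exists M, (forall x, `|f x| <= M) /\ (forall x, M <= `|x| -> f x = 0).

Definition Lint f : R := \int[mu]_x f x.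

Definition cube (M : R) : set 'rV[R]_n := box (const_mx (- M)) (const_mx M).

Lemma cubeP (M : R) x : 0 < M -> cube M x <-> `|x| < M.
Proof.
by move=> M0; rewrite normr_rV_lt//; split => h i; have := h i; rewrite !mxE ltr_norml.
Qed.

Lemma BMP f : BM f <-> measurable_fun [set: 'rV[R]_n] f /\
  exists M, [/\ 0 < M, forall x, `|f x| <= M & forall x, M <= `|x| -> f x = 0].
Proof.
split=> -[mf [M []]]; last by move=> _ ? ?; split => //; exists M.
move=> fM f0; split => //; exists (Num.max 1 M); split.
- by rewrite lt_max ltr01.
- by move=> x; rewrite le_max fM orbT.
- by move=> x; rewrite ge_max => /andP[_ /f0].
Qed.

Lemma BM_integrable f : BM f -> mu.-integrable [set: 'rV[R]_n] (EFin \o f).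
Proof.
move=> /BMP[mf [M [M0 fM f0]]].
apply: (@bounded_support_integrable _ _ _ _ (cube M) _ M) => //.
- exact: measurable_open_box.
- exact: lebesgue_box_lty.
- by move=> x /(contra_not (cubeP x M0).2)/negP; rewrite -leNgt => /f0.
Qed.

Lemma BMD f g : BM f -> BM g -> BM (fun x => f x + g x).
Proof.
move=> /BMP[mf [M [M0 fM f0]]] /BMP[mg [K [K0 gK g0]]]; split.
  exact: measurable_funD.
exists (M + K); split => x.
  by apply: le_trans (ler_normD _ _) _; exact: lerD.
by move=> h; rewrite f0 ?g0 ?addr0//; lra.
Qed.

Lemma BMM f g : BM f -> measurable_fun [set: 'rV[R]_n] g ->
  (exists M, forall x, f x != 0 -> `|g x| <= M) -> BM (fun x => f x * g x).
Proof.
move=> /BMP[mf [M [M0 fM f0]]] mg [K gK]; split.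
  exact: measurable_funM.
exists (Num.max M (M * K)); split => x.
  have [->|fx0] := eqVneq (f x) 0; first by rewrite mul0r normr0 le_max ltW.
  by rewrite normrM le_max ler_pM ?orbT// gK.
by rewrite ge_max => /andP[/f0 -> _]; rewrite mul0r.
Qed.

Lemma BMM2 f g : BM f -> BM g -> BM (fun x => f x * g x).
Proof. by move=> mf [mg [M [gM _]]]; apply: BMM => //; exists M. Qed.

Lemma BMZ k f : BM f -> BM (fun x => k * f x).
Proof.
move=> mf; have : BM (fun x => f x * k) by apply: BMM => //; exists `|k|.
by under eq_fun do rewrite mulrC.
Qed.

Lemma BMN f : BM f -> BM (fun x => - f x).
Proof. by move=> /(BMZ (-1)); under eq_fun do rewrite mulN1r. Qed.

Lemma BMB f g : BM f -> BM g -> BM (fun x => f x - g x).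
Proof. by move=> mf /BMN; exact: BMD. Qed.

Lemma BM0 : BM (fun=> 0).
Proof. by split => //; exists 0; split => // x; rewrite normr0. Qed.

Lemma BM_sum (T : Type) (s : seq T) (F : T -> 'rV[R]_n -> R) :
  (forall i, BM (F i)) -> BM (fun x => \sum_(i <- s) F i x).
Proof.
move=> BF; elim: s => [|a s ih].
  by under eq_fun do rewrite big_nil; exact: BM0.
by under eq_fun do rewrite big_cons; exact: BMD.
Qed.

Lemma BM_abs f : BM f -> BM (fun x => `|f x|).
Proof.
move=> [mf [M [fM f0]]]; split.
  exact: measurableT_comp.
by exists M; split => x; [rewrite normr_id|move=> /f0 ->; rewrite normr0].
Qed.

Lemma BM_le f g : measurable_fun [set: 'rV[R]_n] f -> BM g ->
  (forall x, `|f x| <= g x) -> BM f.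
Proof.
move=> mf [mg [M [gM g0]]] fg; split => //; exists M; split => x.
  exact: le_trans (fg x) (le_trans (ler_norm _) (gM x)).
by move=> /g0 gx0; have := fg x; rewrite gx0 normr_le0 => /eqP.
Qed.

Lemma BM_continuous f M : continuous f -> (forall x, M <= `|x| -> f x = 0) -> BM f.
Proof.
move=> cf f0; split; first exact: measurable_fun_continuous.
have cK : compact [set x : 'rV[R]_n | `|x| <= `|M|].
  apply: bounded_closed_compact.
    by exists `|M|; split => // N MN x /= h; exact: le_trans h (ltW MN).
  apply: (@closed_comp _ _ (fun x : 'rV[R]_n => `|x|) [set y | y <= `|M|]).
    by move=> x _; exact: norm_continuous.
  exact: closed_le.
have /compact_bounded[K [Kr hK]] : compact (f @` [set x : 'rV[R]_n | `|x| <= `|M|]).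
  by apply: continuous_compact => //; exact: continuous_subspaceT.
exists (Num.max `|M| (`|K| + 1)); split => x; last first.
  by rewrite ge_max => /andP[h _]; apply: f0; exact: le_trans (ler_norm _) h.
have [h|h] := lerP `|x| `|M|.
  rewrite le_max; apply/orP; right; apply: (hK (`|K| + 1)); last by exists x.
  by apply: le_lt_trans (ler_norm _) _; rewrite ltrDl.
by rewrite f0 ?normr0 ?le_max ?normr_ge0//; exact: le_trans (ler_norm _) (ltW h).
Qed.

Lemma LintD f g : BM f -> BM g -> Lint (fun x => f x + g x) = Lint f + Lint g.
Proof. by move=> /BM_integrable mf /BM_integrable mg; rewrite /Lint RintegralD. Qed.

Lemma LintZ k f : BM f -> Lint (fun x => k * f x) = k * Lint f.
Proof. by move=> /BM_integrable mf; rewrite /Lint RintegralZl. Qed.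

Lemma LintN f : BM f -> Lint (fun x => - f x) = - Lint f.
Proof.
by move=> mf; rewrite -mulN1r -LintZ//; congr Lint; apply/funext => x; rewrite mulN1r.
Qed.

Lemma LintB f g : BM f -> BM g -> Lint (fun x => f x - g x) = Lint f - Lint g.
Proof. by move=> mf mg; rewrite LintD ?LintN//; exact: BMN. Qed.

Lemma Lint0 : Lint (fun=> 0) = 0.
Proof. by rewrite /Lint /Rintegral; under eq_integral do []; rewrite integral0. Qed.

Lemma Lint_sum (T : Type) (s : seq T) (F : T -> 'rV[R]_n -> R) :
  (forall i, BM (F i)) -> Lint (fun x => \sum_(i <- s) F i x) = \sum_(i <- s) Lint (F i).
Proof.
move=> BF; elim: s => [|a s ih].
  by under eq_fun do rewrite big_nil; rewrite big_nil Lint0.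
under eq_fun do rewrite big_cons.
by rewrite big_cons LintD ?ih//; exact: BM_sum.
Qed.

Lemma Lint_ge0 f : (forall x, 0 <= f x) -> 0 <= Lint f.
Proof. by move=> f0; exact: Rintegral_ge0. Qed.

Lemma Lint_le f g : BM f -> BM g -> (forall x, f x <= g x) -> Lint f <= Lint g.
Proof.
move=> mf mg fg; rewrite -subr_ge0 -LintB//; apply: Lint_ge0 => x.
by rewrite subr_ge0.
Qed.

Lemma Lint_abs_le f g : BM f -> BM g -> (forall x, `|f x| <= g x) -> `|Lint f| <= Lint g.
Proof.
move=> mf mg fg; rewrite ler_norml -LintN//; apply/andP; split; apply: Lint_le => //.
- exact: BMN.
- by move=> x; have := fg x; rewrite ler_norml => /andP[].
- by move=> x; exact: le_trans (ler_norm _) (fg x).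
Qed.

Lemma BM_indic (A : set 'rV[R]_n) M : measurable A -> (forall x, A x -> `|x| < M) ->
  BM (\1_A).
Proof.
move=> mA AM; split; first exact: measurable_indic.
exists (Num.max 1 M); split => x.
  by rewrite ger0_norm ?indicE// le_max lern1 leq_b1.
rewrite ge_max => /andP[_ h]; rewrite indicE memNset// => /AM.
by rewrite ltNge h.
Qed.

Lemma Lint_box (a b : 'rV[R]_n) : (forall i, a ord0 i <= b ord0 i) ->
  Lint (\1_(box a b)) = \prod_(i < n) (b ord0 i - a ord0 i).
Proof.
move=> ab; rewrite /Lint /Rintegral integral_indic ?setIT//.
  by have /= -> := lebesgue_box ab.
exact: measurable_open_box.
Qed.

Lemma box_bounded (a b x : 'rV[R]_n) : box a b x -> `|x| < `|a| + `|b| + 1.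
Proof.
move=> xab; have h : 0 <= `|a| + `|b| by exact: addr_ge0.
rewrite normr_rV_lt ?ltr_wpDl// => i.
have /andP[h1 h2] := xab i.
have := normr_coord_le a i; have := normr_coord_le b i.
have := normr_ge0 a; have := normr_ge0 b; have := ler_norm (b ord0 i); have := ler_norm (- a ord0 i); rewrite normrN.
move=> ? ? ? ? ? ?; rewrite ltr_norml; apply/andP; split; lra.
Qed.

Lemma BM_box (a b : 'rV[R]_n) : BM (\1_(box a b)).
Proof. by apply: BM_indic (@box_bounded a b); exact: measurable_open_box. Qed.

End bounded_functions.

(** * Slicing off the first coordinate *)

Section iterated.
Context {R : realType}.

Lemma rV_consE0 n (t : R) (x : 'rV[R]_n) : rV_cons (t, x) ord0 ord0 = t.
Proof. by rewrite mxE unlift_none. Qed.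

Lemma rV_consES n (t : R) (x : 'rV[R]_n) i : rV_cons (t, x) ord0 (lift ord0 i) = x ord0 i.
Proof. by rewrite mxE liftK. Qed.

Lemma rV_cons0_le n (t : R) (x : 'rV[R]_n) : `|t| <= `|rV_cons (t, x)|.
Proof. by rewrite -{1}(rV_consE0 t x) normr_coord_le. Qed.

Lemma rV_consS_le n (t : R) (x : 'rV[R]_n) : `|x| <= `|rV_cons (t, x)|.
Proof. by apply/normr_rV_le => // i; rewrite -(rV_consES t x) normr_coord_le. Qed.

Lemma rV_consD0 n (t h : R) (x : 'rV[R]_n) :
  rV_cons (t + h, x) = rV_cons (t, x) + h *: delta_mx ord0 ord0.
Proof.
apply/rowP => i; rewrite !mxE/=; case: unliftP => [j ->|->] /=.
  by rewrite mulr0 addr0.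
by rewrite mulr1.
Qed.

Lemma rV_consDS n (t h : R) (x : 'rV[R]_n) (j : 'I_n) :
  rV_cons (t, x + h *: delta_mx ord0 j) =
  rV_cons (t, x) + h *: delta_mx ord0 (lift ord0 j).
Proof.
apply/rowP => i; rewrite !mxE/=; case: unliftP => [k ->|->] /=.
  by rewrite !mxE/= (inj_eq lift_inj).
by rewrite mulr0 addr0.
Qed.

Lemma continuous_rV_cons0 n (x : 'rV[R]_n) : continuous (fun t : R => rV_cons (t, x)).
Proof.
move=> t; apply/continuous_atP => e e0; exists e => // s st.
apply/normr_rV_lt => // i; rewrite !mxE; case: unliftP => [j _|_] //=.
by rewrite subrr normr0.
Qed.

Lemma continuous_rV_consS n (t : R) : continuous (fun x : 'rV[R]_n => rV_cons (t, x)).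
Proof.
move=> x; apply/continuous_atP => e e0; exists e => // y xy.
apply/normr_rV_lt => // i; rewrite !mxE; case: unliftP => [j _|_] /=.
  by move/normr_rV_lt : xy => /(_ e0 j); rewrite !mxE.
by rewrite subrr normr0.
Qed.

Lemma BM_cons_integrable n (f : 'rV[R]_n.+1 -> R) : BM f ->
  (lebesgue_measure \x lebesgue_rV n)%E.-integrable setT (EFin \o (f \o @rV_cons R n)).
Proof.
move=> /BMP[mf [M [M0 fM f0]]].
apply: (@bounded_support_integrable _ _ _ _ (@rV_cons R n @^-1` cube M) _ M) => //.
- rewrite -[X in measurable X]setTI; apply: measurable_rV_cons => //.
  exact: measurable_open_box.
- exact: (@lebesgue_box_lty R n.+1).
- by apply: measurableT_comp => //; exact: measurable_rV_cons.
- by move=> x; exact: fM.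
- by move=> x /(contra_not (cubeP (rV_cons x) M0).2)/negP; rewrite -leNgt => /f0.
Qed.

Lemma Lint_cons n (f : 'rV[R]_n.+1 -> R) : BM f ->
  Lint f = fine (\int[lebesgue_measure]_t \int[lebesgue_rV n]_x (f (rV_cons (t, x)))%:E)%E.
Proof.
move=> bf; rewrite /Lint /Rintegral; congr fine.
have := BM_cons_integrable bf => int.
rewrite /= (@integral_pushforward _ _ _ _ _ _ (@measurable_rV_cons R n) _ setT (EFin \o f))//=.
- rewrite preimage_setT.
  by rewrite -(integral12_prod_meas1 int).
- by case: bf => mf _; apply/measurable_EFinP.
Qed.

Lemma Lint_cons2 n (f : 'rV[R]_n.+1 -> R) : BM f ->
  Lint f = fine (\int[lebesgue_rV n]_x \int[lebesgue_measure]_t (f (rV_cons (t, x)))%:E)%E.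
Proof.
move=> bf; rewrite Lint_cons//; congr fine.
exact: (Fubini (BM_cons_integrable bf)).
Qed.

End iterated.

Section partial_integral.
Context {R : realType}.

(** A difference quotient sees only the values on one line, so derivatives transfer between
    functions on different spaces. Slices, translates and reflections are all handled this way. *)
Lemma is_derive_eqP (V W : normedModType R) (U : normedModType R) (f : V -> W) (g : U -> W)
    (x v : V) (y w : U) df :
  (forall h : R, f (h *: v + x) = g (h *: w + y)) ->
  is_derive x v f df -> is_derive y w g df.
Proof.
move=> fg [dvf <-].
have fg0 : f x = g y by have := fg 0; rewrite !scale0r !add0r.
have defE : (fun h : R => h^-1 *: ((f \o shift x) (h *: v) - f x)) =
         (fun h : R => h^-1 *: ((g \o shift y) (h *: w) - g y)).
  by apply/funext => h /=; rewrite fg fg0.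
by apply: DeriveDef; [move: dvf; rewrite /derivable defE|rewrite /derive defE].
Qed.

Lemma integral_derive1_compact (f f' : R -> R) (M : R) : 0 < M ->
  (forall x : R, is_derive x (1 : R) f (f' x)) -> continuous f' ->
  (forall x, M <= `|x| -> f x = 0) -> (forall x, M <= `|x| -> f' x = 0) ->
  (\int[lebesgue_measure]_t (f' t)%:E = 0)%E.
Proof.
move=> M0 df cf' f0 f'0.
have cf : continuous f by move=> x; apply: differentiable_continuous; apply/derivable1_diffP; case: (df x).
have -> : (\int[lebesgue_measure]_t (f' t)%:E =
           \int[lebesgue_measure]_(t in `[(- M)%R, M]) (f' t)%:E)%E.
  rewrite [RHS]integral_mkcond; apply: eq_integral => t _; rewrite patchE.
  case: ifPn => //; rewrite notin_setE/= in_itv/= -ler_norml => /negP.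
  by rewrite -ltNge => /ltW/f'0 ->.
rewrite (@continuous_FTC2 _ f' f)//.
- by rewrite (f0 M) ?ler_norm// (f0 (- M)) ?subee// normrN ler_norm.
- by lra.
- exact: continuous_subspaceT.
- split.
  + by move=> x _; case: (df x).
  + exact/cvg_at_right_filter/cf.
  + exact/cvg_at_left_filter/cf.
- by move=> x _; rewrite derive1E; case: (df x).
Qed.

(** The margin 1 leaves room for a ball around [x] on which [f] vanishes identically. *)
Lemma derive_zero_outside n (f f' : 'rV[R]_n -> R) (v : 'rV[R]_n) M :
  (forall x, is_derive x v f (f' x)) -> (forall x, M <= `|x| -> f x = 0) ->
  forall x, M + 1 <= `|x| -> f' x = 0.
Proof.
move=> df f0 x Mx; case: (df x) => _ <-.
rewrite (@near_eq_derive _ _ _ f (cst 0)) ?derive_cst//.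
apply/nbhs_normP; exists 1; [exact: ltr01|move=> y]; rewrite /ball_/= => xy; apply: f0.
have := ler_normD (x - y) y; rewrite subrK; lra.
Qed.

(* The induction slices off the first coordinate: Fubini in one order handles
   the first partial derivative, in the other order the remaining ones. *)
Lemma Lint_partial n (i : 'I_n) (f f' : 'rV[R]_n -> R) M :
  (forall x, is_derive x (delta_mx ord0 i) f (f' x)) -> continuous f' ->
  (forall x, M <= `|x| -> f x = 0) -> Lint f' = 0.
Proof.
elim: n i f f' M => [[]//|n ih] i f f' M df cf' f0.
have f'0 := derive_zero_outside df f0.
have bf' : BM f' by exact: BM_continuous f'0.
case: (unliftP ord0 i) => [j ij|i0].
  rewrite Lint_cons//; under eq_integral => t _.
    have bs : BM (fun x : 'rV[R]_n => f' (rV_cons (t, x))).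
      apply: (@BM_continuous _ _ _ (M + 1)).
        by move=> x; apply: continuous_comp; [exact: continuous_rV_consS|exact: cf'].
      by move=> x Mx; apply: f'0; exact: le_trans Mx (rV_consS_le _ _).
    have : Lint (fun x : 'rV[R]_n => f' (rV_cons (t, x))) = 0.
      apply: (ih j (fun x => f (rV_cons (t, x))) _ M).
      - move=> x; apply: is_derive_eqP (df (rV_cons (t, x))) => h.
        by rewrite addrC ij -rV_consDS addrC.
      - by move=> x; apply: continuous_comp; [exact: continuous_rV_consS|exact: cf'].
      - by move=> x Mx; apply: f0; exact: le_trans Mx (rV_consS_le _ _).
    rewrite /Lint /Rintegral => Lint0.
    have -> : (\int[lebesgue_rV n]_x (f' (rV_cons (t, x)))%:E = 0)%E.
      by rewrite -[LHS]fineK ?Lint0//; apply: integrable_fin_num => //; exact: BM_integrable bs.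
    over.
  by rewrite integral0.
rewrite Lint_cons2//; under eq_integral => x _.
  have -> : (\int[lebesgue_measure]_t (f' (rV_cons (t, x)))%:E = 0)%E.
    apply: (@integral_derive1_compact (fun t => f (rV_cons (t, x))) (fun t => f' (rV_cons (t, x))) (`|M| + 1)).
    - by rewrite ltr_wpDl.
    - move=> t; apply: is_derive_eqP (df (rV_cons (t, x))) => h.
      by rewrite addrC i0 -rV_consD0 addrC [_ *: 1]mulr1.
    - by move=> t; apply: continuous_comp; [exact: continuous_rV_cons0|exact: cf'].
    - move=> t Mt; apply: f0; apply: le_trans (rV_cons0_le _ _).
      by apply: le_trans Mt; apply: le_trans (ler_norm M) _; rewrite lerDl.
    - move=> t Mt; apply: f'0; apply: le_trans (rV_cons0_le _ _).
      by apply: le_trans Mt; rewrite lerD2r ler_norm.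
  over.
by rewrite integral0.
Qed.

(** The translated measure has the same values on boxes, which form a generating pi-system exhausted
    by cubes of finite measure, so it equals the original measure. *)
Lemma Lint_translate n (f : 'rV[R]_n -> R) (c : 'rV[R]_n) :
  BM f -> Lint (fun x => f (x + c)) = Lint f.
Proof.
move=> bf.
have mc : measurable_fun [set: 'rV[R]_n] (fun x : 'rV[R]_n => x + c).
  apply: measurable_fun_rVP => i; under eq_fun do rewrite mxE.
  by apply: measurable_funD => //; exact: measurable_coord.
pose mu : {measure set 'rV[R]_n -> \bar R} := lebesgue_rV n.
have defE (A : set 'rV[R]_n) : measurable A -> mu A = pushforward mu (fun x => x + c) A.
  apply: (measure_unique boxes cubek) => //.
  - exact: measurable_boxes.
  - exact: setI_boxes.
  - by move=> k; eexists; eexists; reflexivity.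
  - exact: cubek_cover.
  - move=> _ [a [b ->]]; transitivity (mu ((fun x => x + c) @^-1` box a b)); last by [].
    have -> : (fun x => x + c) @^-1` box a b = box (a - c) (b - c).
      by apply/seteqP; split => x xab i; have := xab i; rewrite !mxE ltrBlDr ltrBrDr.
    have [ab|/existsNP[i /negP]] := pselect (forall i, a ord0 i <= b ord0 i).
      have := lebesgue_box ab; rewrite /mu /= => ->.
      have := @lebesgue_box _ _ (a - c) (b - c); rewrite /= => ->; last first.
        by move=> i; rewrite !mxE lerD2r.
      by congr EFin; apply: eq_bigr => i _; rewrite !mxE; ring.
    rewrite -ltNge => bai; rewrite (_ : box a b = set0).
      rewrite (_ : box _ _ = set0) ?measure0//.
      apply/seteqP; split => // x /(_ i); rewrite !mxE => /andP[/lt_trans h /h].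
      by rewrite ltrD2r ltNge (ltW bai).
    apply/seteqP; split => // x /(_ i) /andP[/lt_trans h /h].
    by rewrite ltNge (ltW bai).
  - by move=> k; exact: lebesgue_box_lty.
rewrite /Lint /Rintegral; congr fine.
have bfc : BM (fun x => f (x + c)).
  move/BMP : bf => [mf [M [M0 fM f0]]]; split.
    exact: (measurableT_comp mf mc).
  exists (M + `|c|); split => x.
    by apply: le_trans (fM _) _; rewrite lerDl.
  move=> h; apply: f0; have := ler_normB (x + c) c; rewrite addrK; lra.
transitivity (\int[pushforward mu (fun x : 'rV[R]_n => (x + c)%R)]_x (f x)%:E)%E.
  rewrite (@integral_pushforward _ _ _ _ _ _ mc _ setT (EFin \o f))//=.
  - by case: bf => mf _; apply/measurable_EFinP.
  - by rewrite preimage_setT; exact: BM_integrable bfc.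
apply: eq_measure_integral => A mA _; exact/esym/defE.
Qed.

End partial_integral.

(** * Calculus and bump functions *)

Section flat_functions.
Context {R : realType}.
Implicit Types (p q : {poly R}).

(* These functions t |-> p(1/t) exp(-1/t), extended by 0 to t <= 0, are stable
   under differentiation. *)
Definition flat p (t : R) : R := if 0 < t then p.[t^-1] * expR (- t^-1) else 0.

(** By induction on [p], the bound with exponent [a / 2] controls the lower-degree factor, and the
    other half of the exponential absorbs the extra factor [y]. *)
Lemma poly_expR_bound p (a : R) : 0 < a ->
  exists2 C, 0 < C & forall y, 0 <= y -> `|p.[y]| <= C * expR (a * y).
Proof.
elim/poly_ind: p a => [|p c ih] a a0.
  by exists 1 => // y _; rewrite horner0 normr0 mul1r expR_ge0.
have a20 : 0 < a / 2 by rewrite divr_gt0.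
have [C C0 hC] := ih _ a20.
exists (C / (a / 2) + `|c|); first by rewrite ltr_pwDl// divr_gt0.
move=> y y0; rewrite hornerMXaddC; apply: le_trans (ler_normD _ _) _.
rewrite mulrDl; apply: lerD; last first.
  by rewrite ler_peMr// -expR0 ler_expR mulr_ge0// ltW.
have -> : a * y = a / 2 * y + a / 2 * y by field.
rewrite expRD normrM (ger0_norm y0).
have -> : C / (a / 2) * (expR (a / 2 * y) * expR (a / 2 * y)) =
  (C * expR (a / 2 * y)) * (expR (a / 2 * y) / (a / 2)) by field; lra.
apply: ler_pM => //; first exact: hC.
rewrite ler_pdivlMr// mulrC; apply: le_trans (expR_ge1Dx _).
by rewrite lerDr.
Qed.

Lemma flat_le0 p t : t <= 0 -> flat p t = 0.
Proof. by rewrite /flat leNgt => /negPf ->. Qed.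

(** Quadratic decay at 0 makes the derivative vanish at the gluing point. It comes from the
    exponential bound for [p * 'X^2] taken at [t^-1]. *)
Lemma flat_sqr_bound p : exists2 C, 0 < C & forall t, `|flat p t| <= C * t ^+ 2.
Proof.
have [C C0 hC] := poly_expR_bound (p * 'X^2) (@ltr01 R).
exists C => // t; rewrite /flat; case: ifPn => [t0|_]; last first.
  by rewrite normr0 mulr_ge0 ?sqr_ge0// ltW.
have ti : 0 < t^-1 by rewrite invr_gt0.
have := hC _ (ltW ti); rewrite hornerM hornerXn mul1r normrM normrX => h; rewrite normrM; move: h.
rewrite (ger0_norm (ltW ti)) (ger0_norm (expR_ge0 _)) expRN => h.
rewrite ler_pdivrMr ?expR_gt0//.
have -> : `|p.[t^-1]| = `|p.[t^-1]| * t^-1 ^+ 2 * t ^+ 2 by field; rewrite gt_eqF.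
by apply: le_trans (ler_wpM2r (sqr_ge0 t) h) _; rewrite mulrAC.
Qed.

(** With [s = 1 / t] one has d/dt = - s^2 d/ds, applied here to p(s) exp(-s). *)
Definition dflat p : {poly R} := 'X^2 * (p - p^`()).

Lemma is_derive_flat p (t : R) : is_derive t (1 : R) (flat p) (flat (dflat p) t).
Proof.
have [t0|t0|->] := ltrgtP t 0.
- rewrite (flat_le0 _ (ltW t0)).
  have defE : {near t, cst 0 =1 flat p}.
    by near=> s; rewrite flat_le0//; apply: ltW; near: s; exact: lt_nbhsl.
  apply: DeriveDef; first exact: (near_eq_derivable defE (derivable_cst 0 t 1)).
  by rewrite -(near_eq_derive _ defE) derive_cst.
- have defE : {near t, (fun s => p.[s^-1] * expR (- s^-1)) =1 flat p}.
    by near=> s; rewrite /flat ifT//; near: s; exact: lt_nbhsr.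
  have tn0 : t != 0 by rewrite gt_eqF.
  have di : is_derive t 1 (fun s : R => s^-1) (- t ^- 2).
    by have := @is_deriveV R id t 1 1 tn0 _; rewrite [_ *: 1]mulr1; apply.
  have d1 : is_derive t 1 (fun s => p.[s^-1]) (p^`().[t^-1] * - t ^- 2).
    exact: (@is_derive1_comp _ (horner p) (fun s : R => s^-1)).
  have d2 : is_derive t 1 (fun s : R => expR (- s^-1)) (expR (- t^-1) * t ^- 2).
    apply: (@is_derive1_comp _ expR (fun s : R => - s^-1)).
    by rewrite -[t ^- 2]opprK; apply: is_deriveN.
  have [D _] := is_deriveM d1 d2.
  apply: DeriveDef; first exact: (near_eq_derivable defE D).
  rewrite -(near_eq_derive _ defE).
  case: (is_deriveM d1 d2) => _ ->.
  rewrite /flat t0 /dflat !hornerE /GRing.scale/=; field.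
  by rewrite gt_eqF.
- have [C C0 hC] := flat_sqr_bound p.
  rewrite (flat_le0 _ (lexx 0)).
  (* The convention that the inverse of 0 is 0 gives the slope function the value 0 at 0, which is
     the derivative sought; the quadratic bound makes it continuous there. *)
  apply/is_derive1_caratheodory; exists (fun z => flat p z / z); split.
  + move=> z; rewrite (flat_le0 _ (lexx 0)) !subr0.
    by have [->|z0] := eqVneq z 0; [rewrite mulr0 flat_le0|rewrite divfK].
  + apply/continuous_atP => e e0; exists (e / C); first exact: divr_gt0.
    move=> z; rewrite invr0 mulr0 !subr0 ltr_pdivlMr// => h.
    have [->|z0] := eqVneq z 0; first by rewrite invr0 mulr0 normr0.
    rewrite normrM normfV ltr_pdivrMr ?normr_gt0//.
    apply: le_lt_trans (hC z) _; rewrite -real_normK ?num_real// expr2 mulrA.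
    by rewrite ltr_pM2r ?normr_gt0// mulrC.
  + by rewrite invr0 mulr0.
Unshelve. all: by end_near.
Qed.

Lemma continuous_flat p : continuous (flat p).
Proof.
move=> t; apply: differentiable_continuous; apply/derivable1_diffP.
by case: (is_derive_flat p t).
Qed.

Definition flat1 : R -> R := flat 1.
Definition dflat1 : R -> R := flat (dflat 1).

Lemma flat1_ge0 t : 0 <= flat1 t.
Proof. by rewrite /flat1 /flat; case: ifP => // _; rewrite hornerC mul1r expR_ge0. Qed.

Lemma flat1_gt0 t : 0 < t -> 0 < flat1 t.
Proof. by move=> t0; rewrite /flat1 /flat t0 hornerC mul1r expR_gt0. Qed.

Lemma flat1_le0 t : t <= 0 -> flat1 t = 0.
Proof. exact: flat_le0. Qed.

Lemma flat1_le1 t : flat1 t <= 1.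
Proof.
rewrite /flat1 /flat; case: ifP => // t0; rewrite hornerC mul1r -expR0 ler_expR.
by rewrite oppr_le0 invr_ge0 ltW.
Qed.

Lemma dflat1_ge0 t : 0 <= dflat1 t.
Proof.
rewrite /dflat1 /flat; case: ifP => // _; rewrite /dflat derivC !hornerE.
by rewrite subr0 mulr1 mulr_ge0 ?expR_ge0// exprn_even_ge0.
Qed.

Lemma dflat1_gt0 t : 0 < t -> 0 < dflat1 t.
Proof.
move=> t0; rewrite /dflat1 /flat t0 /dflat derivC !hornerE.
by rewrite subr0 mulr1 mulr_gt0 ?expR_gt0// exprn_gt0// invr_gt0.
Qed.

Lemma is_derive_flat1 (t : R) : is_derive t (1 : R) flat1 (dflat1 t).
Proof. exact: is_derive_flat. Qed.

Lemma continuous_flat1 : continuous flat1. Proof. exact: continuous_flat. Qed.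
Lemma continuous_dflat1 : continuous dflat1. Proof. exact: continuous_flat. Qed.

Lemma flat1_cvg1 (t : R) : 0 < t -> flat1 (k%:R * t) @[k --> \oo] --> (1 : R).
Proof.
move=> t0; apply/cvgrPdist_lt => e e0; near=> k.
have k0 : 0 < k%:R :> R by rewrite ltr0n; near: k; exists 1%N.
have kt : 0 < k%:R * t by rewrite mulr_gt0.
rewrite ger0_norm ?subr_ge0 ?flat1_le1//.
rewrite /flat1 /flat kt hornerC mul1r.
have := expR_ge1Dx (- (k%:R * t)^-1).
suff : (k%:R * t)^-1 < e by lra.
rewrite invf_plt ?posrE//.
rewrite -ltr_pdivrMr//.
near: k; exists (Num.bound (e^-1 / t)) => // k /= hk.
apply: lt_le_trans (archi_boundP _) _; last by rewrite ler_nat.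
by rewrite divr_ge0 ?invr_ge0 ?ltW.
Unshelve. all: by end_near.
Qed.

End flat_functions.

(** * Gradients and functions of class C^1 *)

Section gradients.
Context {R : realType} {n : nat}.
Implicit Types (f g : 'rV[R]_n -> R) (D : set 'rV[R]_n) (x : 'rV[R]_n).

Lemma gradE f x i : grad f x ord0 i = partial i f x.
Proof. by rewrite mxE. Qed.

Lemma diff_grad f x v : differentiable f x -> 'd f x v = dot (grad f x) v.
Proof.
move=> df; rewrite {1}(row_sum_delta v) linear_sum /dot; apply: eq_bigr => i _.
by rewrite linearZ/= -deriveE// mxE /partial mulrC.
Qed.

Lemma derive_grad f x v : differentiable f x -> 'D_v f x = dot (grad f x) v.
Proof. by move=> df; rewrite deriveE// diff_grad. Qed.

Lemma grad_eq f g x : (\near x, f x = g x) -> grad f x = grad g x.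
Proof. by move=> fg; apply/rowP => i; rewrite !mxE; exact: near_eq_derive. Qed.

(** Typed into [R^o] so that it can carry a linear structure and be compared with a differential. *)
Definition dotl (g : 'rV[R]_n) : 'rV[R]_n -> R^o := dot g.

Lemma dotl_linear (g : 'rV[R]_n) : linear (dotl g).
Proof.
move=> k u v; rewrite /dotl /dot scaler_sumr -big_split/=; apply: eq_bigr => i _.
by rewrite !mxE mulrDr [X in X + _]mulrCA.
Qed.

HB.instance Definition _ (g : 'rV[R]_n) :=
  GRing.isLinear.Build R 'rV[R]_n R^o *:%R (dotl g) (dotl_linear g).

Lemma dot_norm_le (u v : 'rV[R]_n) : `|dot u v| <= n%:R * `|u| * `|v|.
Proof.
apply: le_trans (ler_norm_sum _ _ _) _.
have -> : n%:R * `|u| * `|v| = \sum_(i < n) `|u| * `|v|.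
  by rewrite sumr_const card_ord -[RHS]mulr_natl mulrA.
by apply: ler_sum => i _; rewrite normrM ler_pM// normr_coord_le.
Qed.

Lemma continuous_dot (g : 'rV[R]_n) : continuous (dot g : 'rV[R]_n -> R).
Proof.
move=> x; apply/continuous_atP => e e0.
have c0 : 0 < n%:R * `|g| + 1 by rewrite ltr_wpDl// mulr_ge0.
exists (e / (n%:R * `|g| + 1)); first exact: divr_gt0.
move=> y; rewrite ltr_pdivlMr// => h.
have -> : dot g y - dot g x = dot g (y - x).
  by rewrite /dot -sumrB; apply: eq_bigr => i _; rewrite !mxE mulrBr.
apply: le_lt_trans (dot_norm_le _ _) _; apply: le_lt_trans h.
by rewrite mulrC ler_wpM2l// lerDl.
Qed.

Lemma differentiable_expansion f x : differentiable f x ->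
  forall e, 0 < e -> exists2 d, 0 < d &
    forall h, `|h| < d -> `|f (h + x) - f x - dot (grad f x) h| <= e * `|h|.
Proof.
move=> df e e0; have [_ defE] := (diff_locallyP _ _).1 df.
move/eqaddoP : defE => /(_ _ e0) /nbhs_normP[d d0 hd]; exists d => // h hd'.
have := hd h; rewrite /ball_/= sub0r normrN => /(_ hd').
by rewrite !fctE/= -diff_grad// opprD addrA.
Qed.

(** The expansion identifies the differential with [dot g] by uniqueness, and evaluation on the
    basis vectors identifies [g] with the gradient. This is the way to differentiate functions known
    only through estimates, such as [half_sqr H0]. *)
Lemma expansion_differentiable f x (g : 'rV[R]_n) :
  (forall e, 0 < e -> exists2 d, 0 < d &
    forall h, `|h| < d -> `|f (h + x) - f x - dot g h| <= e * `|h|) ->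
  differentiable f x /\ grad f x = g.
Proof.
move=> H.
have cg : continuous (dot g : 'rV[R]_n -> R) by exact: continuous_dot.
pose W : normedModType R := R^o.
pose df : {linear 'rV[R]_n -> R^o} := dotl g; pose F : 'rV[R]_n -> W := f.
have defE : F \o shift x = cst (F x) + (df : 'rV[R]_n -> W) +o_ (0 : 'rV[R]_n) id.
  apply/eqaddoP => e e0; have [d d0 hd] := H e e0.
  suff: nbhs (0 : 'rV[R]_n) (fun y => `|(F \o shift x - (cst (F x) + (df : 'rV[R]_n -> W))) y| <= e * `|y|) by [].
  apply/nbhs_ballP; exists d => //= h; rewrite -ball_normE /ball_/= sub0r normrN => /hd.
  by rewrite opprD addrA.
have dflat1 : 'd F x = df :> ('rV[R]_n -> W) := @diff_unique R 'rV[R]_n R^o F df x cg defE.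
have dff : differentiable f x.
  by apply/(@diff_locallyP R 'rV[R]_n W x F); rewrite dflat1; split.
split => //; apply/rowP => i; rewrite mxE /partial deriveE//.
have -> : 'd f x (delta_mx ord0 i) = df (delta_mx ord0 i) by rewrite -dflat1.
rewrite /df/= /dotl /dot (bigD1 i)//= mxE !eqxx mulr1 big1 ?addr0// => j ji.
by rewrite mxE (negPf ji) andbF mulr0.
Qed.

Lemma differentiable_eq f g x : (\near x, f x = g x) -> differentiable f x -> differentiable g x.
Proof.
move=> fg df; have fgx : f x = g x by exact: nbhs_singleton fg.
apply: (@expansion_differentiable g x (grad f x) _).1 => e e0.
have [d d0 hd] := differentiable_expansion df e0.
have /nbhs_normP[d' d'0 hd'] := fg.
exists (Num.min d d'); first by rewrite lt_min d0.
move=> h; rewrite lt_min => /andP[h1 h2].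
have <- : f (h + x) = g (h + x).
  by apply: hd'; rewrite /ball_/= opprD addrCA subrr addr0 normrN.
by rewrite -fgx; exact: hd.
Qed.

Lemma gradD f g x : differentiable f x -> differentiable g x ->
  grad (fun y => f y + g y) x = grad f x + grad g x.
Proof.
move=> df dg; apply/rowP => i; rewrite !mxE /partial.
by rewrite deriveD//; exact: diff_derivable.
Qed.

Lemma gradM f g x : differentiable f x -> differentiable g x ->
  grad (fun y => f y * g y) x = f x *: grad g x + g x *: grad f x.
Proof.
move=> df dg; apply/rowP => i; rewrite !mxE /partial.
by rewrite deriveM//; exact: diff_derivable.
Qed.

Lemma grad_cst (k : R) x : grad (cst k : 'rV[R]_n -> R) x = 0.
Proof. by apply/rowP => i; rewrite !mxE /partial derive_cst. Qed.

Lemma differentiable_comp1 f (g : R -> R) dg x : differentiable f x ->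
  is_derive (f x) 1 g dg -> differentiable (fun y => g (f y)) x.
Proof.
by move=> df [dgf _]; apply: differentiable_comp => //; exact/derivable1_diffP.
Qed.

Lemma grad_comp f (g : R -> R) dg x : differentiable f x ->
  is_derive (f x) 1 g dg -> grad (fun y => g (f y)) x = dg *: grad f x.
Proof.
move=> df dgf; have dc := differentiable_comp1 df dgf.
apply/rowP => i; rewrite !mxE /partial.
rewrite (deriveE _ dc) (deriveE _ df) (diff_comp df); last first.
  by apply/derivable1_diffP; case: dgf.
have dg1 : differentiable g (f x) by apply/derivable1_diffP; case: dgf.
rewrite /= -[X in 'd g (f x) X]mulr1 [in LHS]linearZ/= -(deriveE (1 : R) dg1) -(deriveE _ df).
by case: dgf => _ dgE; rewrite dgE mulrC.
Qed.

Lemma differentiable_coordr (i : 'I_n) x : differentiable (fun y : 'rV[R]_n => y ord0 i) x.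
Proof. exact: differentiable_coord. Qed.

Lemma grad_coord (i : 'I_n) x : grad (fun y : 'rV[R]_n => y ord0 i) x = delta_mx ord0 i.
Proof.
apply/rowP => j; rewrite !mxE /partial eqxx /=.
rewrite /derive; apply: cvg_lim => //.
apply: cvg_near_cst; near=> h.
rewrite /= !mxE eqxx/= addrK [_ *: _]mulrA mulVf ?mul1r; last by near: h; exact: nbhs_dnbhs_neq.
by rewrite eq_sym.
Unshelve. all: by end_near.
Qed.

End gradients.

Section C1_calculus.
Context {R : realType} {n : nat}.
Implicit Types (f g : 'rV[R]_n -> R) (D : set 'rV[R]_n) (x : 'rV[R]_n).

Lemma continuous_rVP (T : topologicalType) (F : T -> 'rV[R]_n) (x : T) :
  {for x, continuous F} <-> forall i, {for x, continuous (fun y => F y ord0 i)}.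
Proof.
split=> [cF i|cF].
  by apply: (@continuous_comp _ _ _ F (fun M : 'rV[R]_n => M ord0 i)) => //; exact: coord_continuous.
apply/cvg_ballP => e e0.
suff : \forall y \near x, forall i, `|F x ord0 i - F y ord0 i| < e by apply: filterS => y h; apply/ball_rVP.
apply: filter_forall => j.
exact: ((cvgrPdist_lt _ _).1 (cF j) e e0).
Qed.

Lemma C1_differentiable D f x : C1_on D f -> D x -> differentiable f x.
Proof. by move=> cf /cf[]. Qed.

Lemma C1_grad_continuous D f x : C1_on D f -> D x -> {for x, continuous (grad f)}.
Proof. by move=> cf /cf[]. Qed.

Lemma C1_continuous D f x : C1_on D f -> D x -> {for x, continuous f}.
Proof. by move=> cf /cf[df _]; exact: differentiable_continuous. Qed.

Lemma C1_on_sub D D' f : D' `<=` D -> C1_on D f -> C1_on D' f.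
Proof. by move=> DD' cf x /DD'/cf. Qed.

Lemma open_near D x : open D -> D x -> \forall y \near x, D y.
Proof. by move=> oD Dx; exact: open_nbhs_nbhs. Qed.

Lemma continuous_near_eq (V : topologicalType) (F G : 'rV[R]_n -> V) x :
  (\forall y \near x, F y = G y) -> {for x, continuous F} -> {for x, continuous G}.
Proof.
move=> FG cF; have FGx : F x = G x by exact: nbhs_singleton FG.
move=> A; rewrite -FGx => /cF; rewrite /nbhs/= => h.
by apply: filterS2 FG h => y /= ->.
Qed.

Lemma C1_onD D f g : open D -> C1_on D f -> C1_on D g -> C1_on D (fun x => f x + g x).
Proof.
move=> oD cf cg x Dx; have [df cdf] := cf x Dx; have [dg cdg] := cg x Dx.
split; first exact: differentiableD.
apply: (@continuous_near_eq _ (fun y => grad f y + grad g y)).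
  apply: filterS (open_near oD Dx) => y Dy.
  by rewrite gradD//; [exact: C1_differentiable cf Dy|exact: C1_differentiable cg Dy].
exact: (continuousD cdf cdg).
Qed.

Lemma C1_onM D f g : open D -> C1_on D f -> C1_on D g -> C1_on D (fun x => f x * g x).
Proof.
move=> oD cf cg x Dx; have [df cdf] := cf x Dx; have [dg cdg] := cg x Dx.
split; first exact: differentiableM.
apply: (@continuous_near_eq _ (fun y => f y *: grad g y + g y *: grad f y)).
  apply: filterS (open_near oD Dx) => y Dy.
  by rewrite gradM//; [exact: C1_differentiable cf Dy|exact: C1_differentiable cg Dy].
have c1 := continuousZ (differentiable_continuous df) cdg.
have c2 := continuousZ (differentiable_continuous dg) cdf.
exact: (continuousD c1 c2).
Qed.

Lemma C1_on_cst D (k : R) : C1_on D (fun=> k).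
Proof.
move=> x _; split; first exact: differentiable_cst.
have -> : grad (fun=> k : R) = (fun=> 0 : 'rV[R]_n) by apply/funext => y; exact: grad_cst.
exact: cst_continuous.
Qed.

Lemma C1_on_coord D (i : 'I_n) : C1_on D (fun x => x ord0 i).
Proof.
move=> x _; split; first exact: differentiable_coordr.
rewrite (_ : grad _ = cst (delta_mx ord0 i)); first exact: cst_continuous.
by apply/funext => y; exact: grad_coord.
Qed.

Lemma C1_on_comp D f (g dg : R -> R) : open D -> C1_on D f ->
  (forall x, D x -> is_derive (f x) (1 : R) g (dg (f x))) ->
  (forall x, D x -> {for f x, continuous dg}) ->
  C1_on D (fun x => g (f x)).
Proof.
move=> oD cf dgf cdg x Dx; have [df cdf] := cf x Dx.
split; first exact: differentiable_comp1 (dgf x Dx).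
apply: (@continuous_near_eq _ (fun y => dg (f y) *: grad f y)).
  apply: filterS (open_near oD Dx) => y Dy.
  by rewrite (grad_comp _ (dgf y Dy))//; exact: C1_differentiable cf Dy.
apply: continuousZ => //.
by apply: continuous_comp (cdg x Dx); exact: differentiable_continuous.
Qed.

Lemma C1_onZ D (k : R) f : open D -> C1_on D f -> C1_on D (fun x => k * f x).
Proof. by move=> oD cf; exact: (C1_onM oD (@C1_on_cst D k) cf). Qed.

Lemma gradZ (k : R) f x : differentiable f x -> grad (fun y => k * f y) x = k *: grad f x.
Proof.
move=> df; rewrite gradM//.
by rewrite [grad (fun=> k) x]grad_cst scaler0 addr0.
Qed.

Lemma C1_onN D f : open D -> C1_on D f -> C1_on D (fun x => - f x).
Proof. by move=> oD /(C1_onZ (-1) oD); under eq_fun do rewrite mulN1r. Qed.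

Lemma gradN f x : differentiable f x -> grad (fun y => - f y) x = - grad f x.
Proof.
by move=> df; rewrite -scaleN1r -gradZ//; congr grad; apply/funext => y; rewrite mulN1r.
Qed.

Lemma C1_onB D f g : open D -> C1_on D f -> C1_on D g -> C1_on D (fun x => f x - g x).
Proof. by move=> oD cf /(C1_onN oD); exact: C1_onD. Qed.

Lemma gradB f g x : differentiable f x -> differentiable g x ->
  grad (fun y => f y - g y) x = grad f x - grad g x.
Proof. by move=> df dg; rewrite gradD ?gradN//; exact: differentiableN. Qed.

Lemma is_derive_inv (t : R) : t != 0 -> is_derive t (1 : R) (fun s => s^-1) (- t ^- 2).
Proof. by move=> t0; have := @is_deriveV R id t 1 1 t0 _; rewrite [_ *: 1]mulr1; apply. Qed.

Lemma continuous_inv_sqr (t : R) : t != 0 -> {for t, continuous (fun s : R => - s ^- 2)}.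
Proof.
move=> t0; apply: continuousN; apply: continuousV; first by rewrite sqrf_eq0.
exact: exprn_continuous.
Qed.

Lemma C1_onV D f : open D -> C1_on D f -> (forall x, D x -> f x != 0) ->
  C1_on D (fun x => (f x)^-1).
Proof.
move=> oD cf f0; apply: (@C1_on_comp D f _ (fun s : R => - s ^- 2)) => // x Dx.
  exact/is_derive_inv/f0.
exact/continuous_inv_sqr/f0.
Qed.

Lemma C1_on_sum D (T : Type) (s : seq T) (F : T -> 'rV[R]_n -> R) : open D ->
  (forall i, C1_on D (F i)) -> C1_on D (fun x => \sum_(i <- s) F i x).
Proof.
move=> oD cF; elim: s => [|a s ih].
  by under eq_fun do rewrite big_nil; exact: C1_on_cst.
by under eq_fun do rewrite big_cons; exact: (C1_onD oD (cF a) ih).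
Qed.

End C1_calculus.

Section smooth_functions.
Context {R : realType} {n : nat}.

(** A class described by generators and stable under every [partial i]: membership then yields
    [smooth] by induction on the list of directions, with no computation of iterated derivatives. *)
Inductive flat_algebra : ('rV[R]_n -> R) -> Prop :=
| flat_algebra_flat p c (i : 'I_n) d : flat_algebra (fun x => flat p (c * x ord0 i + d))
| flat_algebra_cst k : flat_algebra (fun=> k)
| flat_algebraD f g : flat_algebra f -> flat_algebra g -> flat_algebra (fun x => f x + g x)
| flat_algebraM f g : flat_algebra f -> flat_algebra g -> flat_algebra (fun x => f x * g x).

Lemma flat_algebra_partial f : flat_algebra f ->
  (forall x, differentiable f x) /\ (forall i, flat_algebra (partial i f)).
Proof.
elim=> {f} [p c i d|k|f g _ [df pf] _ [dg pg]|f g sf [df pf] sg [dg pg]].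
- have dl x : differentiable (fun y : 'rV[R]_n => c * y ord0 i + d) x.
    apply: differentiableD; last exact: differentiable_cst.
    by apply: differentiableM; [exact: differentiable_cst|exact: differentiable_coordr].
  have gl x : grad (fun y : 'rV[R]_n => c * y ord0 i + d) x = c *: delta_mx ord0 i.
    rewrite gradD//; last 1 first.
      by apply: differentiableM; [exact: differentiable_cst|exact: differentiable_coordr].
    rewrite [grad (fun=> d) x]grad_cst addr0 gradZ ?grad_coord//.
    exact: differentiable_coordr.
  have dfl (x : 'rV[R]_n) := @is_derive_flat _ p (c * x ord0 i + d).
  split=> [x|j]; first exact: differentiable_comp1 (dfl x).
  have -> : partial j (fun x : 'rV[R]_n => flat p (c * x ord0 i + d)) =
            fun x => flat (dflat p) (c * x ord0 i + d) * (c * (j == i)%:R).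
    by apply/funext => x; rewrite -gradE (grad_comp _ (dfl x))// gl !mxE/= eq_sym.
  by apply: flat_algebraM; constructor.
- split=> [x|j]; first exact: differentiable_cst.
  have -> : partial j (fun=> k) = (fun=> 0 : R).
    by apply/funext => x; rewrite /partial derive_cst.
  by constructor.
- split=> [x|j]; first exact: differentiableD.
  have -> : partial j (fun x => f x + g x) = fun x => partial j f x + partial j g x.
    by apply/funext => x; rewrite -gradE gradD// !mxE.
  by constructor.
- split=> [x|j]; first exact: differentiableM.
  have -> : partial j (fun x => f x * g x) = fun x => f x * partial j g x + g x * partial j f x.
    by apply/funext => x; rewrite -gradE gradM// !mxE.
  by constructor; constructor.
Qed.

Lemma flat_algebra_smooth f : flat_algebra f -> smooth f.
Proof.
move=> sf s x; apply: (flat_algebra_partial _).1.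
by elim: s => //= i s /flat_algebra_partial[_]; exact.
Qed.

Lemma flat_algebra_prod (T : Type) (s : seq T) (F : T -> 'rV[R]_n -> R) :
  (forall i, flat_algebra (F i)) -> flat_algebra (fun x => \prod_(i <- s) F i x).
Proof.
move=> sF; elim: s => [|a s ih].
  by under eq_fun do rewrite big_nil; constructor.
by under eq_fun do rewrite big_cons; constructor.
Qed.

Lemma smooth_partial (f : 'rV[R]_n -> R) i : smooth f -> smooth (partial i f).
Proof. by move=> sf s x; have := sf (rcons s i) x; rewrite foldr_rcons. Qed.

Lemma smooth_differentiable (f : 'rV[R]_n -> R) x : smooth f -> differentiable f x.
Proof. by move=> /(_ [::] x). Qed.

Lemma smooth_C1 (f : 'rV[R]_n -> R) D : smooth f -> C1_on D f.
Proof.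
move=> sf x _; split; first exact: smooth_differentiable.
apply/continuous_rVP => i; rewrite (_ : (fun y => _) = partial i f).
  by apply: differentiable_continuous; apply: smooth_differentiable; exact: smooth_partial.
by apply/funext => y; rewrite mxE.
Qed.

(** For [k > 0] the function is positive exactly on [box a b]. The parameter [k] leaves this set
    unchanged and drives the values to the indicator of the box. *)
Definition bump (k : R) (a b x : 'rV[R]_n) : R :=
  \prod_(i < n) (flat1 (k * (x ord0 i - a ord0 i)) * flat1 (k * (b ord0 i - x ord0 i))).

Lemma bump_smooth k a b : smooth (bump k a b).
Proof.
apply: flat_algebra_smooth; apply: flat_algebra_prod => i; apply: flat_algebraM.
  have -> : (fun x : 'rV[R]_n => flat1 (k * (x ord0 i - a ord0 i))) =
            (fun x => flat 1 (k * x ord0 i + - (k * a ord0 i))).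
    by apply/funext => x; rewrite mulrBr.
  by constructor.
have -> : (fun x : 'rV[R]_n => flat1 (k * (b ord0 i - x ord0 i))) =
          (fun x => flat 1 (- k * x ord0 i + k * b ord0 i)).
  by apply/funext => x; rewrite /flat1; congr flat; ring.
by constructor.
Qed.

Lemma bump_ge0 k a b x : 0 <= bump k a b x.
Proof. by apply: prodr_ge0 => i _; rewrite mulr_ge0 ?flat1_ge0. Qed.

Lemma bump_le1 k a b x : bump k a b x <= 1.
Proof. by apply: prodr_ile1 => i _; rewrite mulr_ge0 ?flat1_ge0//= mulr_ile1 ?flat1_ge0 ?flat1_le1. Qed.

Lemma bump_gt0 k a b x : 0 < k -> box a b x -> 0 < bump k a b x.
Proof.
move=> k0 xab; apply: prodr_gt0 => i _; have /andP[h1 h2] := xab i.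
by rewrite mulr_gt0// flat1_gt0// mulr_gt0// subr_gt0.
Qed.

Lemma bump_out k a b x : 0 < k -> ~ box a b x -> bump k a b x = 0.
Proof.
move=> k0 /existsNP[i /negP]; rewrite negb_and => h.
rewrite /bump (bigD1 i)//=.
case/orP : h; rewrite -leNgt => h.
  by rewrite flat1_le0 ?mul0r// pmulr_rle0// subr_le0.
by rewrite [X in _ * X * _]flat1_le0 ?mulr0 ?mul0r// pmulr_rle0// subr_le0.
Qed.

Lemma bump_translate k a b (c x : 'rV[R]_n) : bump k (a + c) (b + c) (x + c) = bump k a b x.
Proof.
apply: eq_bigr => i _; rewrite !mxE.
by congr (flat1 (_ * _) * flat1 (_ * _)); ring.
Qed.

Lemma bump_cvg a b x :
  bump k.+1%:R a b x @[k --> \oo] --> (\1_(box a b) x : R).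
Proof.
have [xab|nxab] := pselect (box a b x); last first.
  rewrite indicE memNset//; apply: cvg_near_cst; apply: nearW => k.
  by rewrite bump_out// ltr0n.
rewrite indicE mem_set//=.
have h (t : R) : 0 < t -> flat1 (k.+1%:R * t) @[k --> \oo] --> (1 : R).
  by move=> t0; have := flat1_cvg1 t0; rewrite -(cvg_shiftS (fun k => flat1 (k%:R * t))).
rewrite /bump; elim: (index_enum 'I_n) => [|i s ih].
  by under eq_fun do rewrite big_nil; exact: cvg_cst.
under eq_fun do rewrite big_cons.
have /andP[h1 h2] := xab i.
rewrite -subr_gt0 in h1; rewrite -subr_gt0 in h2.
by have := cvgM (cvgM (h _ h1) (h _ h2)) ih; rewrite !mulr1; exact.
Qed.

Lemma closed_box_closed (a b : 'rV[R]_n) :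
  closed [set x : 'rV[R]_n | forall i, a ord0 i <= x ord0 i <= b ord0 i].
Proof.
have -> : [set x : 'rV[R]_n | forall i, a ord0 i <= x ord0 i <= b ord0 i] =
   \bigcap_(i in [set: 'I_n]) ((fun x : 'rV[R]_n => x ord0 i) @^-1` `[a ord0 i, b ord0 i]%classic).
  apply/seteqP; split => x /= h i; first by move=> _; rewrite /= in_itv /=; exact: h.
  by have := h i Logic.I; rewrite /= in_itv.
apply: closed_bigI => i _; apply: closed_comp; last exact: interval_closed.
by move=> x _; exact: coord_continuous.
Qed.

Lemma bounded_subset_compact (A : set 'rV[R]_n) M :
  closed A -> (forall x, A x -> `|x| <= M) -> compact A.
Proof.
move=> cA AM; apply: bounded_closed_compact => //.
exists M; split; first exact: num_real.
by move=> N MN x /AM h; exact: le_trans h (ltW MN).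
Qed.

Lemma bump_test k (a b : 'rV[R]_n) (D : set 'rV[R]_n) : 0 < k ->
  (forall x : 'rV[R]_n, (forall i, a ord0 i <= x ord0 i <= b ord0 i) -> D x) ->
  test_function D (bump k a b).
Proof.
move=> k0 abD; pose K := [set x : 'rV[R]_n | forall i, a ord0 i <= x ord0 i <= b ord0 i].
have sK : closure [set x | bump k a b x != 0] `<=` K.
  rewrite closureE; apply: smallest_sub; first exact: closed_box_closed.
  move=> x /= bx i; have [xab|nxab] := pselect (box a b x).
    by have /andP[h1 h2] := xab i; rewrite !ltW.
  by move: bx; rewrite bump_out// eqxx.
split; first exact: bump_smooth.
  apply: (@bounded_subset_compact _ (`|a| + `|b|)); first exact: closed_closure.
  move=> x /sK xK; apply/normr_rV_le => [|i]; first exact: addr_ge0.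
  have /andP[h1 h2] := xK i.
  have := normr_coord_le a i; have := normr_coord_le b i.
  have := normr_ge0 a; have := normr_ge0 b.
  have := ler_norm (b ord0 i); have := ler_norm (- a ord0 i); rewrite normrN.
  by move=> ? ? ? ? ? ?; rewrite ler_norml; apply/andP; split; lra.
by move=> x /sK; exact: abD.
Qed.

End smooth_functions.

(* The sets A for which P (K `\` A) holds form a filter without cluster point. *)
Lemma compact_induction (T : topologicalType) (K : set T) (P : set T -> Prop) :
  compact K -> P set0 -> (forall A B, A `<=` B -> P B -> P A) ->
  (forall A B, P A -> P B -> P (A `|` B)) ->
  (forall x, K x -> exists2 U, nbhs x U & P (K `&` U)) -> P K.
Proof.
move=> cK P0 PS PU loc; apply: contrapT => nPK.
pose F : set_system T := [set A | P (K `\` A)].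
have FF : ProperFilter F.
  split; first by rewrite /F/= setD0.
  split.
  - by rewrite /F/= setDT.
  - move=> A B; rewrite /F/= => PA PB; apply: PS (PU _ _ PA PB) => x [Kx nAB].
    by have [Ax|nAx] := pselect (A x); [right|left]; split=> // Bx; exact: nAB.
  - by move=> A B AB; rewrite /F/=; apply: PS => x [Kx nBx]; split=> // /AB.
have FK : F K by rewrite /F/= setDv.
have [x [Kx clx]] := cK F FF FK.
have [U Ux PKU] := loc x Kx.
have /clx/(_ Ux)[y [nUy Uy]] : F (~` U) by rewrite /F/= setDE setCK.
by [].
Qed.

Lemma res_in {R : realType} (T : Type) (D : set T) (f : T -> R) x : D x -> (f \_ D) x = f x.
Proof. by move=> Dx; rewrite patchE mem_set. Qed.

Lemma res_out {R : realType} (T : Type) (D : set T) (f : T -> R) x : ~ D x -> (f \_ D) x = 0.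
Proof. by move=> nDx; rewrite patchE memNset. Qed.

Section compactly_supported.
Context {R : realType} {n : nat}.
Implicit Types (D K : set 'rV[R]_n) (v : 'rV[R]_n -> R).

(** The compact set is a free witness and not the topological support, so products and extensions by
    zero inherit it at once. *)
Definition C1c D v := C1_on setT v /\
  exists K, [/\ compact K, K `<=` D & forall x, ~ K x -> v x = 0].

Lemma compact_normr_lt K : compact K -> exists2 M, 0 < M & forall x, K x -> `|x| < M.
Proof.
move=> /compact_bounded[M [Mr hM]]; exists (`|M| + 2); first by rewrite ltr_wpDl.
move=> x Kx; have := hM (`|M| + 1).
rewrite (le_lt_trans (ler_norm _)) ?ltrDl// => /(_ isT x Kx)/= h.
by apply: le_lt_trans h _; lra.
Qed.

Lemma C1c_sub D D' v : D `<=` D' -> C1c D v -> C1c D' v.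
Proof.
by move=> DD' [cv [K [cK KD v0]]]; split=> //; exists K; split=> // x /KD/DD'.
Qed.

Lemma C1c_bounded_support D v : C1c D v -> exists M, forall x, M <= `|x| -> v x = 0.
Proof.
move=> [cv [K [cK KD v0]]]; have [M M0 KM] := compact_normr_lt cK.
by exists M => x Mx; apply: v0 => /KM; rewrite ltNge Mx.
Qed.

Lemma compact_closedr K : compact K -> closed K.
Proof. by apply: compact_closed; exact: norm_hausdorff. Qed.

Lemma nbhs_notin_compact K x : compact K -> ~ K x -> \forall y \near x, ~ K y.
Proof.
by move=> /compact_closedr/closed_openC oK nKx; exact: (open_near oK nKx).
Qed.

Lemma grad_eq0_out K v x : compact K -> (forall x, ~ K x -> v x = 0) -> ~ K x -> grad v x = 0.
Proof.
move=> cK v0 nKx; rewrite (@grad_eq _ _ v (cst 0)) ?grad_cst//.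
by apply: filterS (nbhs_notin_compact cK nKx) => y /v0.
Qed.

Lemma C1c_continuous D v : C1c D v -> continuous v.
Proof. by move=> [cv _] x; exact: (C1_continuous cv). Qed.

Lemma C1_on_is_derive D v x i : C1_on D v -> D x -> is_derive x (delta_mx ord0 i) v (partial i v x).
Proof. by move=> cv Dx; apply: derivableP; apply: diff_derivable; exact: C1_differentiable cv Dx. Qed.

Lemma continuous_partial v i x : {for x, continuous (grad v)} -> {for x, continuous (partial i v)}.
Proof.
move=> /continuous_rVP/(_ i); rewrite (_ : (fun y => grad v y ord0 i) = partial i v)//.
by apply/funext => y; rewrite gradE.
Qed.

Lemma C1c_BM D v : C1c D v -> BM v.
Proof.
move=> vc; have [M v0] := C1c_bounded_support vc.
exact: BM_continuous (C1c_continuous vc) v0.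
Qed.

Lemma C1c_BM_partial D v i : C1c D v -> BM (partial i v).
Proof.
move=> vc; have [M v0] := C1c_bounded_support vc; have [cv _] := vc.
apply: (@BM_continuous _ _ _ (M + 1)).
  by move=> x; apply: continuous_partial; exact: C1_grad_continuous cv _.
apply: derive_zero_outside v0 => x.
exact: (C1_on_is_derive i cv).
Qed.

Lemma C1c_Lint_partial D v i : C1c D v -> Lint (partial i v) = 0.
Proof.
move=> vc; have [M v0] := C1c_bounded_support vc; have [cv _] := vc.
apply: (@Lint_partial _ _ i v _ M) => //.
  by move=> x; exact: (C1_on_is_derive i cv).
by move=> x; apply: continuous_partial; exact: C1_grad_continuous cv _.
Qed.

(** Extension by zero stays of class C^1 because each point outside [D] has a neighbourhood that
    misses the closed set [K]. *)
Lemma C1c_restrict D K v : open D -> C1_on D v -> compact K -> K `<=` D ->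
  (forall x, D x -> ~ K x -> v x = 0) ->
  C1c D (v \_ D) /\ forall x, D x -> grad (v \_ D) x = grad v x.
Proof.
move=> oD cv cK KD v0.
have vDE x : D x -> \forall y \near x, v y = (v \_ D) y.
  by move=> Dx; apply: filterS (open_near oD Dx) => y Dy; rewrite patchE mem_set.
have gE x : D x -> grad (v \_ D) x = grad v x.
  by move=> Dx; apply/esym/grad_eq; exact: vDE.
have vD0 x : ~ K x -> (v \_ D) x = 0.
  by move=> nKx; rewrite patchE; case: ifPn => // /set_mem Dx; exact: v0.
split=> //; split; last by exists K.
move=> x _; have [Dx|nDx] := pselect (D x).
  have [dv cdv] := cv x Dx; split; first exact: differentiable_eq (vDE x Dx) dv.
  apply: continuous_near_eq cdv.
  by apply: filterS (open_near oD Dx) => y /gE.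
have nKx : ~ K x by move=> /KD.
have near0 : \forall y \near x, cst 0 y = (v \_ D) y.
  by apply: filterS (nbhs_notin_compact cK nKx) => y /vD0.
split; first exact: differentiable_eq near0 (differentiable_cst _ _).
apply: (@continuous_near_eq _ _ _ (cst (0 : 'rV[R]_n))); last exact: cst_continuous.
apply: filterS (nbhs_notin_compact cK nKx) => y nKy.
by rewrite (grad_eq0_out cK vD0).
Qed.

Lemma test_C1c D phi : test_function D phi -> C1c D phi.
Proof.
move=> [sphi cphi phiD]; split; first exact: smooth_C1.
exists (closure [set x | phi x != 0]); split=> // x nx.
by apply/eqP; apply: contrapT => /negP px; apply: nx; exact: subset_closure.
Qed.

Lemma restrict_support D K v : K `<=` D -> (forall x, ~ K x -> v x = 0) -> v \_ D = v.
Proof.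
move=> KD v0; apply/funext => x; rewrite patchE; case: ifPn => //.
by rewrite notin_setE => nDx; rewrite v0// => /KD.
Qed.

Lemma C1c_restrict_id D v : C1c D v -> v \_ D = v.
Proof. by move=> [_ [K [cK KD v0]]]; exact: restrict_support KD v0. Qed.

Lemma C1c_partial_restrict D v i : C1c D v -> (partial i v) \_ D = partial i v.
Proof.
move=> [_ [K [cK KD v0]]]; apply: (restrict_support KD) => x nKx.
by rewrite -gradE (grad_eq0_out cK v0 nKx) mxE.
Qed.

End compactly_supported.

Section weak_formulation.
Context {R : realType} {n : nat}.
Implicit Types (D K : set 'rV[R]_n) (v : 'rV[R]_n -> R).
Local Notation mu := (lebesgue_rV n : {measure set 'rV[R]_n -> \bar R}).

Lemma integral_BM D (f : 'rV[R]_n -> R) : BM (f \_ D) ->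
  (\int[mu]_(x in D) (f x)%:E)%E = (Lint (f \_ D))%:E.
Proof.
move=> bf; rewrite /Lint /Rintegral fineK.
  rewrite [LHS]integral_mkcond/=; apply: eq_integral => x _.
  by rewrite !patchE; case: ifP.
by apply: integrable_fin_num => //; exact: BM_integrable bf.
Qed.

Lemma BM_Lfun2 (f : 'rV[R]_n -> R) : BM f -> f \in Lfun mu 2%:E.
Proof.
move=> bf; rewrite inE; apply/andP; split; first by rewrite inE; case: bf.
rewrite inE/= /finite_norm unlock /=.
apply: poweR_lty.
have -> : (fun x => `|(f x)%:E| `^ 2)%E = EFin \o (fun x => f x * f x).
  apply/funext => x /=; rewrite powR_mulrn// -expr2 real_normK//.
  by rewrite num_real.
have /BM_integrable/integrableP[_] := BMM2 bf bf.
apply: le_lt_trans; apply: ge0_le_integral => //.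
- by move=> x _; rewrite lee_fin -expr2 sqr_ge0.
- by apply/measurable_EFinP; case: (BMM2 bf bf).
- by apply/measurable_EFinP; case: (BM_abs (BMM2 bf bf)).
- by move=> x _; rewrite lee_fin ler_norm.
Qed.

(** The product [u * v], extended by zero, is of class C^1 with compact support, so its partial
    derivative integrates to 0. The behaviour of [u] near the boundary of [D] does not enter. *)
Lemma integration_by_parts_C1c D u v i : open D -> C1_on D u -> C1c D v ->
  BM ((fun x => u x * partial i v x) \_ D) /\ BM ((fun x => partial i u x * v x) \_ D) /\
  Lint ((fun x => u x * partial i v x) \_ D) = - Lint ((fun x => partial i u x * v x) \_ D).
Proof.
move=> oD cu [cv [K [cK KD v0]]].
have cvD : C1_on D v by apply: C1_on_sub cv.
have cuv : C1_on D (fun x => u x * v x) by exact: C1_onM.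
have [] := @C1c_restrict _ _ D K (fun x => u x * v x) oD cuv cK KD.
  by move=> x _ /v0 ->; rewrite mulr0.
move=> uvc guv.
(* If the second factor vanishes off [K], the product is bounded by its maximum on [K], however wild
   the first factor is near the boundary of [D]. *)
have bd (f g : 'rV[R]_n -> R) : (forall x, D x -> {for x, continuous f}) ->
    (forall x, D x -> {for x, continuous g}) ->
    (forall x, ~ K x -> g x = 0) -> BM ((fun x => f x * g x) \_ D).
  move=> cf cg g0; split.
    by apply: measurable_restrict_open => // x Dx; apply: continuousM; [exact: cf|exact: cg].
  have [M M0 KM] := compact_normr_lt cK.
  have /compact_bounded[B [Br hB]] : compact ((fun x => f x * g x) @` K).
    apply: continuous_compact => //; apply: continuous_in_subspaceT => x /set_mem/KD Dx.
    by apply: continuousM; [exact: cf|exact: cg].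
  exists (Num.max (`|B| + 1) M); split=> x.
    have [Kx|nKx] := pselect (K x); last first.
      rewrite patchE g0// mulr0 if_same normr0 le_max; apply/orP; left.
      by rewrite addr_ge0.
    rewrite patchE mem_set; last exact: KD.
    rewrite le_max; apply/orP; left; apply: (hB (`|B| + 1)); last by exists x.
    by apply: le_lt_trans (ler_norm _) _; rewrite ltrDl.
  rewrite ge_max => /andP[_ h]; rewrite patchE g0 ?mulr0 ?if_same// => /KM.
  by rewrite ltNge h.
have cpv x : D x -> {for x, continuous (partial i v)}.
  by move=> Dx; apply: continuous_partial; exact: C1_grad_continuous cvD Dx.
have cpu x : D x -> {for x, continuous (partial i u)}.
  by move=> Dx; apply: continuous_partial; exact: C1_grad_continuous cu Dx.
have pv0 x : ~ K x -> partial i v x = 0.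
  by move=> nKx; rewrite -gradE (grad_eq0_out cK v0 nKx) mxE.
have b1 : BM ((fun x => u x * partial i v x) \_ D).
  by apply: bd => // x Dx; exact: C1_continuous cu Dx.
have b2 : BM ((fun x => partial i u x * v x) \_ D).
  by apply: bd => // x Dx; exact: C1_continuous cvD Dx.
split=> //; split=> //; apply/eqP; rewrite -addr_eq0 -LintD//; apply/eqP.
rewrite -[RHS](C1c_Lint_partial i uvc); congr Lint; apply/funext => x.
have [Dx|nDx] := pselect (D x).
  rewrite !res_in// -[RHS]gradE guv// gradM ?mxE.
  - by rewrite [X in _ = _ + X]mulrC.
  - exact: C1_differentiable cu Dx.
  - exact: C1_differentiable cvD Dx.
rewrite !res_out// addr0 -gradE.
rewrite (@grad_eq0_out _ _ K) ?mxE//; last by move=> /KD.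
by move=> y nKy; rewrite patchE v0// mulr0 if_same.
Qed.

Lemma test_W12 D phi : open D -> test_function D phi -> W12 D phi (grad phi).
Proof.
move=> oD tphi; have cphi := test_C1c tphi; split.
- by rewrite /L2 C1c_restrict_id//; apply: BM_Lfun2; exact: C1c_BM cphi.
- move=> i; rewrite /L2 (_ : (fun x => grad phi x ord0 i) = partial i phi); last first.
    by apply/funext => x; rewrite gradE.
  by rewrite C1c_partial_restrict//; apply: BM_Lfun2; exact: C1c_BM_partial cphi.
- move=> psi tpsi i; have cpsi := test_C1c tpsi.
  have cphiD : C1_on D phi by apply: C1_on_sub (cphi.1).
  have [b1 [b2 defE]] := integration_by_parts_C1c i oD cphiD cpsi.
  rewrite integral_BM// defE; under [X in (- X)%E]eq_integral do rewrite gradE.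
  by rewrite integral_BM.
Qed.

(** The only way in which test functions enter the weak equation. A test function of the sector is
    also one of [Om], and the constant sequence approximates it. *)
Lemma test_W12_Gamma0 (Om Sig : set 'rV[R]_n) phi : open Om -> open Sig ->
  test_function (Om `&` Sig) phi -> W12_Gamma0 Om Sig phi (grad phi).
Proof.
move=> oO oS tphi; have tO : test_function Om phi.
  by case: tphi => sphi cphi h; split=> // x /h[].
split; first by apply: test_W12 => //; exact: openI.
exists phi; last by apply: nearW.
have L0 (f : 'rV[R]_n -> R) : L2_cvg Om (fun=> f) f.
  rewrite /L2_cvg; apply: cvg_near_cst; apply: nearW => k.
  rewrite -[RHS](@Lnorm0 _ _ _ mu 2%:E); last by rewrite eqe pnatr_eq0.
  by apply: eq_Lnorm => x /=; rewrite patchE /= [X in if _ then X else _]subrr if_same.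
exists (grad phi), (fun=> phi); split=> //; first exact: test_W12.
move=> i; rewrite (_ : (fun x => _) = partial i phi)//.
by apply/funext => x; rewrite gradE.
Qed.

End weak_formulation.

(** * The distributional gradient of a C^1 function *)

Section gradient_identification.
Context {R : realType} {n : nat}.
Implicit Types (D K : set 'rV[R]_n) (v : 'rV[R]_n -> R).
Local Notation mu := (lebesgue_rV n : {measure set 'rV[R]_n -> \bar R}).

Definition cbox (a b : 'rV[R]_n) : set 'rV[R]_n :=
  [set x | forall i, a ord0 i <= x ord0 i <= b ord0 i].

Lemma box_cbox a b : box a b `<=` cbox a b.
Proof. by move=> x xab i; have /andP[h1 h2] := xab i; rewrite !ltW. Qed.

Lemma cbox_compact a b : compact (cbox a b).
Proof.
apply: (@bounded_subset_compact _ _ _ (`|a| + `|b|)); first exact: closed_box_closed.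
move=> x xK; apply/normr_rV_le => [|i]; first exact: addr_ge0.
have /andP[h1 h2] := xK i.
have := normr_coord_le a i; have := normr_coord_le b i.
have := normr_ge0 a; have := normr_ge0 b.
have := ler_norm (b ord0 i); have := ler_norm (- a ord0 i); rewrite normrN.
by move=> ? ? ? ? ? ?; rewrite ler_norml; apply/andP; split; lra.
Qed.

Lemma box_inter_cbox (a b a' b' : 'rV[R]_n) : (box a b `&` box a' b') !=set0 ->
  exists c d, box a b `&` box a' b' = box c d /\
    forall i, a ord0 i <= c ord0 i /\ d ord0 i <= b ord0 i.
Proof.
move=> [x [xab xab']].
pose c : 'rV[R]_n := \row_i Num.max (a ord0 i) (a' ord0 i).
pose d : 'rV[R]_n := \row_i Num.min (b ord0 i) (b' ord0 i).
exists c, d; split.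
  apply/seteqP; split => y /=.
    move=> [yab ycd] i; rewrite !mxE gt_max lt_min.
    by have /andP[-> ->] := yab i; have /andP[-> ->] := ycd i.
  move=> yh; split => i; have := yh i; rewrite !mxE gt_max lt_min.
    by case/andP => /andP[-> _] /andP[-> _].
  by case/andP => /andP[_ ->] /andP[_ ->].
by move=> i; rewrite !mxE le_max ge_min !lexx.
Qed.

(** Sets over which [h] has integral 0 form a Dynkin system. It contains all boxes, since a box only
    counts through its intersection with [box a b], hence it contains all measurable sets. *)
Lemma integral_set_eq0_ae (h : 'rV[R]_n -> R) (a b : 'rV[R]_n) :
  mu.-integrable setT (EFin \o h) ->
  (forall x, ~ box a b x -> h x = 0) ->
  (forall c d : 'rV[R]_n, (forall i, a ord0 i <= c ord0 i /\ d ord0 i <= b ord0 i) -> (\int[mu]_(x in box c d) (h x)%:E = 0)%E) ->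
  ae_eq mu setT (EFin \o h) (cst 0%E).
Proof.
move=> ih h0 hbox.
have h_box c d : (\int[mu]_(x in box c d) (h x)%:E = 0)%E.
  have defE : (\int[mu]_(x in box c d) (h x)%:E = \int[mu]_(x in box a b `&` box c d) (h x)%:E)%E.
    rewrite integral_mkcond [RHS]integral_mkcond; apply: eq_integral => x _.
    rewrite !patchE in_setI; have [xab|nxab] := pselect (box a b x).
      by rewrite (mem_set xab).
    by rewrite (memNset nxab)/= h0// if_same.
  rewrite defE; have [ne|] := pselect ((box a b `&` box c d) !=set0).
    by have [c' [d' [-> sub]]] := box_inter_cbox ne; exact: hbox.
  by move=> /set0P/negP/negPn/eqP ->; rewrite integral_set0.
have hS S : measurable S -> (\int[mu]_(x in S) (h x)%:E = 0)%E.
  move=> mS.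
  apply: (dynkin_induction (G := boxes) (P := fun S => (\int[mu]_(x in S) (h x)%:E = 0)%E)
     (@measurable_boxes R n) setI_boxes).
  - have -> : (\int[mu]_(x in setT) (h x)%:E = \int[mu]_(x in box a b) (h x)%:E)%E.
      rewrite [RHS]integral_mkcond; apply: eq_integral => x _.
      by rewrite patchE; case: ifPn => //; rewrite notin_setE => /h0 ->.
    exact: h_box.
  - by move=> _ [c [d ->]]; exact: h_box.
  - move=> A mA IA.
    have TE : (\int[mu]_(x in setT) (h x)%:E = 0)%E.
      have -> : (\int[mu]_(x in setT) (h x)%:E = \int[mu]_(x in box a b) (h x)%:E)%E.
        rewrite [RHS]integral_mkcond; apply: eq_integral => x _.
        by rewrite patchE; case: ifPn => //; rewrite notin_setE => /h0 ->.
      exact: h_box.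
    move: TE; rewrite -(setvU A) integral_setU_EFin//.
    + by rewrite IA adde0.
    + exact: measurableC.
    + by apply: measurable_funTS; apply/measurable_EFinP; exact: measurable_int ih.
    + by apply/disj_setPS; rewrite setICl.
  - move=> F mF tF IF.
    rewrite (integral_bigcup tF mF).
      by apply: eseries0 => k _ _; exact: IF.
    by apply: integrableS ih => //; exact: bigcup_measurable.
  - by rewrite -measurable_boxes.
apply: integral_ae_eq => // defE _ mE.
by rewrite hS// integral0.
Qed.

(** On a closed box inside [D] the difference of the two gradients is integrable and orthogonal to
    every bump, hence to indicators of smaller boxes. Countably many rational boxes then cover
    [D]. *)
Lemma weak_gradient_unique D u g i : open D -> C1_on D u -> W12 D u g ->
  {ae mu, forall x, D x -> g x ord0 i = partial i u x}.
Proof.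
move=> oD cu [_ L2g wg].
have mD := open_measurable_rV oD.
have mg : measurable_fun setT ((fun x => g x ord0 i) \_ D).
  by have := L2g i; rewrite /L2 inE => /andP[]; rewrite inE.
have cpu x : D x -> {for x, continuous (partial i u)}.
  by move=> Dx; apply: continuous_partial; exact: C1_grad_continuous cu Dx.
have g2 := Lfun2_integrable_sqr (L2g i).
have mpu : measurable_fun D (partial i u) by exact: measurable_fun_open.
have mgD : measurable_fun D (fun x => g x ord0 i).
  by apply/(measurable_restrictT _ mD).
have loc (a b : 'rV[R]_n) : cbox a b `<=` D ->
    {ae mu, forall x, box a b x -> g x ord0 i = partial i u x}.
  move=> abD; have bD : box a b `<=` D by apply: subset_trans abD; exact: box_cbox.
  pose h := (fun x => g x ord0 i - partial i u x) \_ (box a b).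
  have mb := measurable_open_box a b.
  have [B B0 hB] : exists2 B, 0 <= B & forall x, box a b x -> `|partial i u x| <= B.
    have /compact_bounded[B [Br hB]] : compact (partial i u @` cbox a b).
      apply: continuous_compact; last exact: cbox_compact.
      by apply: continuous_in_subspaceT => x /set_mem/abD/cpu.
    exists (`|B| + 1); first by rewrite addr_ge0.
    move=> x /box_cbox xab; apply: (hB (`|B| + 1)); last by exists x.
    by apply: le_lt_trans (ler_norm _) _; rewrite ltrDl.
  have mh : measurable_fun setT h.
    apply/(measurable_restrictT _ mb).
    apply: measurable_funB; first exact: measurable_funS mgD.
    exact: measurable_funS mpu.
  (* Only the square of [g] is known to be integrable; [|g| <= g^2 + 1] turns this into
     integrability on a bounded box. *)
  have ih : mu.-integrable setT (EFin \o h).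
    apply: (@le_integrable _ _ _ mu setT measurableT _
       (EFin \o (fun x => ((fun x => g x ord0 i) \_ D) x ^+ 2 + (B + 1) * \1_(box a b) x))).
    - exact/measurable_EFinP.
    - move=> x _ /=; rewrite lee_fin /h.
      have s0 : 0 <= ((fun x => g x ord0 i) \_ D) x ^+ 2 by exact: sqr_ge0.
      have [xb|nxb] := pselect (box a b x); last first.
        by rewrite res_out// normr0.
      rewrite res_in// indicE mem_set// mulr1 (res_in _ (bD _ xb)).
      rewrite (res_in _ (bD _ xb)) in s0.
      rewrite [leRHS]ger0_norm; last by rewrite !addr_ge0.
      apply: le_trans (ler_normB _ _) _; have := hB x xb.
      suff : `|g x ord0 i| <= g x ord0 i ^+ 2 + 1 by lra.
      rewrite -[_ ^+ 2]real_normK ?num_real//.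
      by have := sqr_ge0 (`|g x ord0 i| - 1); have := normr_ge0 (g x ord0 i); nra.
    - apply: (@integrableD _ _ _ mu setT measurableT _ (EFin \o (fun x => (B + 1) * \1_(box a b) x)) g2).
      by apply: BM_integrable; apply: BMZ; exact: BM_box.
  have int0 (c d : 'rV[R]_n) : (forall j, a ord0 j <= c ord0 j /\ d ord0 j <= b ord0 j) ->
      (\int[mu]_(x in box c d) (h x)%:E = 0)%E.
    move=> cdab.
    have cdb : box c d `<=` box a b.
      move=> x xcd j; have [ac db] := cdab j; have /andP[h1 h2] := xcd j.
      by rewrite (le_lt_trans ac)// (lt_le_trans h2).
    have cdD : cbox c d `<=` D.
      move=> x xcd; apply: abD => j; have [ac db] := cdab j; have /andP[h1 h2] := xcd j.
      by rewrite (le_trans ac)// (le_trans h2).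
    have mcd := measurable_open_box c d.
    pose phi k := bump k.+1%:R c d.
    have phi0 k x : ~ box c d x -> phi k x = 0 by apply: bump_out; rewrite ltr0n.
    have tphi k : test_function D (phi k) by apply: bump_test => //; rewrite ltr0n.
    have bphi k : BM (phi k) by exact: C1c_BM (test_C1c (tphi k)).
    have mphi k : measurable_fun setT (phi k) by case: (bphi k).
    (* Weak and classical integration by parts against the same bump have the same right-hand
       side. *)
    have test k : (\int[mu]_x (h x * phi k x)%:E = 0)%E.
      have := wg (phi k) (tphi k) i.
      have [b1 [b2 defE]] := integration_by_parts_C1c i oD cu (test_C1c (tphi k)).
      rewrite integral_BM// defE => /(congr1 oppe); rewrite EFinN !oppeK => E2.
      pose gphi := (fun x => g x ord0 i * phi k x) \_ D.
      have mgphi : measurable_fun setT gphi.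
        apply/(measurable_restrictT _ mD); apply: measurable_funM => //.
        exact: measurable_funTS.
      have ig : mu.-integrable setT (EFin \o gphi).
        apply: (@le_integrable _ _ _ mu setT measurableT _
          (EFin \o (fun x => ((fun x => g x ord0 i) \_ D) x ^+ 2 + phi k x * phi k x))).
        - exact/measurable_EFinP.
        - move=> x _ /=; rewrite lee_fin /gphi.
          rewrite [leRHS]ger0_norm; last by rewrite addr_ge0 ?sqr_ge0// -expr2 sqr_ge0.
          have [Dx|nDx] := pselect (D x); last first.
            by rewrite !res_out// normr0 addr_ge0 ?sqr_ge0// -expr2 sqr_ge0.
          rewrite !res_in// normrM -[_ ^+ 2]real_normK ?num_real//.
          rewrite -[phi k x * phi k x]expr2 -[phi k x ^+ 2]real_normK ?num_real//.
          by have := sqr_ge0 (`|g x ord0 i| - `|phi k x|); have := normr_ge0 (g x ord0 i);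
            have := normr_ge0 (phi k x); nra.
        - apply: (@integrableD _ _ _ mu setT measurableT _ (EFin \o (fun x => phi k x * phi k x)) g2).
          by apply: BM_integrable; exact: BMM2.
      have -> : (\int[mu]_x (h x * phi k x)%:E =
          \int[mu]_x (gphi x - ((fun x => partial i u x * phi k x) \_ D) x)%:E)%E.
        apply: eq_integral => x _; congr EFin; rewrite /gphi /h.
        have [xcd|nxcd] := pselect (box c d x).
          have xb := cdb _ xcd; have Dx := bD _ xb.
          by rewrite !res_in// mulrBl.
        by rewrite phi0// mulr0 !patchE (phi0 _ _ nxcd) !mulr0 if_same subrr.
      rewrite integralB_EFin//; last exact: BM_integrable.
      have -> : (\int[mu]_x (gphi x)%:E = \int[mu]_(x in D) (g x ord0 i * phi k x)%:E)%E.
        by rewrite [RHS]integral_mkcond/= restrict_EFin.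
      rewrite -E2 -integral_BM// [in X in (X - _)%E]integral_mkcond/= restrict_EFin subee//.
      by apply: integrable_fin_num => //; exact: BM_integrable.
    (* The bumps tend to the indicator of [box c d] and are at most 1, so [|h|] dominates. *)
    have [] := @dominated_convergence _ _ _ mu setT measurableT
       (fun k x => (h x * phi k x)%:E) (fun x => (h x * \1_(box c d) x)%:E) (fun x => `|(h x)%:E|)%E.
    - by move=> k; apply/measurable_EFinP; exact: measurable_funM.
    - by apply/measurable_EFinP; apply: measurable_funM => //; exact: measurable_indic.
    - apply: nearW => x _; apply: cvg_EFin; first exact: nearW.
      by apply: cvgM; [exact: cvg_cst|exact: bump_cvg].
    - exact: integrable_abse.
    - apply: nearW => x k _; rewrite abse_EFin lee_fin normrM ler_piMr//.
      by rewrite ger0_norm ?bump_ge0// bump_le1.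
    move=> _ _ /=; under eq_fun do rewrite test.
    move=> /(cvg_unique _ (cvg_cst 0%E)) => /(_ (@ereal_hausdorff R)) => defE.
    rewrite [RHS]defE integral_mkcond; apply: eq_integral => x _.
    rewrite patchE indicE; case: ifP => _; first by rewrite mulr1.
    by rewrite mulr0.
  have := integral_set_eq0_ae ih (fun x nx => res_out _ nx) int0.
  apply: filterS => x /(_ Logic.I)/= [] + xb; rewrite /h res_in//.
  by move/eqP; rewrite subr_eq0 => /eqP.
(* Each box has its own exceptional null set, so only countably many boxes may be used; enumeration
   by [unpickle] brings the statement into the form required by [ae_foralln]. *)
pose J := ('rV[rat]_n * 'rV[rat]_n)%type.
pose lo (p : J) : 'rV[R]_n := \row_j ratr (p.1 ord0 j).
pose hi (p : J) : 'rV[R]_n := \row_j ratr (p.2 ord0 j).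
have : {ae mu, forall x, forall k : nat, if @unpickle J k is Some p then
    cbox (lo p) (hi p) `<=` D -> box (lo p) (hi p) x -> g x ord0 i = partial i u x else True}.
  apply/ae_foralln => k; case: unpickle => [p|]; last exact: nearW.
  have [pD|npD] := pselect (cbox (lo p) (hi p) `<=` D); last by apply: nearW => x /npD.
  by have := loc _ _ pD; apply: filterS => x h _.
apply: filterS => x hx Dx.
have /nbhs_ballP[e /= e0 eD] : nbhs x D by exact: open_near.
have ex1 j : exists q : rat, ratr q \in `](x ord0 j - e), (x ord0 j)[.
  by apply: rat_in_itvoo; rewrite ltrBlDr ltrDl.
have ex2 j : exists q : rat, ratr q \in `](x ord0 j), (x ord0 j + e)[.
  by apply: rat_in_itvoo; rewrite ltrDl.
have [/= p1 hp1] := choice ex1; have [/= p2 hp2] := choice ex2.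
have h1 j : x ord0 j - e < ratr (p1 j) < x ord0 j by have := hp1 j; rewrite in_itv.
have h2 j : x ord0 j < ratr (p2 j) < x ord0 j + e by have := hp2 j; rewrite in_itv.
pose p : J := (\row_j p1 j, \row_j p2 j).
have := hx (pickle p); rewrite pickleK; apply.
  move=> y yp; apply: eD; apply/ball_rVP => // j.
  have := yp j; rewrite !mxE; have := h1 j; have := h2 j.
  move=> /andP[? ?] /andP[? ?] /andP[? ?]; rewrite ltr_norml; apply/andP; split; lra.
by move=> j; rewrite !mxE; have /andP[_ ->] := h1 j; have /andP[->] := h2 j.
Qed.

End gradient_identification.

Section double_integrals.
Context {R : realType} {n : nat}.
Local Notation mu := (lebesgue_rV n).
Variables (f : 'rV[R]_n * 'rV[R]_n -> R) (M : R).
Hypotheses (M0 : 0 < M) (mf : measurable_fun setT f) (fM : forall p, `|f p| <= M)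
  (f1 : forall p, M <= `|p.1| -> f p = 0) (f2 : forall p, M <= `|p.2| -> f p = 0).

Let f_integrable : (mu \x mu)%E.-integrable setT (EFin \o f).
Proof.
apply: (@bounded_support_integrable _ _ _ _ (cube M `*` cube M) _ M) => //.
- by apply: measurableX; exact: measurable_open_box.
- suff : ((mu \x mu) (cube M `*` cube M) < +oo)%E by [].
  rewrite product_measure1E; [|exact: measurable_open_box..].
  by rewrite lte_mul_pinfty// ?ge0_fin_numE//; exact: lebesgue_box_lty.
- move=> p /not_andP[] /(contra_not (cubeP _ M0).2)/negP; rewrite -leNgt.
    exact: f1.
  exact: f2.
Qed.

Let BM1 x : BM (fun y => f (x, y)).
Proof.
split; first exact: (measurableT_comp mf (measurable_pair1 x)).
by exists M; split=> y; [exact: fM|move=> h; exact: f2].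
Qed.

Let BM2 y : BM (fun x => f (x, y)).
Proof.
split; first exact: (measurableT_comp mf (measurable_pair2 y)).
by exists M; split=> x; [exact: fM|move=> h; exact: f1].
Qed.

Let IE (g : 'rV[R]_n -> R) : BM g -> (\int[mu]_x (g x)%:E)%E = (Lint g)%:E.
Proof.
move=> bg; rewrite /Lint /Rintegral fineK//.
by apply: integrable_fin_num => //; exact: BM_integrable bg.
Qed.

Lemma Lint_swap : Lint (fun x => Lint (fun y => f (x, y))) = Lint (fun y => Lint (fun x => f (x, y))).
Proof.
rewrite /Lint [in LHS]/Rintegral [in RHS]/Rintegral; congr fine.
transitivity (\int[mu]_x \int[mu]_y (f (x, y))%:E)%E.
  by apply: eq_integral => x _; rewrite (IE (BM1 x)).
rewrite (Fubini f_integrable).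
by apply: eq_integral => y _; rewrite /= (IE (BM2 y)).
Qed.

Let Lint_bound (g : 'rV[R]_n -> R) : BM g -> (forall x, `|g x| <= M) ->
  (forall x, M <= `|x| -> g x = 0) -> `|Lint g| <= M * Lint (\1_(cube M) : 'rV[R]_n -> R).
Proof.
move=> bg gM g0; rewrite -LintZ; last exact: BM_box.
apply: Lint_abs_le => //; first by apply: BMZ; exact: BM_box.
move=> x; rewrite indicE; have [xM|xM] := ltrP `|x| M.
  by rewrite mem_set ?mulr1//; exact/cubeP.
by rewrite g0// normr0 mulr_ge0// ltW.
Qed.

Lemma BM_Lint1 : BM (fun x => Lint (fun y => f (x, y))).
Proof.
split.
  apply/measurable_EFinP; have := measurable_fubini_F f_integrable.
  rewrite (_ : fubini_F _ _ = EFin \o (fun x => Lint (fun y => f (x, y))))//.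
  by apply/funext => x; rewrite /fubini_F/= (IE (BM1 x)).
exists (Num.max M (M * Lint (\1_(cube M) : 'rV[R]_n -> R))); split=> x.
  rewrite le_max; apply/orP; right; apply: (Lint_bound (BM1 x)) => y; [exact: fM|exact: (f2 (p := (x, y)))].
rewrite ge_max => /andP[h _]; rewrite -[RHS](@Lint0 _ n); congr Lint.
by apply/funext => y; exact: f1.
Qed.

End double_integrals.

Section positivity.
Context {R : realType} {n : nat}.

Lemma Lint_gt0 (f : 'rV[R]_n -> R) (x0 : 'rV[R]_n) c e : BM f -> (forall x, 0 <= f x) ->
  0 < c -> 0 < e -> (forall x, ball x0 e x -> c <= f x) ->
  c * (2 * e) ^+ n <= Lint f.
Proof.
move=> bf f0 c0 e0 cf.
pose a : 'rV[R]_n := x0 - const_mx e; pose b : 'rV[R]_n := x0 + const_mx e.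
have -> : c * (2 * e) ^+ n = Lint (fun x => c * \1_(box a b) x).
  rewrite LintZ; last exact: BM_box.
  rewrite Lint_box; last by move=> i; rewrite !mxE; lra.
  congr (_ * _); rewrite -[n in LHS]card_ord -prodr_const.
  by apply: eq_bigr => i _; rewrite !mxE; ring.
apply: Lint_le => //; first by apply: BMZ; exact: BM_box.
move=> x; have [xab|nxab] := pselect (box a b x).
  rewrite indicE mem_set// mulr1; apply: cf; apply/ball_rVP => // i.
  by have := xab i; rewrite !mxE ltr_norml => /andP[h1 h2]; apply/andP; split; lra.
by rewrite indicE memNset// mulr0.
Qed.

End positivity.

(** * From smooth to C^1 test functions *)

Section weak_formulation_C1.
Context {R : realType} {n : nat}.
Implicit Types (D K : set 'rV[R]_n) (v : 'rV[R]_n -> R).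

Lemma compact_open_margin K D : compact K -> open D -> K `<=` D ->
  exists2 e, 0 < e & forall x y, K x -> `|y - x| < e -> D y.
Proof.
move=> cK oD KD.
apply: (@compact_induction _ K (fun A => exists2 e, 0 < e & forall x y, A x -> `|y - x| < e -> D y) cK).
- by exists 1.
- by move=> A B AB [e e0 h]; exists e => // x y /AB; exact: h.
- move=> A B [e e0 h] [e' e'0 h']; exists (Num.min e e'); first by rewrite lt_min e0.
  by move=> x y [Ax|Bx]; rewrite lt_min => /andP[? ?]; [exact: h Ax _|exact: h' Bx _].
- move=> x Kx; have /nbhs_ballP[e /= e0 eD] : nbhs x D by apply: open_near => //; exact: KD.
  exists (ball x (e / 2)); first by apply: nbhsx_ballx; rewrite divr_gt0.
  exists (e / 2); first by rewrite divr_gt0.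
  move=> y z [_]; rewrite -ball_normE /ball_/= => xy zy; apply: eD.
  rewrite -ball_normE /ball_/=.
  have := ler_distD y x z; rewrite [in X in _ <= _ + X]distrC; lra.
Qed.

Lemma compact_uniform_continuity (V : normedModType R) K D (v : 'rV[R]_n -> V) e : compact K -> open D -> K `<=` D ->
  (forall x, D x -> {for x, continuous v}) -> 0 < e ->
  exists2 d, 0 < d & forall x y, K x -> `|y - x| < d -> `|v y - v x| < e.
Proof.
move=> cK oD KD cv e0.
apply: (@compact_induction _ K (fun A => exists2 d, 0 < d & forall x y, A x -> `|y - x| < d -> `|v y - v x| < e) cK).
- by exists 1.
- by move=> A B AB [d d0 h]; exists d => // x y /AB; exact: h.
- move=> A B [d d0 h] [d' d'0 h']; exists (Num.min d d'); first by rewrite lt_min d0.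
  by move=> x y [Ax|Bx]; rewrite lt_min => /andP[? ?]; [exact: h Ax _|exact: h' Bx _].
- move=> x Kx; have e20 : 0 < e / 2 by rewrite divr_gt0.
  have /continuous_atP/(_ _ e20)[d d0 hd] := cv x (KD x Kx).
  exists (ball x (d / 2)); first by apply: nbhsx_ballx; rewrite divr_gt0.
  exists (d / 2); first by rewrite divr_gt0.
  move=> y z [_]; rewrite -ball_normE /ball_/= distrC => xy zy.
  have h1 : `|v y - v x| < e / 2 by apply: hd; lra.
  have h2 : `|v z - v x| < e / 2.
    by apply: hd; have := ler_distD y z x; lra.
  by have := ler_distD (v x) (v z) (v y); rewrite [in X in _ <= _ + X]distrC; lra.
Qed.

Lemma C1c_translate v (c : 'rV[R]_n) i :
  (forall x, differentiable v x) ->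
  forall x, partial i (fun y => v (y + c)) x = partial i v (x + c).
Proof.
move=> dv x; have : is_derive (x + c) (delta_mx ord0 i) v (partial i v (x + c)).
  by apply: derivableP; exact: diff_derivable.
move=> d1; have [_ <-//] : is_derive x (delta_mx ord0 i) (fun y => v (y + c)) (partial i v (x + c)).
by apply: is_derive_eqP d1 => h; rewrite addrA.
Qed.

(* Pairing the equation tested with translates r (. - x) of a bump with the
   values v x, Fubini and integration by parts move the derivative from the
   bump to v; the bump then acts as an approximate identity on F. *)
Lemma weak_formulation_C1c D (F : 'rV[R]_n -> 'rV[R]_n) v :
  open D -> (forall x, D x -> {for x, continuous F}) ->
  (forall phi, test_function D phi ->
    Lint ((fun x => dot (grad phi x) (F x)) \_ D) = Lint phi) ->
  C1c D v ->
  Lint ((fun x => dot (grad v x) (F x)) \_ D) = Lint v.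
Proof.
move=> oD cF hF cv.
have cFi i x : D x -> {for x, continuous (fun y => F y ord0 i)}.
  by move=> Dx; move: i; apply/continuous_rVP; exact: cF.
have [dv [K [cK KD v0]]] := cv.
have [e1 e10 he1] := compact_open_margin cK oD KD.
have [M M0 KM] := compact_normr_lt cK.
pose Fi i := (fun x => F x ord0 i) \_ D.
have mFi i : measurable_fun setT (Fi i).
  by apply: measurable_restrict_open => // x; exact: cFi.
have bpv i : BM (partial i v) by exact: C1c_BM_partial cv.
have bv : BM v by exact: C1c_BM cv.
have pv0 i x : ~ K x -> partial i v x = 0.
  by move=> nKx; rewrite -gradE (grad_eq0_out cK v0 nKx) mxE.
have [BF BF0 hBF] : exists2 B, 0 <= B & forall x, K x -> `|F x| <= B.
  have /compact_bounded[B [Br hB]] : compact (F @` K).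
    by apply: continuous_compact => //; apply: continuous_in_subspaceT => x /set_mem/KD/cF.
  exists (`|B| + 1); first by rewrite addr_ge0.
  move=> x Kx; apply: (hB (`|B| + 1)); last by exists x.
  by apply: le_lt_trans (ler_norm _) _; rewrite ltrDl.
have bpF i : BM (fun x => partial i v x * Fi i x).
  apply: BMM => //; exists BF => x px.
  have Kx : K x by apply: contrapT => /(pv0 i) h; rewrite h eqxx in px.
  by rewrite /Fi res_in; [exact: le_trans (normr_coord_le _ _) (hBF x Kx)|exact: KD].
pose W := Lint ((fun x => dot (grad v x) (F x)) \_ D).
have WE : W = \sum_(i < n) Lint (fun x => partial i v x * Fi i x).
  rewrite -Lint_sum//; congr Lint; apply/funext => x; rewrite /Fi.
  have [Dx|nDx] := pselect (D x); last first.
    by rewrite res_out// big1// => i _; rewrite res_out// mulr0.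
  by rewrite res_in//; apply: eq_bigr => i _; rewrite res_in// gradE.
pose A := \sum_(i < n) Lint (fun x => `|partial i v x|).
have A0 : 0 <= A by apply: sumr_ge0 => i _; exact: Lint_ge0.
suff H eta : 0 < eta -> `|Lint v - W| <= eta * A.
  have : `|Lint v - W| <= 0.
    apply/ler_addgt0Pl => eta eta0; rewrite addr0.
    have A1 : 0 < A + 1 by lra.
    apply: le_trans (H (eta / (A + 1)) (divr_gt0 eta0 A1)) _.
    by rewrite mulrAC ler_pdivrMr// ler_wpM2l ?ltW// ltrDl.
  by rewrite normr_le0 subr_eq0 => /eqP.
move=> eta0.
have [d d0 hd] := compact_uniform_continuity cK oD KD cF eta0.
(* The third keeps [2 * e] below both margins: points within [2 * e] of [K] remain in [D], and [F]
   varies there by less than [eta]. *)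
pose e := Num.min e1 d / 3.
have e0 : 0 < e by rewrite divr_gt0// lt_min e10.
have ee1 : 2 * e < e1.
  have : Num.min e1 d <= e1 by rewrite ge_min lexx.
  by move: e0; rewrite /e; lra.
have ed : 2 * e < d.
  have : Num.min e1 d <= d by rewrite ge_min lexx orbT.
  by move: e0; rewrite /e; lra.
pose lo : 'rV[R]_n := const_mx (- e); pose hi : 'rV[R]_n := const_mx e.
pose r : 'rV[R]_n -> R := bump 1 lo hi.
have sr : smooth r by exact: bump_smooth.
have cr : C1c setT r by apply: test_C1c; exact: bump_test.
have br : BM r by exact: C1c_BM cr.
have bpr i : BM (partial i r) by exact: C1c_BM_partial cr.
have r_out z : e <= `|z| -> r z = 0.
  by move=> h; apply: bump_out => // /(cubeP _ e0); rewrite ltNge h.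
have pr_out i z : 2 * e <= `|z| -> partial i r z = 0.
  move=> h; rewrite -gradE (@grad_eq0_out _ _ (cbox lo hi)) ?mxE//.
  - exact: cbox_compact.
  - by move=> y ny; apply: bump_out => // /box_cbox.
  - move=> zb; have : `|z| <= e.
      by apply/normr_rV_le => [|j]; [exact: ltW|have := zb j; rewrite !mxE ler_norml].
    lra.
(* The kernel is even and its derivatives are odd, so a derivative in [y] of [r (y - x)] can be
   traded for one in [x]. *)
have r_even z : r (- z) = r z.
  by apply: eq_bigr => i _; rewrite !mxE !mul1r mulrC; congr (flat1 _ * flat1 _); ring.
have pr_odd i z : partial i r (- z) = - partial i r z.
  have d1 : is_derive (- z) (- delta_mx ord0 i) r ('D_(- delta_mx ord0 i) r (- z)).
    by apply: derivableP; apply: diff_derivable; exact: smooth_differentiable.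
  have [_] : is_derive z (delta_mx ord0 i) r ('D_(- delta_mx ord0 i) r (- z)).
    by apply: is_derive_eqP d1 => h; rewrite scalerN -opprD r_even.
  rewrite -/(partial i r z) => ->.
  rewrite derive_grad; last exact: smooth_differentiable.
  have -> : partial i r (- z) = dot (grad r (- z)) (delta_mx ord0 i).
    by rewrite -derive_grad//; exact: smooth_differentiable.
  by rewrite /dot -sumrN; apply: eq_bigr => j _; rewrite !mxE mulrN opprK.
pose c := Lint r.
have c0 : 0 < c.
  have r0 : 0 < r 0 by apply: bump_gt0 => // i; rewrite !mxE oppr_lt0 e0.
  have /continuous_atP/(_ (r 0 / 2)) : {for 0, continuous r} by exact: (C1c_continuous cr).
  rewrite divr_gt0// => /(_ isT)[d' d'0 hd'].
  apply: lt_le_trans (@Lint_gt0 _ _ r 0 (r 0 / 2) d' br _ _ d'0 _).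
  - by rewrite mulr_gt0 ?divr_gt0// exprn_gt0// mulr_gt0.
  - by move=> x; exact: bump_ge0.
  - by rewrite divr_gt0.
  - move=> x; rewrite -ball_normE /ball_/= distrC => /hd'.
    by rewrite ltr_distl => /andP[h _]; lra.
(* Cutting [F] to this neighbourhood of [K] gives the bounded measurable components [G i] that
   Fubini needs; the bumps centred in [K] do not notice the cut. *)
pose K2 := \bigcup_(x in K) ball x (2 * e).
have e20 : 0 < 2 * e by rewrite mulr_gt0.
have K2P y : K2 y <-> exists2 x, K x & `|y - x| < 2 * e.
  by split=> -[x Kx h]; exists x => //; move: h; rewrite -ball_normE /ball_/= distrC.
have oK2 : open K2 by apply: bigcup_open => x _; exact: ball_open.
have K2D : K2 `<=` D by move=> y /K2P[x Kx h]; apply: (he1 x y Kx); lra.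
pose G i := (fun x => F x ord0 i) \_ K2.
have mG i : measurable_fun setT (G i).
  by apply: measurable_restrict_open => // x /K2D; exact: cFi.
pose B := BF + eta.
have GB i y : `|G i y| <= B.
  have [K2y|nK2y] := pselect (K2 y); last by rewrite /G res_out// normr0 addr_ge0// ltW.
  rewrite /G res_in//; apply: le_trans (normr_coord_le _ _) _.
  have [x Kx h] := (K2P y).1 K2y.
  have h1 := hd x y Kx (lt_trans h ed); have := hBF x Kx.
  have := ler_normD (F y - F x) (F x); rewrite subrK /B; lra.
have G0 i y : M + 2 * e <= `|y| -> G i y = 0.
  move=> h; apply: res_out => /K2P[x /KM Kx xy].
  by have := ler_normD (y - x) x; rewrite subrK; lra.
have bG i : BM (G i).
  split=> //; exists (Num.max B (M + 2 * e)); split=> y.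
    by rewrite le_max GB.
  by rewrite ge_max => /andP[_ /G0].
have phiE x : (fun y => r (y - x)) = bump 1 (lo + x) (hi + x).
  by apply/funext => y; rewrite -{2}[y](subrK x) bump_translate.
have cI x : Lint (fun y => r (y - x)) = c by exact: Lint_translate.
have gphi x i y : partial i (fun y => r (y - x)) y = partial i r (y - x).
  by apply: C1c_translate => z; exact: smooth_differentiable.
have bounded_BM (f : 'rV[R]_n -> R) : BM f -> exists Bf, forall x, `|f x| <= Bf.
  by move=> [_ [N [hN _]]]; exists N.
have bGr i x : BM (fun y => G i y * r (y - x)).
  apply: BMM => //.
    rewrite phiE; apply: measurable_fun_continuous => y.
    by apply: differentiable_continuous; apply: smooth_differentiable; exact: bump_smooth.
  by have [N hN] := bounded_BM _ br; exists N => y _; exact: hN.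
have bGpr i x : BM (fun y => G i y * partial i r (y - x)).
  apply: BMM => //.
    rewrite (_ : (fun y => partial i r (y - x)) = partial i (fun y => r (y - x))); last first.
      by apply/funext => y; rewrite gphi.
    rewrite phiE; apply: measurable_fun_continuous => y.
    by apply: differentiable_continuous; apply: smooth_differentiable; apply: smooth_partial; exact: bump_smooth.
  by have [N hN] := bounded_BM _ (bpr i); exists N => y _; exact: hN.
(* The hypothesis on test functions, applied to the bump centred at [x], whose integral is [c] by
   translation invariance. *)
have E1 x : K x -> c = \sum_(i < n) Lint (fun y => G i y * partial i r (y - x)).
  move=> Kx; rewrite -(cI x) phiE -hF; last first.
    apply: bump_test => // y yb; apply: (he1 x) => //.
    have : `|y - x| <= e.
      apply/normr_rV_le => [|j]; first exact: ltW.
      by have := yb j; rewrite !mxE ler_norml => /andP[? ?]; apply/andP; split; lra.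
    lra.
  rewrite -Lint_sum; last by move=> i; exact: bGpr.
  rewrite -phiE; congr Lint; apply/funext => y.
  have [K2y|nK2y] := pselect (K2 y).
    rewrite res_in; last exact: K2D.
    by apply: eq_bigr => i _; rewrite gradE gphi /G res_in// mulrC.
  rewrite big1; last by move=> i _; rewrite /G res_out// mul0r.
  have [Dy|nDy] := pselect (D y); last by rewrite res_out.
  rewrite res_in// /dot big1// => i _; rewrite gradE gphi pr_out ?mul0r// leNgt.
  by apply/negP => h; apply: nK2y; apply/K2P; exists x.
have msub : measurable_fun setT (fun p : 'rV[R]_n * 'rV[R]_n => p.2 - p.1).
  apply: measurable_fun_rVP => i; under eq_fun do rewrite !mxE.
  by apply: measurable_funB; apply: (measurableT_comp (measurable_coord i)).
have prod_ok (a b h : 'rV[R]_n -> R) (L : R) : measurable_fun setT a -> measurable_fun setT b ->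
    measurable_fun setT h -> (exists Ba, forall x, `|a x| <= Ba) ->
    (exists Bb, forall x, `|b x| <= Bb) -> (exists Bh, forall x, `|h x| <= Bh) ->
    (forall x, L <= `|x| -> a x = 0) -> (forall x, L <= `|x| -> b x = 0) ->
    let f := fun p : 'rV[R]_n * 'rV[R]_n => a p.1 * (b p.2 * h (p.2 - p.1)) in
    exists N, [/\ 0 < N, measurable_fun setT f, forall p, `|f p| <= N,
      forall p, N <= `|p.1| -> f p = 0 & forall p, N <= `|p.2| -> f p = 0].
  move=> ma mb mh [Ba hBa] [Bb hBb] [Bh hBh] a0 b0 f.
  exists (Num.max (Num.max 1 L) (Ba * (Bb * Bh))); split.
  - by rewrite !lt_max ltr01.
  - apply: measurable_funM; first exact: (measurableT_comp ma).
    apply: measurable_funM; first exact: (measurableT_comp mb).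
    exact: (measurableT_comp mh).
  - by move=> p; rewrite le_max !normrM !ler_pM ?orbT ?mulr_ge0.
  - by move=> p; rewrite !ge_max => /andP[/andP[_ h1] _]; rewrite /f a0// mul0r.
  - by move=> p; rewrite !ge_max => /andP[/andP[_ h1] _]; rewrite /f b0// mul0r mulr0.
have vM x : M + 2 * e <= `|x| -> v x = 0.
  by move=> h; apply: v0 => /KM; lra.
have pvM i x : M + 2 * e <= `|x| -> partial i v x = 0.
  by move=> h; apply: pv0 => /KM; lra.
have ok1 i := prod_ok v (G i) (partial i r) _ bv.1 (mG i) (bpr i).1
  (bounded_BM _ bv) (bounded_BM _ (bG i)) (bounded_BM _ (bpr i)) vM (@G0 i).
have ok2 i := prod_ok (partial i v) (G i) r _ (bpv i).1 (mG i) br.1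
  (bounded_BM _ (bpv i)) (bounded_BM _ (bG i)) (bounded_BM _ br) (pvM i) (@G0 i).
(* After exchanging the integrals, the integration by parts is done in [x] at fixed [y]; the sign
   from oddness cancels the sign from integration by parts. *)
have swap i : Lint (fun x => v x * Lint (fun y => G i y * partial i r (y - x))) =
    Lint (fun x => partial i v x * Lint (fun y => G i y * r (y - x))).
  have [N1 [N10 m1 b1 s1 t1]] := ok1 i; have [N2 [N20 m2 b2 s2 t2]] := ok2 i.
  have := Lint_swap N10 m1 b1 s1 t1; rewrite /= => eq1.
  transitivity (Lint (fun x => Lint (fun y => v x * (G i y * partial i r (y - x))))).
    by congr Lint; apply/funext => x; rewrite LintZ.
  rewrite eq1; have := Lint_swap N20 m2 b2 s2 t2; rewrite /= => E'.
  transitivity (Lint (fun x => Lint (fun y => partial i v x * (G i y * r (y - x))))); last first.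
    by congr Lint; apply/funext => x; rewrite LintZ.
  rewrite E'; congr Lint; apply/funext => y.
  have cu : C1_on setT (fun x => r (x - y)) by rewrite phiE; apply: smooth_C1; exact: bump_smooth.
  have cvT : C1c setT v := C1c_sub (@subsetT _ D) cv.
  have oT : open [set: 'rV[R]_n] by exact: openT.
  have [b3 [b4 E3]] := @integration_by_parts_C1c _ _ setT _ _ i oT cu cvT.
  have rT (f : 'rV[R]_n -> R) : f \_ setT = f by apply/funext => x; rewrite res_in.
  rewrite !rT in b3 b4 E3.
  transitivity (Lint (fun x => - G i y * (partial i (fun x => r (x - y)) x * v x))).
    congr Lint; apply/funext => x; rewrite gphi -[y - x]opprB pr_odd; ring.
  rewrite (LintZ _ b4) -[LHS]opprK -mulrN -E3 mulNr opprK -(LintZ _ b3); congr Lint; apply/funext => x.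
  by rewrite -[y - x]opprB r_even; ring.
have cIv : c * Lint v = \sum_(i < n) Lint (fun x => partial i v x * Lint (fun y => G i y * r (y - x))).
  rewrite -LintZ//; transitivity (Lint (fun x => \sum_(i < n) v x * Lint (fun y => G i y * partial i r (y - x)))).
    congr Lint; apply/funext => x; rewrite -mulr_sumr.
    have [Kx|nKx] := pselect (K x); first by rewrite -E1// mulrC.
    by rewrite v0// mulr0 mul0r.
  rewrite Lint_sum; first by apply: eq_bigr => i _; exact: swap.
  move=> i; have [N1 [N10 m1 b1 s1 t1]] := ok1 i.
  have := BM_Lint1 N10 m1 b1 s1 t1; rewrite /=.
  rewrite (_ : (fun x => Lint (fun y => v x * (G i y * partial i r (y - x)))) =
     (fun x => v x * Lint (fun y => G i y * partial i r (y - x))))//.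
  by apply/funext => x; rewrite LintZ.
have bI i : BM (fun x => partial i v x * Lint (fun y => G i y * r (y - x))).
  have [N2 [N20 m2 b2 s2 t2]] := ok2 i.
  have := BM_Lint1 N20 m2 b2 s2 t2; rewrite /=.
  rewrite (_ : (fun x => Lint (fun y => partial i v x * (G i y * r (y - x)))) =
     (fun x => partial i v x * Lint (fun y => G i y * r (y - x))))//.
  by apply/funext => x; rewrite LintZ.
have D1 : c * (Lint v - W) = \sum_(i < n)
    Lint (fun x => partial i v x * Lint (fun y => G i y * r (y - x)) - c * (partial i v x * Fi i x)).
  rewrite mulrBr cIv WE mulr_sumr -sumrB; apply: eq_bigr => i _.
  by rewrite LintB//; [rewrite LintZ|exact: BMZ].
have : `|c * (Lint v - W)| <= c * (eta * A).
  rewrite D1; apply: le_trans (ler_norm_sum _ _ _) _.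
  rewrite /A !mulr_sumr; apply: ler_sum => i _.
  rewrite -LintZ; last exact: BM_abs.
  rewrite -LintZ; last by apply: BMZ; exact: BM_abs.
  apply: Lint_abs_le; first by apply: BMB => //; exact: BMZ.
    by do 2 apply: BMZ; exact: BM_abs.
  move=> x; have [Kx|nKx] := pselect (K x); last first.
    by rewrite !pv0// !mul0r mulr0 subrr normr0 !mulr0.
  rewrite [c * (_ * _)]mulrCA -mulrBr normrM.
  rewrite mulrA [leRHS]mulrC ler_wpM2l//.
  have brx : BM (fun y => r (y - x)).
    by rewrite phiE; apply: C1c_BM; apply: test_C1c; exact: (@bump_test _ _ _ _ _ setT).
  (* Writing the value at [x] as an average against the bump leaves the oscillation of [F] within
     distance [e] of [x], which is below [eta]. *)
  have -> : c * Fi i x = Lint (fun y => Fi i x * r (y - x)).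
    by rewrite LintZ// cI mulrC.
  rewrite -LintB//; last exact: BMZ.
  rewrite -(cI x) mulrC -LintZ//.
  apply: Lint_abs_le; [by apply: BMB => //; exact: BMZ|exact: BMZ|].
  move=> y; have rge0 : 0 <= r (y - x) by exact: bump_ge0.
  rewrite -mulrBl normrM (ger0_norm rge0).
  have [yx|yx] := ltrP `|y - x| e; last by rewrite r_out// !mulr0.
  apply: ler_wpM2r; first exact: rge0.
  have K2y : K2 y by apply/K2P; exists x => //; lra.
  rewrite /G /Fi res_in// res_in; last exact: KD.
  have h := hd x y Kx; have {}h : `|F y - F x| < eta by apply: h; lra.
  by have := normr_coord_le (F y - F x) i; rewrite !mxE; lra.
by rewrite normrM (gtr0_norm c0) ler_pM2l.
Qed.

End weak_formulation_C1.

(** * Norms and duality *)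

Section directional_derivatives.
Context {R : realType} {n : nat}.
Implicit Types (f : 'rV[R]_n -> R) (x v : 'rV[R]_n).

Lemma dotDr (u v w : 'rV[R]_n) : dot u (v + w) = dot u v + dot u w.
Proof. by rewrite /dot -big_split; apply: eq_bigr => i _; rewrite !mxE mulrDr. Qed.

Lemma dotZr (u v : 'rV[R]_n) k : dot u (k *: v) = k * dot u v.
Proof. by rewrite /dot mulr_sumr; apply: eq_bigr => i _; rewrite !mxE mulrCA. Qed.

Lemma dotC (u v : 'rV[R]_n) : dot u v = dot v u.
Proof. by apply: eq_bigr => i _; rewrite mulrC. Qed.

Lemma dotNr (u v : 'rV[R]_n) : dot u (- v) = - dot u v.
Proof. by rewrite -scaleN1r dotZr mulN1r. Qed.

Lemma dotBr (u v w : 'rV[R]_n) : dot u (v - w) = dot u v - dot u w.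
Proof. by rewrite dotDr dotNr. Qed.

Lemma dotDl (u v w : 'rV[R]_n) : dot (v + w) u = dot v u + dot w u.
Proof. by rewrite dotC dotDr !(dotC u). Qed.

Lemma dotZl (u v : 'rV[R]_n) k : dot (k *: v) u = k * dot v u.
Proof. by rewrite dotC dotZr dotC. Qed.

Lemma dotNl (u v : 'rV[R]_n) : dot (- v) u = - dot v u.
Proof. by rewrite dotC dotNr dotC. Qed.

Lemma dotBl (u v w : 'rV[R]_n) : dot (v - w) u = dot v u - dot w u.
Proof. by rewrite dotC dotBr !(dotC u). Qed.

Lemma dot0l (u : 'rV[R]_n) : dot 0 u = 0.
Proof. by rewrite /dot big1// => i _; rewrite mxE mul0r. Qed.

Lemma dot0r (u : 'rV[R]_n) : dot u 0 = 0.
Proof. by rewrite dotC dot0l. Qed.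

Lemma dot_ge0_eq0 (u : 'rV[R]_n) : (forall v, 0 <= dot u v) -> u = 0.
Proof.
move=> h; apply/rowP => i; rewrite mxE.
have defE : dot u (delta_mx ord0 i) = u ord0 i.
  rewrite /dot (bigD1 i)//= mxE !eqxx mulr1 big1 ?addr0// => j ji.
  by rewrite mxE (negPf ji) andbF mulr0.
have := h (delta_mx ord0 i); have := h (- delta_mx ord0 i); rewrite dotNr defE => h1 h2.
by apply/eqP; rewrite eq_le h2 andbT -oppr_ge0.
Qed.

Lemma dot_derivative_ge f x v a : differentiable f x ->
  (exists2 d, 0 < d & forall t, 0 < t < d -> t * a <= f (x + t *: v) - f x) ->
  a <= dot (grad f x) v.
Proof.
move=> df [d d0 hd]; apply/ler_addgt0Pl => e e0.
have v1 : 0 < `|v| + 1 by rewrite ltr_wpDl.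
have [d' d'0 hd'] := differentiable_expansion df (divr_gt0 e0 v1).
pose t := Num.min d (d' / (`|v| + 1)) / 2.
have t0 : 0 < t by rewrite divr_gt0// lt_min d0 divr_gt0.
have td : t < d.
  have : Num.min d (d' / (`|v| + 1)) <= d by rewrite ge_min lexx.
  by move: t0; rewrite /t; lra.
have td' : t < d' / (`|v| + 1).
  have : Num.min d (d' / (`|v| + 1)) <= d' / (`|v| + 1) by rewrite ge_min lexx orbT.
  by move: t0; rewrite /t; lra.
have tv : `|t *: v| < d'.
  rewrite normrZ gtr0_norm//; rewrite ltr_pdivlMr// in td'.
  by apply: le_lt_trans td'; rewrite ler_wpM2l ?lerDl// ltW.
have := hd' _ tv; rewrite dotZr normrZ (gtr0_norm t0) [_ + x]addrC => h.
have := hd t; rewrite t0 td => /(_ isT) h2.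
rewrite -(ler_pM2l t0) mulrDr.
have h3 : e / (`|v| + 1) * (t * `|v|) <= t * e.
  rewrite mulrCA ler_pM2l// -mulrA ler_piMr ?(ltW e0)//.
  by rewrite mulrC ler_pdivrMr// mul1r lerDl.
by move: h; rewrite ler_norml => /andP[_ h]; lra.
Qed.

Lemma dot_derivative_le f x v a : differentiable f x ->
  (exists2 d, 0 < d & forall t, 0 < t < d -> f (x + t *: v) - f x <= t * a) ->
  dot (grad f x) v <= a.
Proof.
move=> df [d d0 hd]; rewrite -lerN2.
have := @dot_derivative_ge (fun y => - f y) x v (- a) (differentiableN df).
rewrite gradN// dotNl; apply; exists d => // t /hd.
by rewrite mulrN -opprD lerN2.
Qed.

End directional_derivatives.

Section norms.
Context {R : realType} {n : nat}.
Variable H : 'rV[R]_n -> R.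
Hypothesis hH : is_norm H.

Lemma norm_triangle x y : H (x + y) <= H x + H y. Proof. by case: hH. Qed.

Lemma normZ a x : H (a *: x) = `|a| * H x. Proof. by case: hH. Qed.

Lemma norm_zero : H 0 = 0.
Proof. by have := normZ 0 0; rewrite scale0r normr0 mul0r. Qed.

Lemma norm_opp x : H (- x) = H x.
Proof. by rewrite -scaleN1r normZ normrN1 mul1r. Qed.

Lemma norm_nonneg x : 0 <= H x.
Proof.
have := norm_triangle x (- x); rewrite subrr norm_zero norm_opp; lra.
Qed.

Lemma norm_pos x : x != 0 -> 0 < H x.
Proof.
move=> x0; rewrite lt_neqAle norm_nonneg andbT eq_sym; apply: contra x0 => /eqP.
by case: hH => _ _ h /h ->.
Qed.

Lemma norm_le_mx : exists2 C, 0 < C & forall x, H x <= C * `|x|.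
Proof.
exists (\sum_(i < n) H (delta_mx ord0 i) + 1).
  by rewrite ltr_wpDl// sumr_ge0// => i _; exact: norm_nonneg.
move=> x; apply: (@le_trans _ _ (\sum_(i < n) `|x ord0 i| * H (delta_mx ord0 i))).
  rewrite {1}(row_sum_delta x); elim/big_rec2: _ => [|i y z _ h]; first by rewrite norm_zero.
  by apply: le_trans (norm_triangle _ _) _; rewrite normZ lerD2l.
rewrite mulrDl mul1r -[leLHS]addr0; apply: lerD => //.
rewrite mulr_suml; apply: ler_sum => i _; rewrite mulrC.
by rewrite ler_wpM2l ?norm_nonneg ?normr_coord_le.
Qed.

Lemma norm_sub_le x y : `|H x - H y| <= H (x - y).
Proof.
rewrite ler_norml; have := norm_triangle (x - y) y; rewrite subrK.
have := norm_triangle (y - x) x; rewrite subrK -opprB norm_opp.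
by move=> ? ?; apply/andP; split; lra.
Qed.

Lemma norm_continuous_rV : continuous H.
Proof.
have [C C0 hC] := norm_le_mx.
move=> x; apply/continuous_atP => e e0; exists (e / C); first exact: divr_gt0.
move=> y; rewrite ltr_pdivlMr// mulrC => h.
by apply: le_lt_trans (norm_sub_le _ _) _; apply: le_lt_trans (hC _) h.
Qed.

Lemma sphere_compact : compact [set x : 'rV[R]_n | `|x| = 1].
Proof.
apply: (@bounded_subset_compact _ _ _ 1); last by move=> x ->.
apply: (@closed_comp _ _ (fun x : 'rV[R]_n => `|x|) [set 1]).
  by move=> x _; exact: norm_continuous.
exact: closed_eq.
Qed.

Lemma norm_ge_mx : exists2 c, 0 < c & forall x, c * `|x| <= H x.
Proof.
have [[x0 hx0]|nosphere] := pselect ([set x : 'rV[R]_n | `|x| = 1] !=set0).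
  have [|c /set_mem hc hmin] := @compact_EVT_min _ _ H _ (ex_intro _ _ hx0) sphere_compact.
    exact: continuous_subspaceT norm_continuous_rV.
  have c0 : c != 0 by rewrite -normr_eq0 hc oner_eq0.
  exists (H c); first exact: norm_pos.
  move=> x; have [->|x0'] := eqVneq x 0; first by rewrite normr0 mulr0 norm_zero.
  have xp : 0 < `|x| by rewrite normr_gt0.
  have : H c <= H (`|x|^-1 *: x).
    by apply: hmin; rewrite inE/= normrZ normfV normr_id mulVf ?normr_eq0.
  by rewrite normZ ger0_norm ?invr_ge0// mulrC ler_pdivlMr.
(* The sphere is empty, so 0 is the only vector and any constant works. *)
exists 1 => // x; have [->|x0] := eqVneq x 0; first by rewrite normr0 mulr0 norm_zero.
exfalso; apply: nosphere; exists (`|x|^-1 *: x).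
by rewrite /= normrZ normfV normr_id mulVf// normr_eq0.
Qed.

Lemma half_sqrZ a x : half_sqr H (a *: x) = a ^+ 2 * half_sqr H x.
Proof. by rewrite /half_sqr normZ exprMn real_normK ?num_real// mulrA. Qed.

Lemma half_sqr_ge0 x : 0 <= half_sqr H x.
Proof. by rewrite /half_sqr divr_ge0// sqr_ge0. Qed.

Lemma half_sqr0 : half_sqr H 0 = 0.
Proof. by rewrite /half_sqr norm_zero expr0n mul0r. Qed.

End norms.

(** * Duality between H and H0 *)

Section duality.
Context {R : realType} {n : nat}.
Variables H H0 : 'rV[R]_n -> R.
Hypotheses (n0 : (0 < n)%N) (hH : is_norm H) (hHC1 : C1_on [set~ 0] H)
  (hV : strictly_convex (half_sqr H)) (hH0 : is_norm H0)
  (hdual : forall xi, H xi = dual_norm H0 xi).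

Local Notation V := (half_sqr H).
Local Notation DV := (grad (half_sqr H)).

Let open_setC0 : open [set~ (0 : 'rV[R]_n)].
Proof. by apply: closed_openC; apply: compact_closedr; exact: compact_set1. Qed.

(** At 0 the bound [H h <= C * |h|] makes [V] quadratically small; elsewhere [V] inherits
    differentiability from [H]. *)
Lemma half_sqr_differentiable x : differentiable V x.
Proof.
have [->|x0] := eqVneq x 0.
  have [C C0 hC] := norm_le_mx hH.
  apply: (@expansion_differentiable _ _ _ _ 0 _).1 => e e0.
  exists (e / C ^+ 2); first by rewrite divr_gt0// exprn_gt0.
  move=> h; rewrite ltr_pdivlMr ?exprn_gt0// => hh.
  rewrite addr0 half_sqr0// subr0 dot0l subr0 ger0_norm ?half_sqr_ge0//.
  have h1 : H h ^+ 2 <= (C * `|h|) ^+ 2.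
    by rewrite ler_sqr ?nnegrE ?norm_nonneg// mulr_ge0// ltW.
  have h2 : (C * `|h|) ^+ 2 <= e * `|h|.
    have -> : (C * `|h|) ^+ 2 = `|h| * C ^+ 2 * `|h| by ring.
    by rewrite ler_wpM2r// ltW.
  have := sqr_ge0 (H h); rewrite /half_sqr; lra.
apply: differentiableM; last exact: differentiable_cst.
have dH : differentiable H x := C1_differentiable hHC1 (elimN eqP x0).
by under eq_fun do rewrite expr2; exact: differentiableM.
Qed.

Lemma convex_tangent x y : V x + dot (DV x) (y - x) <= V y.
Proof.
suff : dot (DV x) (y - x) <= V y - V x by lra.
apply: dot_derivative_le; first exact: half_sqr_differentiable.
exists 1 => // t /andP[t0 t1].
have [->|xy] := eqVneq y x; first by rewrite subrr scaler0 addr0 !subrr mulr0.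
have -> : x + t *: (y - x) = t *: y + (1 - t) *: x.
  by rewrite scalerBr scalerBl scale1r addrCA addrA.
by have := hV xy; move=> /(_ t); rewrite t0 t1 => /(_ isT); lra.
Qed.

Lemma convex_tangent_lt x y : y != x -> V x + dot (DV x) (y - x) < V y.
Proof.
move=> xy; pose m := 2^-1 *: y + (1 - 2^-1) *: x.
have := hV xy; move=> /(_ 2^-1); rewrite invr_gt0 invf_lt1// ltr1n ltr0n => /(_ isT).
have := convex_tangent x (2^-1 *: y + (1 - 2^-1) *: x).
have -> : 2^-1 *: y + (1 - 2^-1) *: x - x = 2^-1 *: (y - x).
  by rewrite scalerBr scalerBl scale1r addrA addrAC addrK.
by rewrite dotZr; lra.
Qed.

(** Differentiability leaves room for one subgradient only. Homogeneity, the norm and the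
    surjectivity of [DV] are all proved by exhibiting a supporting affine function. *)
Lemma subgradient_unique x p : (forall y, V x + dot p (y - x) <= V y) -> DV x = p.
Proof.
move=> h; apply/subr0_eq/dot_ge0_eq0 => v; rewrite dotBl subr_ge0.
apply: dot_derivative_ge; first exact: half_sqr_differentiable.
exists 1 => // t _; have := h (x + t *: v); rewrite addrAC subrr add0r dotZr; lra.
Qed.

Lemma DVZ t x : DV (t *: x) = t *: DV x.
Proof.
have [->|t0] := eqVneq t 0.
  rewrite !scale0r; apply: subgradient_unique => y.
  by rewrite half_sqr0// dot0l addr0 half_sqr_ge0.
apply: subgradient_unique => y.
have := convex_tangent x (t^-1 *: y).
have -> : t^-1 *: y - x = t^-1 *: (y - t *: x) by rewrite scalerBr scalerA mulVf ?scale1r.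
rewrite !half_sqrZ// dotZr dotZl => h.
have t20 : 0 < t ^+ 2 by rewrite exprn_even_gt0.
have := h; rewrite -(ler_pM2l t20) mulrDr => {}h.
have E1 : t ^+ 2 * (t^-1 ^+ 2 * V y) = V y by field.
have E2 : t ^+ 2 * (t^-1 * dot (DV x) (y - t *: x)) = t * dot (DV x) (y - t *: x) by field.
by rewrite E1 E2 in h.
Qed.

Lemma DV0 : DV 0 = 0.
Proof. by have := DVZ 0 0; rewrite !scale0r. Qed.

(** Euler's identity: [V] is homogeneous of degree 2, so its derivative along [x] is [2 * V x]. *)
Lemma DV_euler x : dot (DV x) x = H x ^+ 2.
Proof.
have defE : H x ^+ 2 = 2 * V x by rewrite /half_sqr; field.
rewrite defE; apply/eqP; rewrite eq_le; apply/andP; split.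
  apply/ler_addgt0Pl => e e0.
  apply: dot_derivative_le; first exact: half_sqr_differentiable.
  have vx : 0 < V x + 1 by rewrite ltr_wpDl// half_sqr_ge0.
  exists (e / (V x + 1)); first exact: divr_gt0.
  move=> t /andP[t0]; rewrite ltr_pdivlMr// => te.
  have -> : x + t *: x = (1 + t) *: x by rewrite scalerDl scale1r.
  rewrite half_sqrZ//.
  have -> : (1 + t) ^+ 2 * V x - V x = t * (2 * V x + t * V x) by ring.
  rewrite ler_pM2l//; lra.
apply: dot_derivative_ge; first exact: half_sqr_differentiable.
exists 1 => // t /andP[t0 t1].
have -> : x + t *: x = (1 + t) *: x by rewrite scalerDl scale1r.
rewrite half_sqrZ//.
have -> : (1 + t) ^+ 2 * V x - V x = t * (2 * V x) + t ^+ 2 * V x by ring.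
by rewrite lerDl mulr_ge0 ?sqr_ge0 ?half_sqr_ge0.
Qed.

Lemma cauchy_schwarz x xi : dot x xi <= H0 x * H xi.
Proof.
have [->|x0] := eqVneq x 0; first by rewrite dot0l norm_zero// mul0r.
have hx := norm_pos hH0 x0.
rewrite mulrC -ler_pdivrMr// hdual; apply: sup_upper_bound; last by exists x.
split; first by exists (dot x xi / H0 x), x.
have [c c0 hc] := norm_ge_mx hH0.
exists (n%:R * `|xi| / c) => _ [y /= y0 <-].
have hy := norm_pos hH0 y0.
rewrite ler_pdivrMr// mulrAC ler_pdivlMr//.
apply: (@le_trans _ _ (n%:R * `|y| * `|xi| * c)).
  by rewrite ler_wpM2r ?(ltW c0)//; exact: le_trans (ler_norm _) (dot_norm_le _ _).
have -> : n%:R * `|y| * `|xi| * c = n%:R * `|xi| * (c * `|y|) by ring.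
by rewrite ler_wpM2l// mulr_ge0.
Qed.

(** The quotient in the dual norm is homogeneous of degree 0, so its supremum is a maximum over a
    compact sphere. *)
Lemma dual_attained xi : exists y, y != 0 /\ dot y xi = H0 y * H xi.
Proof.
have [x0 hx0] : [set x : 'rV[R]_n | `|x| = 1] !=set0.
  pose e : 'rV[R]_n := const_mx 1.
  have e0 : e != 0.
    apply/eqP => /rowP/(_ (Ordinal n0)); rewrite !mxE => /eqP; by rewrite oner_eq0.
  by exists (`|e|^-1 *: e); rewrite /= normrZ normfV normr_id mulVf ?normr_eq0.
have nz (y : 'rV[R]_n) : `|y| = 1 -> y != 0 by move=> y1; rewrite -normr_gt0 y1 ltr01.
have [|y /set_mem hy hmax] := @compact_EVT_max _ _ (fun y => dot y xi / H0 y) _ (ex_intro _ _ hx0) sphere_compact.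
  apply: continuous_in_subspaceT => y /set_mem/= y1.
  have c1 : {for y, continuous (fun z => dot z xi)}.
    rewrite (_ : (fun z => dot z xi) = dot xi); first exact: continuous_dot.
    by apply/funext => z; rewrite dotC.
  have c2 : {for y, continuous (fun z => (H0 z)^-1)}.
    by apply: continuousV; [rewrite gt_eqF// norm_pos// nz|exact: norm_continuous_rV].
  exact: (continuousM c1 c2).
have y0 := nz y hy; have Hy := norm_pos hH0 y0.
exists y; split=> //; apply/eqP; rewrite eq_le cauchy_schwarz/= mulrC -ler_pdivlMr//.
rewrite hdual; apply: ge_sup; first by exists (dot y xi / H0 y), y.
move=> _ [z /= z0 <-].
have zp : 0 < `|z| by rewrite normr_gt0.
have := hmax (`|z|^-1 *: z); rewrite inE/= normrZ normfV normr_id mulVf ?normr_eq0//.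
move=> /(_ erefl); rewrite dotZl (normZ hH0) normfV normr_id invfM invrK.
have -> // : `|z|^-1 * dot z xi * (`|z| / H0 z) = dot z xi / H0 z.
by field; rewrite !gt_eqF// norm_pos.
Qed.

(** A vector that attains the dual norm at [xi], scaled to [H0 z = H xi], is a subgradient there:
    [dot z eta <= H xi * H eta], and the product is at most half the sum of the squares. Hence it
    equals [DV xi]. *)
Lemma norm_DV xi : H0 (DV xi) = H xi.
Proof.
have [->|xi0] := eqVneq xi 0.
  by rewrite DV0 !norm_zero.
have Hxi := norm_pos hH xi0.
have [y [y0 hy]] := dual_attained xi; have Hy := norm_pos hH0 y0.
pose z := (H xi / H0 y) *: y.
have H0z : H0 z = H xi.
  by rewrite normZ// ger0_norm ?divr_ge0 ?ltW// divfK// gt_eqF.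
have zxi : dot z xi = H xi ^+ 2.
  by rewrite dotZl hy mulrA divfK ?gt_eqF// expr2.
rewrite (@subgradient_unique xi z)// => eta.
have := cauchy_schwarz z eta; rewrite H0z dotBr zxi /half_sqr.
by have := sqr_ge0 (H xi - H eta); nra.
Qed.

Lemma DV_surjective x : exists xi, DV xi = x.
Proof.
have [c c0 hc] := norm_ge_mx hH.
(* Beyond this radius the quadratic lower bound [c^2 |eta|^2 / 2] of [V] exceeds the linear term
   [n |x| |eta|], so the minimum over the ball of radius [rho] is global, and a global minimiser of
   [V - dot x] has subgradient [x]. *)
pose rho := 2 * (n%:R * `|x| + 1) / c ^+ 2 + 1.
have c20 : 0 < c ^+ 2 by rewrite exprn_gt0.
have nx : 0 <= n%:R * `|x| by rewrite mulr_ge0.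
have rho1 : 0 < rho by rewrite ltr_wpDl// divr_ge0// ?(ltW c20)//; lra.
pose f xi := V xi - dot x xi.
have cf : continuous f.
  move=> xi; apply: continuousB; last exact: continuous_dot.
  exact: differentiable_continuous (half_sqr_differentiable xi).
have cK : compact [set xi : 'rV[R]_n | `|xi| <= rho].
  apply: (@bounded_subset_compact _ _ _ rho) => //.
  apply: (@closed_comp _ _ (fun x : 'rV[R]_n => `|x|) [set y | y <= rho]).
    by move=> z _; exact: norm_continuous.
  exact: closed_le.
have K0 : [set xi : 'rV[R]_n | `|xi| <= rho] !=set0 by exists 0; rewrite /= normr0 ltW.
have [|xi /set_mem hxi hmin] := @compact_EVT_min _ _ f _ K0 cK.
  exact: continuous_subspaceT.
exists xi; apply: subgradient_unique => eta.
suff : f xi <= f eta by rewrite /f dotBr; lra.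
have [h|h] := lerP `|eta| rho; first by apply: hmin; rewrite inE.
have fxi0 : f xi <= 0.
  have := hmin 0; rewrite inE/= normr0 (ltW rho1) => /(_ isT).
  by rewrite {2}/f half_sqr0// dot0r subr0.
apply: le_trans fxi0 _; rewrite /f subr_ge0.
apply: le_trans (ler_norm _) _; apply: le_trans (dot_norm_le _ _) _.
have eta0 : 0 < `|eta| by exact: lt_trans h.
have h1 : (c * `|eta|) ^+ 2 <= H eta ^+ 2.
  by rewrite ler_sqr ?nnegrE ?norm_nonneg// mulr_ge0// ltW.
rewrite /half_sqr ler_pdivlMr//; apply: le_trans h1.
have -> : (c * `|eta|) ^+ 2 = c ^+ 2 * `|eta| * `|eta| by ring.
have -> : n%:R * `|x| * `|eta| * 2 = (2 * (n%:R * `|x|)) * `|eta| by ring.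
rewrite ler_wpM2r//.
have h2 : 2 * (n%:R * `|x| + 1) / c ^+ 2 < `|eta| by move: h; rewrite /rho; lra.
by move: h2; rewrite ltr_pdivrMr// expr2; lra.
Qed.

(** The inverse of [DV]. It turns out to be the gradient of [half_sqr H0], and this is how
    [half_sqr H0] is seen to be of class C^1. *)
Definition Wulff_dual (x : 'rV[R]_n) : 'rV[R]_n := projT1 (cid (DV_surjective x)).
Local Notation G := Wulff_dual.

Lemma DV_G x : DV (G x) = x.
Proof. by rewrite /Wulff_dual; case: cid. Qed.

Lemma DV_injective xi eta : DV xi = DV eta -> xi = eta.
Proof.
move=> defE; apply/eqP; apply: contrapT => /negP ne.
have := convex_tangent_lt ne; rewrite eq_sym in ne; have := convex_tangent_lt ne.
by rewrite defE -opprB dotNr; lra.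
Qed.

Lemma G_DV xi : G (DV xi) = xi.
Proof. by apply: DV_injective; rewrite DV_G. Qed.

Lemma norm_G x : H (G x) = H0 x.
Proof. by rewrite -norm_DV DV_G. Qed.

Lemma DV_strictly_monotone xi eta : xi != eta -> 0 < dot (DV xi - DV eta) (xi - eta).
Proof.
move=> ne; have := convex_tangent_lt ne; rewrite eq_sym in ne; have := convex_tangent_lt ne.
by rewrite dotBl -[eta - xi]opprB dotNr; lra.
Qed.

Lemma DV_monotone xi eta : 0 <= dot (DV xi - DV eta) (xi - eta).
Proof.
have [->|/DV_strictly_monotone/ltW//] := eqVneq xi eta.
by rewrite [eta - eta]subrr dot0r.
Qed.

Lemma continuous_DV : continuous DV.
Proof.
have [C0 C00 hC0] := norm_le_mx hH; have [c c0 hc] := norm_ge_mx hH0.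
move=> x; have [->|x0] := eqVneq x 0.
  apply/continuous_atP => e e0; exists (e * c / C0); first by rewrite divr_gt0// mulr_gt0.
  rewrite DV0.
  move=> y; rewrite !subr0 ltr_pdivlMr// mulrC => h.
  rewrite -(ltr_pM2r c0); apply: le_lt_trans h.
  by have := hc (DV y); have := hC0 y; rewrite norm_DV mulrC; lra.
have cH : C1_on [set~ 0] V.
  have cHH : C1_on [set~ 0] (fun y => H y * H y) := C1_onM open_setC0 hHC1 hHC1.
  have := C1_onM open_setC0 cHH (@C1_on_cst R n [set~ 0] 2^-1).
  by rewrite (_ : (fun y => _) = half_sqr H).
by have /cH[] : [set~ 0] x by exact/eqP.
Qed.

(** The usual argument for the inverse of a continuous injective map with compactness: near [x] the
    values of [G] stay in a ball by [norm_G], and on the part of that ball at distance at least [e]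
    from [G x] the distance from [DV eta] to [x] has a positive minimum. *)
Lemma continuous_G : continuous G.
Proof.
have [c c0 hc] := norm_ge_mx hH; have [C C0 hC] := norm_le_mx hH0.
move=> x; apply/continuous_atP => e e0.
pose rho := C * (`|x| + 1) / c.
pose S := [set eta : 'rV[R]_n | `|eta| <= rho] `&` [set eta | e <= `|eta - G x|].
have bG y : `|y - x| < 1 -> `|G y| <= rho.
  move=> yx; rewrite ler_pdivlMr// mulrC; apply: le_trans (hc _) _; rewrite norm_G.
  apply: le_trans (hC _) _; rewrite ler_pM2l//.
  by have := ler_normD (y - x) x; rewrite subrK; lra.
have [[eta0 Seta0]|nS] := pselect (S !=set0); last first.
  exists 1 => // y /bG h; rewrite ltNge; apply/negP => h'; apply: nS.
  by exists (G y).
have cS : compact S.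
  apply: (@bounded_subset_compact _ _ _ rho); last by move=> z [].
  apply: closedI.
    apply: (@closed_comp _ _ (fun x : 'rV[R]_n => `|x|) [set y | y <= rho]).
      by move=> z _; exact: norm_continuous.
    exact: closed_le.
  apply: (@closed_comp _ _ (fun y : 'rV[R]_n => `|y - G x|) [set y | e <= y]).
    move=> z _; apply: (@continuous_comp _ _ _ (fun y : 'rV[R]_n => y - G x) (fun y : 'rV[R]_n => `|y|)).
      by apply: (@continuousB _ _ _ id (cst (G x))); [exact: cvg_id|exact: cst_continuous].
    exact: norm_continuous.
  exact: closed_ge.
have [|m /set_mem[_ hm] hmin] := @compact_EVT_min _ _ (fun eta => `|DV eta - x|) _ (ex_intro _ _ Seta0) cS.
  apply: continuous_subspaceT => z.
  apply: (@continuous_comp _ _ _ (fun y : 'rV[R]_n => DV y - x) (fun y : 'rV[R]_n => `|y|)).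
    by apply: continuousB; [exact: continuous_DV|exact: cst_continuous].
  exact: norm_continuous.
have m0 : 0 < `|DV m - x|.
  rewrite normr_gt0 subr_eq0; apply/eqP => mx.
  by move: hm; rewrite /= -mx G_DV subrr normr0 leNgt e0.
exists (Num.min 1 `|DV m - x|); first by rewrite lt_min ltr01.
move=> y; rewrite lt_min => /andP[/bG h1 h2]; rewrite ltNge; apply/negP => h3.
by have := hmin (G y); rewrite inE DV_G => /(_ (conj h1 h3)); rewrite leNgt h2.
Qed.

Lemma half_sqr_dual_tangent x y : half_sqr H0 x + dot (G x) (y - x) <= half_sqr H0 y.
Proof.
have := cauchy_schwarz y (G x); rewrite norm_G => h.
have e1 : dot (G x) x = H0 x ^+ 2 by have := DV_euler (G x); rewrite DV_G norm_G dotC.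
by rewrite dotBr e1 (dotC _ y) /half_sqr; have := sqr_ge0 (H0 y - H0 x); nra.
Qed.

(** The tangent inequalities at [x] and at [x + h] squeeze the increment between the slopes [G x]
    and [G (x + h)]; continuity of [G] closes the gap. *)
Lemma half_sqr_dual_grad x : differentiable (half_sqr H0) x /\ grad (half_sqr H0) x = G x.
Proof.
apply: expansion_differentiable => e e0.
have n00 : 0 < n%:R :> R by rewrite ltr0n.
have /continuous_atP/(_ _ (divr_gt0 e0 n00))[d d0 hd] := @continuous_G x.
exists d => // h hd'.
have := half_sqr_dual_tangent x (h + x); have := half_sqr_dual_tangent (h + x) x.
rewrite addrK opprD addrCA subrr addr0 dotNr => h1 h2.
have h3 : dot (G (h + x) - G x) h <= e * `|h|.
  apply: le_trans (ler_norm _) _; apply: le_trans (dot_norm_le _ _) _.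
  rewrite ler_wpM2r// mulrC -ler_pdivlMr//; apply: ltW; apply: hd.
  by rewrite addrK.
rewrite dotBl in h3; rewrite ler_norml; apply/andP; split; last lra.
by apply: (@le_trans _ _ 0); [rewrite oppr_le0 mulr_ge0// ltW|lra].
Qed.

Lemma half_sqr_dual_C1 D : C1_on D (half_sqr H0).
Proof.
move=> x _; have [d _] := half_sqr_dual_grad x; split=> //.
rewrite (_ : grad _ = G); first exact: continuous_G.
by apply/funext => y; have [] := half_sqr_dual_grad y.
Qed.

End duality.

Section weak_solutions.
Context {R : realType} {n : nat}.
Local Notation mu := (lebesgue_rV n : {measure set 'rV[R]_n -> \bar R}).

(** Replaces the distributional gradient by the classical one. The second conclusion, finite
    Dirichlet energy, is what later allows cutting off at the origin. *)
Lemma weak_solution_C1 (H : 'rV[R]_n -> R) (Om Sig : set 'rV[R]_n) (u : 'rV[R]_n -> R) :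
  open Om -> open Sig -> continuous (grad (half_sqr H)) ->
  C1_on (Om `&` Sig) u -> weak_solution H Om Sig (fun=> 1) u ->
  (forall v, C1c (Om `&` Sig) v ->
     Lint ((fun x => dot (grad v x) (grad (half_sqr H) (grad u x))) \_ (Om `&` Sig)) = Lint v) /\
  (forall i, mu.-integrable setT (EFin \o (fun x => (((fun y => partial i u y) \_ (Om `&` Sig)) x) ^+ 2))).
Proof.
move=> oO oS cDV cu [g [Wg _] sol]; have [_ L2g _] := Wg; have oD := openI oO oS.
have mD := open_measurable_rV oD.
have gae : {ae mu, forall x, (Om `&` Sig) x -> g x = grad u x}.
  have : \forall x \ae mu, forall i, (Om `&` Sig) x -> g x ord0 i = partial i u x.
    apply: filter_forall => i; exact: weak_gradient_unique oD cu Wg.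
  by apply: filterS => x h Dx; apply/rowP => i; rewrite h// mxE.
have mg i : measurable_fun setT ((fun x => g x ord0 i) \_ (Om `&` Sig)).
  by have := L2g i; rewrite /L2 inE => /andP[]; rewrite inE.
pose gD x : 'rV[R]_n := \row_i ((fun x => g x ord0 i) \_ (Om `&` Sig)) x.
have gDE x : (Om `&` Sig) x -> gD x = g x.
  by move=> Dx; apply/rowP => i; rewrite mxE res_in.
have mDVg i : measurable_fun (Om `&` Sig) (fun x => grad (half_sqr H) (g x) ord0 i).
  apply: (@eq_measurable_fun _ _ _ _ _ (fun x => grad (half_sqr H) (gD x) ord0 i)).
    by move=> x /set_mem Dx; rewrite gDE.
  apply: measurable_funTS.
  have mgD : measurable_fun setT gD.
    by apply: measurable_fun_rVP => j; under eq_fun do rewrite mxE; exact: mg.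
  have mDV : measurable_fun setT (fun x => grad (half_sqr H) x ord0 i).
    apply: measurable_fun_continuous => x; move: i; apply/continuous_rVP; exact: cDV.
  exact: (measurableT_comp mDV mgD).
have cgu x : (Om `&` Sig) x -> {for x, continuous (grad u)}.
  by move=> Dx; exact: C1_grad_continuous cu Dx.
split.
  move=> v; apply: (@weak_formulation_C1c R n (Om `&` Sig) (fun x => grad (half_sqr H) (grad u x)) v oD).
    move=> x Dx; by apply: (@continuous_comp _ _ _ (grad u) (grad (half_sqr H))); [exact: cgu|exact: cDV].
  move=> phi tphi; have cphi := test_C1c tphi.
  have := sol phi (grad phi) (test_W12_Gamma0 oO oS tphi).
  pose f x := dot (grad phi x) (grad (half_sqr H) (grad u x)).
  have cF i x : (Om `&` Sig) x -> {for x, continuous (fun y => grad (half_sqr H) (grad u y) ord0 i)}.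
    move=> Dx; move: i; apply/continuous_rVP.
    by apply: (@continuous_comp _ _ _ (grad u) (grad (half_sqr H))); [exact: cgu|exact: cDV].
  have bf : BM (f \_ (Om `&` Sig)).
    have -> : f \_ (Om `&` Sig) = fun x => \sum_(i < n)
        partial i phi x * ((fun y => grad (half_sqr H) (grad u y) ord0 i) \_ (Om `&` Sig)) x.
      apply/funext => x; have [Dx|nDx] := pselect ((Om `&` Sig) x).
        by rewrite res_in//; apply: eq_bigr => i _; rewrite res_in// gradE.
      by rewrite res_out// big1// => i _; rewrite res_out// mulr0.
    apply: BM_sum => i; apply: BMM; first exact: C1c_BM_partial cphi.
      by apply: measurable_restrict_open => // x; exact: cF.
    have [_ [K [cK KD phi0]]] := cphi.
    have /compact_bounded[B [Br hB]] : compact ((fun y => grad (half_sqr H) (grad u y) ord0 i) @` K).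
      by apply: continuous_compact => //; apply: continuous_in_subspaceT => x /set_mem/KD; exact: cF.
    exists (`|B| + 1) => x px.
    have Kx : K x.
      apply: contrapT => nKx; move: px.
      by rewrite -gradE (grad_eq0_out cK phi0 nKx) mxE eqxx.
    rewrite res_in; last exact: KD.
    apply: (hB (`|B| + 1)); last by exists x.
    by apply: le_lt_trans (ler_norm _) _; rewrite ltrDl.
  have -> : (\int[mu]_(x in Om `&` Sig) (dot (grad phi x) (grad (half_sqr H) (g x)))%:E =
             \int[mu]_(x in Om `&` Sig) (f x)%:E)%E.
    apply: ae_eq_integral => //.
    - apply/measurable_EFinP; apply: measurable_sum => i.
      apply: measurable_funM; last exact: mDVg.
      rewrite (_ : (fun x => grad phi x ord0 i) = partial i phi); last first.
        by apply/funext => x; rewrite gradE.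
      by apply: measurable_funTS; case: (C1c_BM_partial i cphi).
    - apply/measurable_EFinP; apply/(measurable_restrictT _ mD); exact: bf.1.
    - by apply: filterS gae => x h Dx /=; rewrite /f h.
  rewrite integral_BM//.
  have -> : (\int[mu]_(x in Om `&` Sig) (1 * phi x)%:E = \int[mu]_(x in Om `&` Sig) (phi x)%:E)%E.
    by apply: eq_integral => x _; rewrite mul1r.
  rewrite integral_BM; last by rewrite C1c_restrict_id//; exact: C1c_BM cphi.
  by rewrite (C1c_restrict_id cphi) => -[].
move=> i; have /integrableP[m2 fin2] := Lfun2_integrable_sqr (L2g i).
have mpu : measurable_fun setT ((fun y => partial i u y) \_ (Om `&` Sig)).
  apply: measurable_restrict_open => // x Dx.
  by apply: continuous_partial; exact: cgu.
have mpu2 : measurable_fun setT (EFin \o (fun x => (((fun y => partial i u y) \_ (Om `&` Sig)) x) ^+ 2)).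
  by apply/measurable_EFinP; exact: measurable_funX.
apply/integrableP; split=> //.
pose g2 x : R := ((fun x => g x ord0 i) \_ (Om `&` Sig)) x ^+ 2.
have defE : (\int[mu]_x `|(EFin \o g2) x| = \int[mu]_x `|(EFin \o (fun x => ((fun y => partial i u y) \_ (Om `&` Sig)) x ^+ 2)%R) x|)%E.
  apply: ae_eq_integral => //; [exact: measurableT_comp|exact: measurableT_comp|].
  apply: filterS gae => x h _ /=; congr (`|(_ ^+ 2)%:E|)%E.
  have [Dx|nDx] := pselect ((Om `&` Sig) x); last by rewrite !res_out.
  by rewrite !res_in// h// gradE.
by rewrite -defE.
Qed.

End weak_solutions.

(** * Smooth transitions and limits of integrals *)

Section cutoff_tools.
Context {R : realType}.

Lemma flat_bounded (p : {poly R}) : exists2 C, 0 < C & forall t, `|flat p t| <= C.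
Proof.
have [C C0 hC] := poly_expR_bound p (@ltr01 R).
exists C => // t; rewrite /flat; case: ifPn => [t0|_]; last by rewrite normr0 ltW.
have ti : 0 < t^-1 by rewrite invr_gt0.
have := hC _ (ltW ti); rewrite mul1r normrM (ger0_norm (expR_ge0 _)) expRN => h.
by rewrite ler_pdivrMr ?expR_gt0.
Qed.

(** The standard smooth transition from 0 on the negative axis to 1 beyond 1; the two terms of the
    denominator never vanish together. *)
Definition step (t : R) : R := flat1 t / (flat1 t + flat1 (1 - t)).
Definition dstep (t : R) : R :=
  (dflat1 t * flat1 (1 - t) + flat1 t * dflat1 (1 - t)) / (flat1 t + flat1 (1 - t)) ^+ 2.

Lemma step_den_gt0 (t : R) : 0 < flat1 t + flat1 (1 - t).
Proof.
have [t0|t0] := ltrP 0 t; first by rewrite ltr_pwDl ?flat1_gt0 ?flat1_ge0.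
by rewrite ltr_wpDl ?flat1_ge0// flat1_gt0//; lra.
Qed.

Lemma step_ge0 (t : R) : 0 <= step t.
Proof. by rewrite /step divr_ge0 ?flat1_ge0// ltW// step_den_gt0. Qed.

Lemma step_le1 (t : R) : step t <= 1.
Proof. by rewrite /step ler_pdivrMr ?step_den_gt0// mul1r lerDl flat1_ge0. Qed.

Lemma step_le0 (t : R) : t <= 0 -> step t = 0.
Proof. by move=> t0; rewrite /step flat1_le0// mul0r. Qed.

Lemma step_ge1 (t : R) : 1 <= t -> step t = 1.
Proof.
move=> t1; rewrite /step (@flat1_le0 _ (1 - t)) ?addr0 ?divff//; last lra.
by rewrite gt_eqF// flat1_gt0//; lra.
Qed.

Lemma dstep_ge0 (t : R) : 0 <= dstep t.
Proof.
by rewrite /dstep divr_ge0 ?sqr_ge0// addr_ge0// mulr_ge0 ?flat1_ge0 ?dflat1_ge0.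
Qed.

Lemma dflat1_le0 (t : R) : t <= 0 -> dflat1 t = 0 :> R.
Proof. exact: flat_le0. Qed.

Lemma dstep_out (t : R) : ~~ (0 < t < 1) -> dstep t = 0.
Proof.
rewrite negb_and -!leNgt => /orP[t0|t1]; rewrite /dstep.
  by rewrite (flat1_le0 t0) (dflat1_le0 t0) !mul0r addr0 mul0r.
by rewrite (@flat1_le0 _ (1 - t)) ?(@dflat1_le0 (1 - t)) ?mulr0 ?addr0 ?mul0r//; lra.
Qed.

Lemma is_derive_step (t : R) : is_derive t (1 : R) step (dstep t).
Proof.
have d1 := is_derive_flat1 t.
have d0 : is_derive t (1 : R) (fun s : R => 1 - s) (-1).
  have := @is_deriveB R R R (cst 1) id t 1 0 1 _ _; rewrite sub0r; apply.
have d2 : is_derive t (1 : R) (fun s => flat1 (1 - s)) (dflat1 (1 - t) * -1).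
  exact: (@is_derive1_comp _ flat1 (fun s : R => 1 - s) t _ _ (is_derive_flat1 (1 - t)) d0).
have d3 := is_deriveD d1 d2.
have den0 : flat1 t + flat1 (1 - t) != 0 by rewrite gt_eqF// step_den_gt0.
have d4 := @is_deriveV _ (flat1 + (fun s => flat1 (1 - s))) t _ 1 den0 d3.
have d5 := is_deriveM d1 d4.
apply: is_derive_eq d5 _.
rewrite -[(flat1 + (fun s : R => flat1 (1 - s))) t]/(flat1 t + flat1 (1 - t)).
by rewrite /dstep /GRing.scale/=; field.
Qed.

Lemma continuous_dstep : continuous dstep.
Proof.
move=> t.
have c1 : {for t, continuous (fun s : R => 1 - s)}.
  by apply: continuousB; [exact: cst_continuous|exact: cvg_id].
have cE1 : {for t, continuous (fun s : R => flat1 (1 - s) : R)}.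
  by apply: (@continuous_comp _ _ _ (fun s : R => 1 - s) flat1) => //; exact: continuous_flat1.
have cdE1 : {for t, continuous (fun s : R => dflat1 (1 - s) : R)}.
  by apply: (@continuous_comp _ _ _ (fun s : R => 1 - s) dflat1) => //; exact: continuous_dflat1.
have cden : {for t, continuous (fun s : R => flat1 s + flat1 (1 - s) : R)}.
  by apply: continuousD => //; exact: continuous_flat1.
have cnum : {for t, continuous (fun s : R => dflat1 s * flat1 (1 - s) + flat1 s * dflat1 (1 - s) : R)}.
  by apply: continuousD; apply: continuousM => //; [exact: continuous_dflat1|exact: continuous_flat1].
have cden2 : {for t, continuous (fun s : R => (flat1 s + flat1 (1 - s)) * (flat1 s + flat1 (1 - s)) : R)}.
  exact: continuousM.
have cinv : {for t, continuous (fun s : R => ((flat1 s + flat1 (1 - s)) * (flat1 s + flat1 (1 - s)))^-1 : R)}.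
  by apply: continuousV => //; rewrite mulf_neq0// gt_eqF// step_den_gt0.
exact: (continuousM cnum cinv).
Qed.

Lemma dstep_bounded : exists2 B, 0 < B & forall t, dstep t <= B.
Proof.
have : compact (dstep @` `[0, 1]).
  apply: continuous_compact; last exact: segment_compact.
  exact: continuous_subspaceT continuous_dstep.
move=> /compact_bounded[B [Br hB]]; exists (`|B| + 1); first by rewrite ltr_wpDl.
move=> t; have [h|h] := boolP (0 < t < 1); last by rewrite dstep_out// addr_ge0.
apply: le_trans (ler_norm _) _; apply: (hB (`|B| + 1)).
  by apply: le_lt_trans (ler_norm _) _; rewrite ltrDl.
by exists t => //; rewrite /= in_itv/=; case/andP : h => /ltW -> /ltW ->.
Qed.

Context {n : nat}.
Local Notation mu := (lebesgue_rV n : {measure set 'rV[R]_n -> \bar R}).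

Lemma Lint_dominated (f : nat -> 'rV[R]_n -> R) (g : 'rV[R]_n -> R) :
  (forall k, BM (f k)) -> mu.-integrable setT (EFin \o g) ->
  (forall k x, `|f k x| <= g x) -> (forall x, f k x @[k --> \oo] --> 0) ->
  Lint (f k) @[k --> \oo] --> 0.
Proof.
move=> bf ig fg f0.
have [|||||] := @dominated_convergence _ _ _ mu setT measurableT
    (fun k x => (f k x)%:E) (fun=> 0%E) (EFin \o g) => //.
- by move=> k; apply/measurable_EFinP; case: (bf k).
- by apply: nearW => x _; apply: cvg_EFin; [exact: nearW|exact: f0].
- by apply: nearW => x k _; rewrite abse_EFin lee_fin.
move=> _ _; rewrite integral0 => h.
have -> : (fun k => Lint (f k)) = fine \o (fun k => \int[mu]_x (f k x)%:E)%E by [].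
by apply: fine_cvg.
Qed.

Lemma dot_self_grad (x : 'rV[R]_n) :
  differentiable (fun y : 'rV[R]_n => dot y y) x /\ grad (fun y : 'rV[R]_n => dot y y) x = 2 *: x.
Proof.
apply: expansion_differentiable => e e0.
have n0 : 0 < n%:R + 1 :> R by rewrite ltr_wpDl.
exists (e / (n%:R + 1)); first exact: divr_gt0.
move=> h; rewrite ltr_pdivlMr// => hd.
have -> : dot (h + x) (h + x) - dot x x - dot (2 *: x) h = dot h h.
  by rewrite !dotDl !dotDr dotZl (dotC h x); ring.
apply: le_trans (dot_norm_le _ _) _.
by rewrite ler_wpM2r//; have := normr_ge0 h; nra.
Qed.

Lemma dot_self_C1 (D : set 'rV[R]_n) : C1_on D (fun y : 'rV[R]_n => dot y y).
Proof.
move=> x _; have [d _] := dot_self_grad x; split=> //.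
rewrite (_ : grad _ = fun y : 'rV[R]_n => 2 *: y).
  by apply: (@continuousZ _ _ _ (cst 2) id); [exact: cst_continuous|exact: cvg_id].
by apply/funext => y; have [] := dot_self_grad y.
Qed.

(** Links the maximum norm of row vectors to the Euclidean square, which is smooth and hence used
    for radial cutoffs. *)
Lemma dot_self_ge (x : 'rV[R]_n) : `|x| ^+ 2 <= dot x x.
Proof.
have d0 : 0 <= dot x x by apply: sumr_ge0 => i _; rewrite -expr2 sqr_ge0.
rewrite -(sqr_sqrtr d0) ler_sqr ?nnegrE ?sqrtr_ge0//.
apply/normr_rV_le => [|i]; first exact: sqrtr_ge0.
rewrite -sqrtr_sqr ler_sqrt// /dot (bigD1 i)//= -expr2 lerDl.
by apply: sumr_ge0 => j _; rewrite -expr2 sqr_ge0.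
Qed.

Lemma BM_dot_C1c (D : set 'rV[R]_n) (A : 'rV[R]_n -> 'rV[R]_n) w : open D ->
  (forall x, D x -> {for x, continuous A}) -> C1c D w ->
  BM ((fun x => dot (grad w x) (A x)) \_ D).
Proof.
move=> oD cA cw.
have cAi i x : D x -> {for x, continuous (fun y => A y ord0 i)}.
  by move=> Dx; move: i; apply/continuous_rVP; exact: cA.
have -> : (fun x => dot (grad w x) (A x)) \_ D = fun x => \sum_(i < n)
    partial i w x * ((fun y => A y ord0 i) \_ D) x.
  apply/funext => x; have [Dx|nDx] := pselect (D x).
    by rewrite res_in//; apply: eq_bigr => i _; rewrite res_in// gradE.
  by rewrite res_out// big1// => i _; rewrite res_out// mulr0.
apply: BM_sum => i; apply: BMM; first exact: C1c_BM_partial cw.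
  by apply: measurable_restrict_open => // x; exact: cAi.
have [_ [K [cK KD w0]]] := cw.
have /compact_bounded[B [Br hB]] : compact ((fun y => A y ord0 i) @` K).
  by apply: continuous_compact => //; apply: continuous_in_subspaceT => x /set_mem/KD; exact: cAi.
exists (`|B| + 1) => x px.
have Kx : K x.
  apply: contrapT => nKx; move: px.
  by rewrite -gradE (grad_eq0_out cK w0 nKx) mxE eqxx.
rewrite res_in; last exact: KD.
apply: (hB (`|B| + 1)); last by exists x.
by apply: le_lt_trans (ler_norm _) _; rewrite ltrDl.
Qed.

Lemma continuous_dot2 (A B : 'rV[R]_n -> 'rV[R]_n) x :
  {for x, continuous A} -> {for x, continuous B} ->
  {for x, continuous (fun y => dot (A y) (B y))}.
Proof.
move=> cA cB; rewrite /dot.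
have h i : {for x, continuous (fun y => A y ord0 i * B y ord0 i)}.
  by apply: continuousM; [move: i; exact/continuous_rVP|move: i; exact/continuous_rVP].
elim: (index_enum 'I_n) => [|i s ih].
  rewrite (_ : (fun y => _) = cst 0); first exact: cst_continuous.
  by apply/funext => y; rewrite big_nil.
rewrite (_ : (fun y => _) =
    (fun y => A y ord0 i * B y ord0 i + \sum_(j <- s) A y ord0 j * B y ord0 j)).
  exact: continuousD.
by apply/funext => y; rewrite big_cons.
Qed.

End cutoff_tools.

(** * Comparison principle *)

Section neumann_patch.
Context {R : realType} {n : nat}.
Variables (D : set 'rV[R]_n) (A : 'rV[R]_n -> 'rV[R]_n).
Hypotheses (oD : open D) (cA : forall x, D x -> {for x, continuous A}).
Hypothesis weak : forall w, C1c D w -> (forall x, 0 <= w x) ->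
  Lint ((fun x => dot (grad w x) (A x)) \_ D) <= 0.

(** Functions that need not vanish near the boundary of [D]; the bounds keep the flux of a bump
    times [f] bounded wherever [A] is bounded. *)
Definition tame (f : 'rV[R]_n -> R) := [/\ C1_on D f, forall x, D x -> 0 <= f x &
  exists2 M, 0 < M & forall x, D x -> `|f x| <= M /\ `|grad f x| <= M].

Definition flux (f : 'rV[R]_n -> R) : 'rV[R]_n -> R := (fun x => dot (grad f x) (A x)) \_ D.

(* On D the field A satisfies [dot A (grad psi) = 0] in the limit at the part
   psi = 0 of the boundary of D. *)
Definition neumann_chart (y : 'rV[R]_n) := exists U psi,
  [/\ open U /\ U y, C1_on U psi, grad psi y != 0,
      (forall x, D x -> U x -> psi x < 0) /\
      (forall x, closure D x -> ~ D x -> U x -> psi x = 0) &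
      forall x, closure D x -> ~ D x -> U x ->
        dot (A z) (grad psi z) @[z --> within D (nbhs x)] --> (0 : R)].

Lemma C1_on_step (P : set 'rV[R]_n) f : open P -> C1_on P f -> C1_on P (fun x => step (f x)).
Proof.
move=> oP cf; apply: (C1_on_comp oP cf (fun x _ => is_derive_step (f x))) => x _.
exact: continuous_dstep.
Qed.

Lemma grad_step (f : 'rV[R]_n -> R) x : differentiable f x ->
  grad (fun y => step (f y)) x = dstep (f x) *: grad f x.
Proof. by move=> df; exact: grad_comp df (is_derive_step (f x)). Qed.

Lemma nbhs_cbox (y : 'rV[R]_n) (P : set 'rV[R]_n) : nbhs y P ->
  exists a b : 'rV[R]_n, [/\ box a b y, cbox a b `<=` P & forall i, a ord0 i < b ord0 i].
Proof.
move=> /nbhs_ballP[e /= e0 eP].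
exists (y - const_mx (e / 2)), (y + const_mx (e / 2)).
have e20 : 0 < e / 2 by rewrite divr_gt0.
split=> [i|x xb|i]; [by rewrite !mxE; lra| |by rewrite !mxE; lra].
apply: eP; apply/ball_rVP => // i; have := xb i; rewrite !mxE => /andP[h1 h2].
by rewrite ltr_norml; apply/andP; split; lra.
Qed.

Lemma bump1_C1 a b (P : set 'rV[R]_n) : C1_on P (bump 1 a b).
Proof. by apply: smooth_C1; exact: bump_smooth. Qed.

Lemma bump1_out a b (x : 'rV[R]_n) : ~ cbox a b x -> bump 1 a b x = 0.
Proof. by move=> nx; apply: bump_out => // /box_cbox. Qed.

Lemma bump1_C1c a b : C1c setT (bump 1 a b : 'rV[R]_n -> R).
Proof. by apply: test_C1c; exact: bump_test. Qed.

Lemma grad_bump1_bounded (a b : 'rV[R]_n) :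
  exists2 B, 0 < B & forall x, `|grad (bump 1 a b) x| <= B.
Proof.
have /choice[B hB] i : exists B, forall x, `|partial i (bump 1 a b) x| <= B.
  by have [_ [B [hB _]]] := C1c_BM_partial i (bump1_C1c a b); exists B.
exists (\sum_(i < n) `|B i| + 1); first by rewrite ltr_wpDl// sumr_ge0.
have S0 : 0 <= \sum_(i < n) `|B i| by rewrite sumr_ge0.
move=> x; apply/normr_rV_le => [|i]; first lra.
rewrite gradE; apply: le_trans (hB i x) _; apply: le_trans (ler_norm _) _.
rewrite (bigD1 i)//= -addrA lerDl addr_ge0//.
by rewrite sumr_ge0.
Qed.

Lemma flux_bump_interior a b phi : cbox a b `<=` D -> C1_on D phi ->
  (forall x, D x -> 0 <= phi x) ->
  BM (flux (fun x => bump 1 a b x * phi x)) /\ Lint (flux (fun x => bump 1 a b x * phi x)) <= 0.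
Proof.
move=> abD cphi phi0.
have cw := C1_onM oD (@bump1_C1 a b D) cphi.
have [cc gE] := C1c_restrict oD cw (@cbox_compact _ _ a b) abD
  (fun x _ nx => etrans (congr1 (fun t => t * phi x) (bump1_out nx)) (mul0r _)).
have fE : flux (fun x => bump 1 a b x * phi x) =
    flux ((fun x => bump 1 a b x * phi x) \_ D).
  apply/funext => x; rewrite /flux; have [Dx|nDx] := pselect (D x); last by rewrite !res_out.
  by rewrite !res_in// gE.
rewrite fE; split; first exact: BM_dot_C1c.
apply: weak => // x; have [Dx|nDx] := pselect (D x); last by rewrite res_out.
by rewrite res_in// mulr_ge0 ?bump_ge0// phi0.
Qed.

Lemma flux_vanishing f (P : set 'rV[R]_n) : open P ->
  (forall x, P x -> D x -> f x = 0) -> forall x, P x -> flux f x = 0.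
Proof.
move=> oP f0 x Px; rewrite /flux; have [Dx|nDx] := pselect (D x); last by rewrite res_out.
rewrite res_in// (@grad_eq _ _ f (cst 0)) ?grad_cst ?dot0l//.
near=> y; apply: f0; near: y; exact: open_near.
Unshelve. all: by end_near.
Qed.

Lemma flux_bump_out a b phi x : ~ cbox a b x -> flux (fun x => bump 1 a b x * phi x) x = 0.
Proof.
apply: (@flux_vanishing _ (~` cbox a b)).
  by apply: closed_openC; apply: compact_closedr; exact: cbox_compact.
by move=> y ny _; rewrite bump1_out// mul0r.
Qed.

Lemma measurable_flux f : C1_on D f -> measurable_fun setT (flux f).
Proof.
move=> cf; apply: measurable_restrict_open => // x Dx.
by apply: continuous_dot2; [exact: C1_grad_continuous cf Dx|exact: cA].
Qed.

Lemma flux_bump_BM a b phi : tame phi ->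
  (exists2 M, 0 < M & forall x, D x -> cbox a b x -> `|A x| <= M) ->
  BM (flux (fun x => bump 1 a b x * phi x)).
Proof.
move=> [cphi phi0 [M M0 hM]] [MA MA0 hMA].
have cw := C1_onM oD (@bump1_C1 a b D) cphi.
have [B B0 hB] := grad_bump1_bounded a b.
split; first exact: measurable_flux.
have [L L0 hL] := compact_normr_lt (@cbox_compact _ _ a b).
exists (Num.max L (n%:R * (M + M * B) * MA)); split=> x; last first.
  rewrite ge_max => /andP[h _]; apply: flux_bump_out => /hL; lra.
rewrite le_max; apply/orP; right.
have r0 : 0 <= n%:R * (M + M * B) * MA.
  by rewrite !mulr_ge0 ?(ltW MA0)// addr_ge0 ?mulr_ge0 ?ltW.
have [xb|nxb] := pselect (cbox a b x); last by rewrite flux_bump_out// normr0.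
rewrite /flux; have [Dx|nDx] := pselect (D x); last by rewrite res_out// normr0.
rewrite res_in//; apply: le_trans (dot_norm_le _ _) _.
apply: ler_pM => //; [apply: ler_wpM2l => //|exact: hMA].
have [h1 h2] := hM x Dx.
rewrite gradM; [|exact: smooth_differentiable (bump_smooth _ _ _)|exact: C1_differentiable cphi Dx].
apply: le_trans (ler_normD _ _) _; apply: lerD; rewrite normrZ.
  by rewrite ger0_norm ?bump_ge0//; apply: le_trans h2; rewrite ler_piMl// bump_le1.
by rewrite ler_pM.
Qed.


Lemma compact_sublevel (K : set 'rV[R]_n) (f : 'rV[R]_n -> R) : compact K ->
  (forall x, K x -> {for x, continuous f}) -> compact [set x | K x /\ 0 <= f x].
Proof.
move=> cK cf; apply: (subclosed_compact _ cK); last by move=> x [].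
rewrite -[X in closed X]setCK; apply: open_closedC; rewrite openE => x nx.
have [Kx|nKx] := pselect (K x); last first.
  by apply: filterS (nbhs_notin_compact cK nKx) => y nKy [].
have fx : f x < 0 by rewrite ltNge; apply/negP => h; exact: nx.
have /continuous_atP/(_ (- f x)) := cf x Kx; rewrite oppr_gt0 => /(_ fx)[d d0 hd].
apply/nbhs_ballP; exists d => //= y; rewrite -ball_normE /ball_/= distrC => /hd.
by rewrite ltr_norml => /andP[_ h] [_]; lra.
Qed.

(** By compactness of [K]: around a point of [D] the function [psi] stays away from 0, so a thin
    strip misses a neighbourhood; around a boundary point the limit hypothesis applies. *)
Lemma neumann_chart_uniform U (psi : 'rV[R]_n -> R) (K : set 'rV[R]_n) om :
  open U -> C1_on U psi -> compact K -> K `<=` closure D -> K `<=` U ->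
  (forall x, D x -> U x -> psi x < 0) ->
  (forall x, closure D x -> ~ D x -> U x ->
     dot (A z) (grad psi z) @[z --> within D (nbhs x)] --> (0 : R)) -> 0 < om ->
  exists2 d, 0 < d & forall x, K x -> D x -> - d < psi x -> `|dot (A x) (grad psi x)| <= om.
Proof.
move=> oU cpsi cK KD KU psineg lim0 om0.
apply: (@compact_induction _ K (fun S => exists2 d, 0 < d & forall x, S x -> D x -> - d < psi x ->
  `|dot (A x) (grad psi x)| <= om) cK).
- by exists 1.
- by move=> S S' SS' [d d0 h]; exists d => // x /SS'; exact: h.
- move=> S S' [d d0 h] [d' d'0 h']; exists (Num.min d d'); first by rewrite lt_min d0.
  have h1 : Num.min d d' <= d by rewrite ge_min lexx.
  have h2 : Num.min d d' <= d' by rewrite ge_min lexx orbT.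
  by move=> x [Sx|Sx] Dx hx; [apply: h|apply: h'] => //; lra.
- move=> x Kx; have [Dx|nDx] := pselect (D x).
    have px := psineg x Dx (KU x Kx).
    have /continuous_atP/(_ (- psi x / 2)) := C1_continuous cpsi (KU x Kx).
    have px2 : 0 < - psi x / 2 by lra.
    move=> /(_ px2)[d d0 hd]; exists (ball x d); first exact: nbhsx_ballx.
    exists (- psi x / 2) => // y [_]; rewrite -ball_normE /ball_/= distrC => /hd.
    by rewrite ltr_norml => /andP[_ h] _ h'; exfalso; lra.
  have /cvgrPdist_lt/(_ om om0) := lim0 x (KD x Kx) nDx (KU x Kx).
  rewrite near_withinE => h; exists [set z | D z -> `|0 - dot (A z) (grad psi z)| < om] => //.
  by exists 1 => // y [_ hy] Dy _; have := hy Dy; rewrite sub0r normrN => /ltW.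
Qed.

(* The test function is multiplied by step (- k psi - 1), which vanishes near
   psi = 0. The derivative of this factor lives on a strip of width 1 / k, where
   its integral stays bounded as k grows, by integration by parts against the
   bump; and dot (grad psi) A is small there. *)
Lemma flux_bump_neumann y : neumann_chart y ->
  (exists2 W, nbhs y W & exists2 M, 0 < M & forall x, D x -> W x -> `|A x| <= M) ->
  exists a b : 'rV[R]_n, box a b y /\ forall phi, tame phi ->
    BM (flux (fun x => bump 1 a b x * phi x)) /\ Lint (flux (fun x => bump 1 a b x * phi x)) <= 0.
Proof.
move=> [U [psi [[oU Uy] cpsi gy [psineg psi0] lim0]]] [W Wy [MA MA0 hMA]].
have [i s0] : exists i, partial i psi y != 0.
  apply: contrapT => h; move/eqP : gy; apply; apply/rowP => i; rewrite gradE mxE.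
  by apply/eqP; apply: contrapT => /negP h'; apply: h; exists i.
(* [sg] is the sign of a nonzero partial derivative at [y], and by continuity [sg * partial i psi]
   stays above half of its value near [y]. *)
pose s := partial i psi y; pose kp := `|s| / 2; pose sg := s / `|s|.
have kp0 : 0 < kp by rewrite divr_gt0// normr_gt0.
have sgs : sg * s = `|s|.
  by rewrite /sg mulrAC -expr2 -real_normK ?num_real// expr2 mulfK// normr_eq0.
have sg1 : `|sg| = 1 by rewrite /sg normrM normfV normr_id divff// normr_eq0.
have [d d0 hd] : exists2 d, 0 < d & forall x, `|x - y| < d -> kp <= sg * partial i psi x.
  have cp : {for y, continuous (partial i psi)}.
    by apply: continuous_partial; exact: C1_grad_continuous cpsi Uy.
  have /continuous_atP/(_ kp kp0)[d d0 hd] := cp; exists d => // x /hd h.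
  have : `|sg * (partial i psi x - s)| < kp by rewrite normrM sg1 mul1r.
  by rewrite ltr_norml mulrBr sgs => /andP[h1 _]; rewrite /kp in h1 *; lra.
have nP : nbhs y (U `&` W `&` ball y d).
  by apply: filterI; [apply: filterI => //; exact: open_near|exact: nbhsx_ballx].
have [a [b [yab abP _]]] := nbhs_cbox nP.
have abU : cbox a b `<=` U by move=> x /abP[[]].
have abW : cbox a b `<=` W by move=> x /abP[[]].
have abk x : cbox a b x -> kp <= sg * partial i psi x.
  by move=> /abP[_]; rewrite -ball_normE /ball_/= distrC; exact: hd.
exists a, b; split=> // phi tphi; have [cphi phi0 [M M0 hM]] := tphi.
pose be : 'rV[R]_n -> R := bump 1 a b.
pose T := flux (fun x => be x * phi x).
have bT : BM T by apply: flux_bump_BM => //; exists MA => // x Dx /abW; exact: hMA.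
split=> //; rewrite -/be -/T.
have cbe P : C1_on P be by exact: bump1_C1.
have bbe : BM be by exact: C1c_BM (bump1_C1c a b).
have be0 x : 0 <= be x by exact: bump_ge0.
have be_out x : ~ cbox a b x -> be x = 0 by exact: bump1_out.
have cbeU : C1c U be.
  by split; [exact: cbe|exists (cbox a b); split=> //; exact: cbox_compact].
(* [step (f k x)] is 0 for [psi x >= - 1 / (k + 1)] and 1 for [psi x <= - 2 / (k + 1)]. *)
pose f (k : nat) x := - k.+1%:R * psi x - 1.
have cf k : C1_on U (f k).
  exact: (C1_onB oU (C1_onZ (- k.+1%:R) oU cpsi) (@C1_on_cst _ _ U 1)).
have gf k x : U x -> grad (f k) x = - k.+1%:R *: grad psi x.
  move=> Ux; have dpsi := C1_differentiable cpsi Ux.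
  rewrite gradB ?gradZ ?[grad (fun=> 1) x]grad_cst ?subr0//.
  by apply: differentiableM => //; exact: differentiable_cst.
pose chi k x := step (f k x).
have cchi k : C1_on U (chi k).
  exact: C1_on_step oU (cf k).
have gchi k x : U x -> grad (chi k) x = (dstep (f k x) * - k.+1%:R) *: grad psi x.
  move=> Ux; rewrite (grad_comp (C1_differentiable (cf k) Ux) (is_derive_step (f k x))).
  by rewrite gf// scalerA.
have [B B0 hB] := @dstep_bounded R.
(* Up to sign, the factor of [grad psi] in the derivative of the cutoff, weighted by the bump: an
   approximate surface measure on the boundary. *)
pose q k x := be x * ((fun x => dstep (f k x) * k.+1%:R) \_ U) x.
have bq k : BM (q k).
  apply: BMM => //.
    apply: measurable_restrict_open => // x Ux; apply: continuousM; last exact: cst_continuous.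
    apply: (@continuous_comp _ _ _ (f k) dstep); last exact: continuous_dstep.
    exact: C1_continuous (cf k) Ux.
  exists (B * k.+1%:R) => x _; have [Ux|nUx] := pselect (U x); last first.
    by rewrite res_out// normr0 mulr_ge0// ltW.
  rewrite res_in// normrM (ger0_norm (dstep_ge0 _)) ger0_norm//.
  by rewrite ler_wpM2r.
have q0 k x : 0 <= q k x.
  rewrite /q mulr_ge0//; have [Ux|nUx] := pselect (U x); last by rewrite res_out.
  by rewrite res_in// mulr_ge0// dstep_ge0.
have q_out k x : ~ cbox a b x -> q k x = 0 by move=> nx; rewrite /q be_out// mul0r.
pose C := Lint (fun x => `|partial i be x|).
have bpbe : BM (partial i be) by exact: C1c_BM_partial (bump1_C1c a b).
(* Integrating [partial i (chi k) * be] by parts moves the derivative to the bump; since [chi k]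
   lies between 0 and 1 the result is bounded uniformly in [k], and [partial i psi] has size at
   least [kp] on the box. *)
have Iq k : kp * Lint (q k) <= C.
  have [b1 [b2 defE]] := integration_by_parts_C1c i oU (cchi k) cbeU.
  have E2 : (fun x => partial i (chi k) x * be x) \_ U = fun x => - ((partial i psi \_ U) x * q k x).
    apply/funext => x; have [Ux|nUx] := pselect (U x); last by rewrite !res_out// mul0r oppr0.
    by rewrite /q !res_in// -gradE gchi// mxE gradE; ring.
  have b3 : BM (fun x => (partial i psi \_ U) x * q k x).
    by rewrite E2 in b2; have := BMN b2; under eq_fun do rewrite opprK.
  rewrite E2 LintN// opprK in defE.
  rewrite -LintZ//; apply: (@le_trans _ _ (Lint (fun x => sg * ((partial i psi \_ U) x * q k x)))).
    apply: Lint_le; [exact: BMZ|exact: BMZ|move=> x].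
    have [xab|nx] := pselect (cbox a b x); last by rewrite q_out// !mulr0.
    rewrite res_in; last exact: abU.
    by rewrite mulrA ler_wpM2r// abk.
  rewrite LintZ// -defE; apply: le_trans (ler_norm _) _; rewrite normrM sg1 mul1r.
  apply: Lint_abs_le => //; first exact: BM_abs.
  move=> x; have [Ux|nUx] := pselect (U x); last by rewrite res_out// normr0.
  by rewrite res_in// normrM ler_piMl// ger0_norm ?step_ge0// step_le1.
have cK0 : compact (cbox a b `&` closure D).
  have c := @cbox_compact _ _ a b; apply: (subclosed_compact _ c) => [|x []//].
  by apply: closedI; [exact: compact_closedr|exact: closed_closure].
(* Normal component of the flux times [phi]; multiplied by [q k] it is the error [Y k] between the
   cut-off integrand and the flux of an admissible test function. *)
pose Z := (fun x => phi x * dot (grad psi x) (A x)) \_ (D `&` U).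
have oDU : open (D `&` U) by exact: openI.
have mZ : measurable_fun setT Z.
  apply: measurable_restrict_open => // x [Dx Ux]; apply: continuousM.
    exact: C1_continuous cphi Dx.
  by apply: continuous_dot2; [exact: C1_grad_continuous cpsi Ux|exact: cA].
have [Mp Mp0 hMp] : exists2 B, 0 < B & forall x, cbox a b x -> `|grad psi x| <= B.
  have /compact_bounded[L [Lr hL]] : compact (grad psi @` cbox a b).
    apply: continuous_compact; last exact: cbox_compact.
    by apply: continuous_in_subspaceT => x /set_mem/abU Ux; exact: C1_grad_continuous cpsi Ux.
  exists (`|L| + 1); first by rewrite ltr_wpDl.
  move=> x xab; apply: (hL (`|L| + 1)); last by exists x.
  by apply: le_lt_trans (ler_norm _) _; rewrite ltrDl.
pose Y k x := q k x * Z x.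
have bY k : BM (Y k).
  apply: BMM => //; exists (M * (n%:R * Mp * MA)) => x qx.
  have xab : cbox a b x by apply: contrapT => /(q_out k) h; rewrite h eqxx in qx.
  rewrite /Z; have [[Dx Ux]|nx] := pselect ((D `&` U) x); last first.
    by rewrite res_out// normr0 !mulr_ge0// ltW.
  rewrite res_in// normrM; apply: ler_pM => //; first by case: (hM x Dx).
  apply: le_trans (dot_norm_le _ _) _.
  by apply: ler_pM => //; [rewrite ler_wpM2l// hMp|apply: hMA => //; exact: abW].
pose chiU k := chi k \_ U.
have mchiU k : measurable_fun setT (chiU k).
  by apply: measurable_restrict_open => // x Ux; exact: C1_continuous (cchi k) Ux.
have chiU01 k x : 0 <= chiU k x <= 1.
  rewrite /chiU; have [Ux|nUx] := pselect (U x); last by rewrite res_out// lexx ler01.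
  by rewrite res_in// step_ge0 step_le1.
have bTc k : BM (fun x => T x * chiU k x).
  apply: BMM => //; exists 1 => x _.
  by have /andP[h1 h2] := chiU01 k x; rewrite ger0_norm.
have bTc' k : BM (fun x => T x * (1 - chiU k x)).
  apply: BMM => //; first exact: measurable_funB.
  by exists 1 => x _; have /andP[h1 h2] := chiU01 k x; rewrite ger0_norm; lra.
have ITchi k : Lint (fun x => T x * chiU k x) <= Lint (Y k).
  have cw : C1_on (D `&` U) (fun x => be x * phi x * chi k x).
    have c1 := C1_on_sub (@subIsetl _ D U) cphi.
    have c2 := C1_on_sub (@subIsetr _ D U) (cchi k).
    exact: (C1_onM oDU (C1_onM oDU (cbe _) c1) c2).
  pose K := [set x | (cbox a b `&` closure D) x /\ 0 <= f k x].
  have cK : compact K.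
    apply: compact_sublevel => // x [/abU Ux _]; exact: C1_continuous (cf k) Ux.
  have KDU : K `<=` D `&` U.
    move=> x [[/abU Ux clx] fx]; split=> //; apply: contrapT => nDx.
    by move: fx; rewrite /f psi0// mulr0 sub0r oppr_ge0 ler10.
  have w0 x : (D `&` U) x -> ~ K x -> be x * phi x * chi k x = 0.
    move=> [Dx Ux] nKx; have [xab|nx] := pselect (cbox a b x); last by rewrite be_out// !mul0r.
    rewrite /chi step_le0 ?mulr0//; apply: ltW; rewrite ltNge; apply/negP => h; apply: nKx.
    by split=> //; split=> //; exact: subset_closure.
  have [cc gE] := C1c_restrict oDU cw cK KDU w0.
  pose w := (fun x => be x * phi x * chi k x) \_ (D `&` U).
  have ccD : C1c D w := C1c_sub (@subIsetl _ D U) cc.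
  have w_ge0 x : 0 <= w x.
    rewrite /w; have [[Dx Ux]|nx] := pselect ((D `&` U) x); last by rewrite res_out.
    rewrite res_in//; apply: mulr_ge0; last exact: step_ge0.
    by apply: mulr_ge0; [exact: be0|exact: phi0].
  have := weak ccD w_ge0; rewrite -/(flux w) => Iw.
  have bw : BM (flux w) by exact: BM_dot_C1c.
  have -> : (fun x => T x * chiU k x) = fun x => flux w x + Y k x.
    apply/funext => x; rewrite /Y.
    have [Dx|nDx] := pselect (D x); last first.
      have -> : Z x = 0 by rewrite /Z res_out// => -[].
      by rewrite /T /flux !res_out// mul0r mulr0 addr0.
    rewrite /Z /chiU /q.
    have [Ux|nUx] := pselect (U x); last first.
      have nab : ~ cbox a b x by move=> /abU.
      rewrite {1}/T flux_bump_out// mul0r be_out// !mul0r addr0.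
      rewrite /flux res_in// (@grad_eq0_out _ _ K) ?dot0l//.
        move=> z nKz; rewrite /w; have [Dz|nDz] := pselect ((D `&` U) z); last by rewrite res_out.
        by rewrite res_in// w0.
      by move=> [[/nab]].
    rewrite /T /flux !res_in//.
    rewrite /w gE// [in RHS]gradM; last 2 first.
    - apply: differentiableM; [exact: C1_differentiable (cbe D) Dx|exact: C1_differentiable cphi Dx].
    - exact: C1_differentiable (cchi k) Ux.
    by rewrite gchi// scalerA dotDl !dotZl; ring.
  by rewrite LintD//; lra.
rewrite leNgt; apply/negP => IT.
have C0 : 0 <= C by exact: Lint_ge0.
(* Chosen so that [M * om] times the uniform bound [C / kp] on the integral of [q k] is at most a
   quarter of [Lint T]. *)
pose om := Lint T / 4 * kp / (M * (C + 1)).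
have C10 : 0 < C + 1 by rewrite ltr_wpDl.
have IT4 : 0 < Lint T / 4 by rewrite divr_gt0.
have om0 : 0 < om by apply: divr_gt0; apply: mulr_gt0.
have [dl dl0 hdl] := neumann_chart_uniform oU cpsi cK0 (@subIsetr _ _ _)
  (fun x h => abU x h.1) psineg lim0 om0.
have cv : Lint (fun x => T x * (1 - chiU k x)) @[k --> \oo] --> 0.
  apply: (@Lint_dominated _ _ _ (fun x => `|T x|)) => //.
  - by apply: BM_integrable; exact: BM_abs.
  - move=> k x; rewrite normrM ler_piMr//.
    by have /andP[h1 h2] := chiU01 k x; rewrite ger0_norm; lra.
  - move=> x; have [Dx|nDx] := pselect (D x); last first.
      by rewrite /T /flux res_out//; under eq_fun do rewrite mul0r; exact: cvg_cst.
    have [xab|nx] := pselect (cbox a b x); last first.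
      by rewrite /T flux_bump_out//; under eq_fun do rewrite mul0r; exact: cvg_cst.
    have Ux := abU x xab; have px := psineg x Dx Ux.
    (* From this index on, [psi x <= - 2 / (k + 1)], so the cutoff equals 1 at [x]. *)
    apply: cvg_near_cst; exists (Num.bound (2 / - psi x)) => // k /= hk.
    rewrite /chiU res_in// /chi step_ge1 ?subrr ?mulr0//.
    have : 2 / - psi x < k.+1%:R.
      apply: lt_le_trans (archi_boundP _) _; first by rewrite divr_ge0//; lra.
      by rewrite ler_nat; exact: leqW.
    rewrite ltr_pdivrMr; last lra.
    by rewrite /f => h; lra.
have /cvgrPdist_lt/(_ _ IT4)[k1 _ hk1] := cv.
(* The first bound makes the part removed by the cutoff cost less than a quarter of [Lint T]; the
   second puts the strip where [q k] lives inside [- dl < psi], where the normal flux is at most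
   [om]. *)
pose k := maxn k1 (Num.bound (2 / dl)).
have h1 : `|Lint (fun x => T x * (1 - chiU k x))| < Lint T / 4.
  by have := hk1 k; rewrite /= leq_maxl sub0r normrN; apply.
have h2 : `|Lint (Y k)| <= M * om * Lint (q k).
  rewrite -LintZ//; apply: Lint_abs_le => //; first exact: BMZ.
  move=> x; rewrite /Y normrM (ger0_norm (q0 k x)) mulrC.
  have [->|qx] := eqVneq (q k x) 0; first by rewrite !mulr0.
  apply: ler_wpM2r; first exact: q0.
  have xab : cbox a b x by apply: contrapT => /(q_out k) h; rewrite h eqxx in qx.
  have Ux := abU x xab.
  rewrite /Z; have [[Dx _]|nx] := pselect ((D `&` U) x); last first.
    by rewrite res_out// normr0 mulr_ge0// ltW.
  rewrite res_in// normrM; apply: ler_pM => //; first by case: (hM x Dx).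
  rewrite dotC; apply: hdl => //; first by split=> //; exact: subset_closure.
  have f1 : 0 < f k x < 1.
    apply: contrapT => /negP h; move: qx; rewrite /q res_in// dstep_out// mul0r mulr0.
    by rewrite eqxx.
  have : 2 / dl < k.+1%:R.
    apply: lt_le_trans (archi_boundP _) _; first by rewrite divr_ge0// ltW.
    by rewrite ler_nat; apply: leqW; rewrite leq_maxr.
  rewrite ltr_pdivrMr// => h.
  have k0 : 0 < k.+1%:R :> R by rewrite ltr0n.
  by case/andP : f1 => _; rewrite /f => f1; nra.
have h3 : M * om * Lint (q k) <= Lint T / 4.
  have defE : M * om = Lint T / 4 * kp / (C + 1).
    by rewrite /om; field; rewrite (gt_eqF C10) (gt_eqF M0).
  have -> : M * om * Lint (q k) = Lint T / 4 * (kp * Lint (q k)) / (C + 1) by rewrite defE; ring.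
  rewrite ler_pdivrMr//; apply: ler_wpM2l; first exact: ltW.
  apply: le_trans (Iq k) _; lra.
have := ITchi k; have : Lint T = Lint (fun x => T x * chiU k x) + Lint (fun x => T x * (1 - chiU k x)).
  by rewrite -LintD//; congr Lint; apply/funext => x; ring.
move: h1 h2; rewrite ltr_norml ler_norml => /andP[_ g1] /andP[_ g2]; lra.
Qed.

End neumann_patch.

Lemma C1_compact_bounded {R : realType} {n : nat} (U K : set 'rV[R]_n) f : C1_on U f -> compact K ->
  K `<=` U -> exists2 B, 0 < B & forall x, K x -> `|f x| <= B /\ `|grad f x| <= B.
Proof.
move=> cf cK KU.
have bnd (V : normedModType R) (g : 'rV[R]_n -> V) : (forall x, K x -> {for x, continuous g}) ->
    exists2 B, 0 < B & forall x, K x -> `|g x| <= B.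
  move=> cg; have /compact_bounded[L [Lr hL]] : compact (g @` K).
    apply: continuous_compact; last exact: cK.
    by apply: continuous_in_subspaceT => x /set_mem; exact: cg.
  exists (`|L| + 1); first by rewrite ltr_wpDl.
  move=> x xK; apply: (hL (`|L| + 1)); last by exists x.
  by apply: le_lt_trans (ler_norm _) _; rewrite ltrDl.
have [B B0 hB] := bnd _ f (fun x Kx => C1_continuous cf (KU x Kx)).
have [B' B'0 hB'] := bnd _ (grad f) (fun x Kx => C1_grad_continuous cf (KU x Kx)).
exists (Num.max B B'); first by rewrite lt_max B0.
by move=> x Kx; rewrite !le_max hB// hB'// orbT.
Qed.

Lemma C1_on_flat1 {R : realType} {n : nat} (P : set 'rV[R]_n) f : open P -> C1_on P f ->
  C1_on P (fun x => flat1 (f x)).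
Proof.
move=> oP cf; apply: (C1_on_comp oP cf (fun x _ => is_derive_flat1 (f x))) => x _.
exact: continuous_dflat1.
Qed.

Lemma grad_flat1 {R : realType} {n : nat} (f : 'rV[R]_n -> R) x : differentiable f x ->
  grad (fun y => flat1 (f y)) x = dflat1 (f x) *: grad f x.
Proof. by move=> df; exact: grad_comp df (is_derive_flat1 (f x)). Qed.

Lemma nbhs_box {R : realType} {n : nat} (a b y : 'rV[R]_n) : box a b y -> nbhs y (box a b).
Proof.
move=> yab; have b0 : 0 < bump 1 a b y by exact: bump_gt0.
have /(_ y)/continuous_atP/(_ _ b0)[d d0 hd] : continuous (bump 1 a b : 'rV[R]_n -> R).
  by move=> x; exact: (C1_continuous (@bump1_C1 _ _ a b setT)).
apply/nbhs_ballP; exists d => // x; rewrite -ball_normE /ball_/= distrC => /hd h.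
by apply: contrapT => nx; move: h; rewrite (@bump_out _ _ 1 a b x)// sub0r normrN gtr0_norm// ltxx.
Qed.

(** * Gluing the local estimates *)

Section partition_of_unity.
Context {R : realType} {n : nat}.
Variables (D : set 'rV[R]_n) (A : 'rV[R]_n -> 'rV[R]_n).
Hypotheses (oD : open D) (bD : exists M, forall x, D x -> `|x| <= M).
Hypothesis cA : forall x, D x -> {for x, continuous A}.
Hypothesis weak : forall w, C1c D w -> (forall x, 0 <= w x) ->
  Lint ((fun x => dot (grad w x) (A x)) \_ D) <= 0.

Lemma compact_closure_bounded : compact (closure D).
Proof.
have [M hM] := bD; apply: (@bounded_subset_compact _ _ _ M); first exact: closed_closure.
move=> x cx; rewrite leNgt; apply/negP => Mx.
have xM : 0 < `|x| - M by rewrite subr_gt0.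
have /cx[y [/hM Dy]] := nbhsx_ballx x _ xM; rewrite -ball_normE /ball_/= => h.
have := ler_normD (x - y) y; rewrite subrK; lra.
Qed.

Lemma tameM f g : tame D f -> tame D g -> tame D (fun x => f x * g x).
Proof.
move=> [cf f0 [M M0 hM]] [cg g0 [L L0 hL]]; split; first exact: C1_onM.
  by move=> x Dx; rewrite mulr_ge0// ?f0 ?g0.
exists (M * L + L * M); first by rewrite addr_gt0// mulr_gt0.
move=> x Dx; have [f1 f2] := hM x Dx; have [g1 g2] := hL x Dx.
have ML : 0 <= L * M by rewrite mulr_ge0// ltW.
split; first by rewrite normrM ler_wpDr// ler_pM.
rewrite gradM; [|exact: C1_differentiable cf Dx|exact: C1_differentiable cg Dx].
apply: le_trans (ler_normD _ _) _; rewrite !normrZ; apply: lerD; exact: ler_pM.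
Qed.

Lemma flux_eq f g : (forall x, D x -> f x = g x) -> flux D A f = flux D A g.
Proof.
move=> fg; apply/funext => x; rewrite /flux.
have [Dx|nDx] := pselect (D x); last by rewrite !res_out.
rewrite !res_in//; congr dot; apply: grad_eq.
by apply: filterS (open_near oD Dx) => y /fg.
Qed.

Lemma fluxD f g : C1_on D f -> C1_on D g ->
  flux D A (fun x => f x + g x) = fun x => flux D A f x + flux D A g x.
Proof.
move=> cf cg; apply/funext => x; rewrite /flux.
have [Dx|nDx] := pselect (D x); last by rewrite !res_out// addr0.
by rewrite !res_in// gradD ?dotDl//; [exact: C1_differentiable cf Dx|exact: C1_differentiable cg Dx].
Qed.

Lemma flux0 f : (forall x, D x -> f x = 0) -> flux D A f = cst 0.
Proof.
move=> f0; apply/funext => x.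
exact: (flux_vanishing A oD openT (fun x _ => f0 x)).
Qed.

(** Finitely many good boxes cover the compact closure of [D]. With [S] the sum of their bumps,
    positive on that closure, [v] is the sum of the products of the bumps with [v / S], and each of
    them has nonpositive flux. *)
Lemma flux_tame_le0 v : tame D v ->
  (forall y, closure D y -> [\/ exists2 P, nbhs y P & forall x, P x -> D x -> v x = 0, D y |
     neumann_chart D A y /\ exists2 W, nbhs y W & exists2 M, 0 < M & forall x, D x -> W x -> `|A x| <= M]) ->
  BM (flux D A v) /\ Lint (flux D A v) <= 0.
Proof.
move=> tv hv; have [cv v0 _] := tv.
(* Requiring [phi] to vanish with [v] makes a box on which [v] is 0 good for trivial reasons; this
   settles points without a chart. *)
pose good (p : 'rV[R]_n * 'rV[R]_n) := forall phi, tame D phi ->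
  (forall x, D x -> v x = 0 -> phi x = 0) ->
  BM (flux D A (fun x => bump 1 p.1 p.2 x * phi x)) /\
  Lint (flux D A (fun x => bump 1 p.1 p.2 x * phi x)) <= 0.
have loc y : closure D y -> exists p, box p.1 p.2 y /\ good p.
  move=> /hv[[P yP Pv]|Dy|[Ny Wy]].
  - have [a [b [yab abP _]]] := nbhs_cbox yP; exists (a, b); split=> // phi tphi phi0 /=.
    rewrite flux0; first by split; [exact: BM0|rewrite Lint0].
    move=> x Dx; have [xab|nx] := pselect (cbox a b x); last by rewrite bump1_out ?mul0r.
    by rewrite phi0 ?mulr0// Pv//; exact: abP.
  - have [a [b [yab abP _]]] := nbhs_cbox (open_near oD Dy).
    by exists (a, b); split=> // phi [cphi phi0 _] _; exact: flux_bump_interior.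
  - have [a [b [yab h]]] := flux_bump_neumann oD cA weak Ny Wy.
    by exists (a, b); split=> // phi tphi _; exact: h.
have [l gl cl] : exists2 l : seq ('rV[R]_n * 'rV[R]_n), forall p, p \in l -> good p &
    forall x, closure D x -> exists2 p, p \in l & box p.1 p.2 x.
  apply: (@compact_induction _ (closure D) (fun S => exists2 l : seq ('rV[R]_n * 'rV[R]_n),
    forall p, p \in l -> good p & forall x, S x -> exists2 p, p \in l & box p.1 p.2 x)).
  - exact: compact_closure_bounded.
  - by exists [::].
  - by move=> S S' SS' [l gl h]; exists l => // x /SS'/h.
  - move=> S S' [l gl h] [l' gl' h']; exists (l ++ l') => [p|x].
      by rewrite mem_cat => /orP[/gl|/gl'].
    by move=> [/h|/h'] [p pl px]; exists p; rewrite // mem_cat pl ?orbT.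
  - move=> y /loc[p [yp gp]]; exists (box p.1 p.2).
      exact: nbhs_box.
    exists [:: p] => [p'|x [_ xp]]; first by rewrite inE => /eqP ->.
    by exists p; rewrite ?inE.
pose S x := \sum_(p <- l) (bump 1 p.1 p.2 x : R).
have cS P : open P -> C1_on P S.
  by move=> oP; apply: C1_on_sum => // p; exact: bump1_C1.
have S0 x : closure D x -> 0 < S x.
  move=> /cl[p pl xp]; rewrite /S (big_rem p)//= ltr_pwDl ?bump_gt0//.
  by apply: sumr_ge0 => q _; exact: bump_ge0.
pose U := [set x | S x != 0].
have oU : open U.
  apply: (@open_comp _ _ S [set t | t != 0]) => [x _|].
    exact: (C1_continuous (cS _ openT)).
  exact: open_neq.
have DU : closure D `<=` U by move=> x /S0 Sx; rewrite /U/= gt_eqF.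
have cSV : C1_on U (fun x => (S x)^-1) by apply: (C1_onV oU (cS U oU)) => x.
have sD := @subset_closure _ D.
have tSV : tame D (fun x => (S x)^-1).
  split; first by apply: C1_on_sub cSV => x /sD/DU.
    by move=> x Dx; rewrite invr_ge0 ltW// S0//; exact: sD.
  have [B B0 hB] := C1_compact_bounded cSV compact_closure_bounded DU.
  by exists B => // x Dx; apply: hB; exact: sD.
pose phi x := v x * (S x)^-1.
have tphi : tame D phi by exact: tameM.
have [cphi _ _] := tphi.
have phiv x : D x -> v x = 0 -> phi x = 0 by move=> _ vx; rewrite /phi vx mul0r.
have -> : flux D A v = flux D A (fun x => \sum_(p <- l) bump 1 p.1 p.2 x * phi x).
  apply: flux_eq => x Dx; rewrite -mulr_suml -/(S x) /phi mulrCA divff ?mulr1//.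
  by rewrite gt_eqF// S0//; exact: sD.
(* The quotient by the full sum must stay fixed while the induction shortens the list. *)
clearbody phi; clear cl S cS S0 U oU DU cSV tSV.
elim: l gl => [|p l ih] gl.
  rewrite flux0; first by split; [exact: BM0|rewrite Lint0].
  by move=> x _; rewrite big_nil.
have gl' q : q \in l -> good q by move=> ql; apply: gl; rewrite inE ql orbT.
have [b1 i1] := ih gl'.
have [b2 i2] := gl p (mem_head _ _) phi tphi phiv.
rewrite (_ : (fun x => \sum_(p <- _) _) = fun x => bump 1 p.1 p.2 x * phi x +
    \sum_(p <- l) bump 1 p.1 p.2 x * phi x); last by apply/funext => x; rewrite big_cons.
have c1 (q : 'rV[R]_n * 'rV[R]_n) : C1_on D (fun x => bump 1 q.1 q.2 x * phi x).
  exact: (C1_onM oD (@bump1_C1 _ _ _ _ D) cphi).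
have c2 := C1_on_sum l oD c1.
have e := fluxD (c1 p) c2; have i3 := LintD b2 b1; have b3 := BMD b2 b1.
by rewrite e; split=> //; rewrite i3; have := lerD i2 i1; rewrite addr0.
Qed.


End partition_of_unity.

(** * The weak comparison principle *)

Section comparison.
Context {R : realType} {n : nat}.
Variables (D : set 'rV[R]_n) (A : 'rV[R]_n -> 'rV[R]_n).
Hypotheses (oD : open D) (bD : exists M, forall x, D x -> `|x| <= M).
Hypothesis cA : forall x, D x -> {for x, continuous A}.
Hypothesis weak : forall w, C1c D w -> (forall x, 0 <= w x) ->
  Lint ((fun x => dot (grad w x) (A x)) \_ D) <= 0.
Variable z : 'rV[R]_n -> R.
Hypotheses (n2 : (2 <= n)%N) (cz : C1_on D z).
Hypothesis bdd : forall y, closure D y -> y != 0 -> exists2 W, nbhs y W &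
  exists2 M, 0 < M & forall x, D x -> W x -> `|A x| <= M /\ `|grad z x| <= M.
Hypothesis bdry : forall y, closure D y -> ~ D y -> y != 0 ->
  (forall e, 0 < e -> \forall x \near y, D x -> z x < e) \/ neumann_chart D A y.
Hypothesis A2 : (lebesgue_rV n : {measure set 'rV[R]_n -> \bar R}).-integrable setT
  (EFin \o ((fun x => `|A x| ^+ 2) \_ D)).
Hypothesis mono : forall x, D x -> 0 <= dot (grad z x) (A x).

(** Vanishes where [dot x x <= r^2] and equals 1 where [dot x x >= 2 r^2]. *)
Let cutoff r (x : 'rV[R]_n) := step (r ^- 2 * dot x x - 1).

Lemma cutoff_C1 r P : open P -> C1_on P (cutoff r).
Proof.
move=> oP; apply: C1_on_step => //.
exact: (C1_onB oP (C1_onZ _ oP (@dot_self_C1 _ _ P)) (@C1_on_cst _ _ P 1)).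
Qed.

Lemma grad_cutoff r x : grad (cutoff r) x = (dstep (r ^- 2 * dot x x - 1) * (r ^- 2 * 2)) *: x.
Proof.
have [d g] := dot_self_grad x.
have d1 : differentiable (fun y : 'rV[R]_n => r ^- 2 * dot y y) x.
  by apply: differentiableM => //; exact: differentiable_cst.
have d2 : differentiable (fun y : 'rV[R]_n => 1 : R) x by exact: differentiable_cst.
rewrite (grad_step (f := fun y => r ^- 2 * dot y y - 1)); last exact: differentiableB d1 d2.
rewrite (gradB d1 d2) (gradZ _ d) g [grad (fun=> 1) x]grad_cst subr0.
by rewrite !scalerA mulrA.
Qed.

(** The local bounds cover every point of the closure of [D] except the origin, so compactness
    applies once a ball is removed. *)
Lemma bounded_away r : 0 < r -> exists2 M, 0 < M &
  forall x, D x -> r ^+ 2 <= dot x x -> `|A x| <= M /\ `|grad z x| <= M.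
Proof.
move=> r0; pose K := [set x | closure D x /\ 0 <= dot x x - r ^+ 2].
have cK : compact K.
  apply: compact_sublevel => [|x _]; first exact: (compact_closure_bounded bD).
  have c1 : {for x, continuous (fun y : 'rV[R]_n => dot y y)}.
    exact: (C1_continuous (@dot_self_C1 _ _ setT)).
  by apply: continuousB => //; exact: cst_continuous.
suff [M M0 hM] : exists2 M, 0 < M & forall x, K x -> D x -> `|A x| <= M /\ `|grad z x| <= M.
  exists M => // x Dx h; apply: hM => //; split; first exact: subset_closure.
  by rewrite subr_ge0.
apply: (@compact_induction _ K (fun S => exists2 M, 0 < M &
  forall x, S x -> D x -> `|A x| <= M /\ `|grad z x| <= M) cK).
- by exists 1.
- by move=> S S' SS' [M M0 h]; exists M => // x /SS'; exact: h.
- move=> S S' [M M0 h] [M' M'0 h']; exists (Num.max M M'); first by rewrite lt_max M0.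
  by move=> x [Sx|Sx] Dx; [have [h1 h2] := h x Sx Dx|have [h1 h2] := h' x Sx Dx];
    rewrite !le_max ?h1 ?h2 ?orbT.
- move=> y [cy dy]; have y0 : y != 0.
    apply/eqP => y0; move: dy; rewrite y0 dot0l sub0r oppr_ge0 leNgt.
    by rewrite exprn_gt0.
  by have [W yW [M M0 h]] := bdd cy y0; exists W => //; exists M => // x [_ Wx] Dx; exact: h.
Qed.

(** Subtracting [e] makes the function vanish near boundary points where [z] becomes nonpositive;
    the second factor removes the origin. *)
Let test e r x := flat1 (z x - e) * cutoff r x.

Lemma C1_on_levels e : C1_on D (fun x => z x - e).
Proof. exact: (C1_onB oD cz (@C1_on_cst _ _ D e)). Qed.

Lemma grad_level e x : D x -> grad (fun x => flat1 (z x - e)) x = dflat1 (z x - e) *: grad z x.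
Proof.
move=> Dx; rewrite (grad_flat1 (C1_differentiable (C1_on_levels e) Dx)).
rewrite gradB ?[grad (fun=> e) x]grad_cst ?subr0//; exact: C1_differentiable cz Dx.
Qed.

Lemma grad_test e r x : D x -> grad (test e r) x =
  (cutoff r x * dflat1 (z x - e)) *: grad z x +
  (flat1 (z x - e) * (dstep (r ^- 2 * dot x x - 1) * (r ^- 2 * 2))) *: x.
Proof.
move=> Dx; rewrite /test gradM; last 2 first.
- exact: (C1_differentiable (C1_on_flat1 oD (C1_on_levels e)) Dx).
- exact: (C1_differentiable (cutoff_C1 r oD) Dx).
by rewrite grad_level// grad_cutoff !scalerA addrC.
Qed.

Lemma flux_test_le0 e r : 0 < e -> 0 < r ->
  BM (flux D A (test e r)) /\ Lint (flux D A (test e r)) <= 0.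
Proof.
move=> e0 r0; have r20 : 0 < r ^+ 2 by rewrite exprn_gt0.
have cutoff0 x : dot x x <= r ^+ 2 -> cutoff r x = 0.
  by move=> h; rewrite /cutoff step_le0// subr_le0 ler_pdivrMl// mulr1.
apply: (flux_tame_le0 oD bD cA weak); first split.
- exact: (C1_onM oD (C1_on_flat1 oD (C1_on_levels e)) (cutoff_C1 r oD)).
- by move=> x _; rewrite mulr_ge0 ?flat1_ge0 ?step_ge0.
- have [M M0 hM] := bounded_away r0.
  have [C C0 hC] := flat_bounded (dflat 1 : {poly R}).
  have [B B0 hB] := C1_compact_bounded (cutoff_C1 r openT) (compact_closure_bounded bD) (@subsetT _ _).
  exists (1 + (B + C * M)); first by rewrite !addr_gt0// mulr_gt0.
  move=> x Dx; have E1 : `|flat1 (z x - e)| <= 1 by rewrite ger0_norm ?flat1_ge0// flat1_le1.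
  have s1 : `|cutoff r x| <= 1 by rewrite ger0_norm ?step_ge0// step_le1.
  have CM : 0 <= C * M by rewrite mulr_ge0// ltW.
  split; first by rewrite normrM; apply: (@le_trans _ _ 1); [rewrite mulr_ile1|lra].
  rewrite /test gradM; last 2 first.
  - exact: (C1_differentiable (C1_on_flat1 oD (C1_on_levels e)) Dx).
  - exact: (C1_differentiable (cutoff_C1 r oD) Dx).
  apply: le_trans (ler_normD _ _) _; apply: ler_wpDl => //; apply: lerD; rewrite normrZ.
    have [_ h] := hB x (subset_closure Dx).
    by apply: le_trans h; rewrite ler_piMl.
  have [h|h] := lerP (dot x x) (r ^+ 2); first by rewrite cutoff0// normr0 mul0r.
  apply: (@le_trans _ _ `|grad (fun x0 => flat1 (z x0 - e)) x|); first by rewrite ler_piMl.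
  rewrite grad_level// normrZ; apply: ler_pM => //; first exact: hC.
  by have [] := hM x Dx (ltW h).
move=> y cy; have [->|y0] := eqVneq y 0.
  apply: Or31; exists [set x | dot x x < r ^+ 2].
    have c1 : {for (0 : 'rV[R]_n), continuous (fun y : 'rV[R]_n => dot y y)}.
      exact: (C1_continuous (@dot_self_C1 _ _ setT)).
    have /cvgrPdist_lt/(_ _ r20) := c1.
    by apply: filterS => x; rewrite dot0l sub0r normrN => /(le_lt_trans (ler_norm _)).
  by move=> x /= /ltW h _; rewrite /test cutoff0// mulr0.
have [Dy|nDy] := pselect (D y); first exact: Or32.
have [hz|hn] := bdry cy nDy y0.
  apply: Or31; exists [set x | D x -> z x < e]; first exact: hz.
  by move=> x h Dx; rewrite /test flat1_le0 ?mul0r// subr_le0 ltW// h.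
apply: Or33; split=> //; have [W yW [M M0 h]] := bdd cy y0.
by exists W => //; exists M => // x Dx /h - /(_ Dx)[].
Qed.

Let annulus r := D `&` [set x | r ^+ 2 < dot x x < 2 * r ^+ 2].

Let A2r r := (fun x => `|A x| ^+ 2) \_ (annulus r).

Lemma annulus_open r : open (annulus r).
Proof.
apply: openI => //.
apply: (@open_comp _ _ (fun x : 'rV[R]_n => dot x x) [set t | r ^+ 2 < t < 2 * r ^+ 2]).
  by move=> x _; exact: (C1_continuous (@dot_self_C1 _ _ setT)).
rewrite (_ : [set t | _] = [set t | r ^+ 2 < t] `&` [set t | t < 2 * r ^+ 2]).
  by apply: openI; [exact: open_gt|exact: open_lt].
by apply/seteqP; split=> t /=; [move=> /andP[]|move=> [-> ->]].
Qed.

Lemma A2r_ge0 r x : 0 <= A2r r x.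
Proof.
rewrite /A2r; have [h|h] := pselect (annulus r x); last by rewrite res_out.
by rewrite res_in// exprn_ge0.
Qed.

Lemma BM_A2r r : 0 < r -> BM (A2r r).
Proof.
move=> r0; split.
  apply: measurable_restrict_open; first exact: annulus_open.
  move=> x [Dx _]; have cn : {for x, continuous (fun y => `|A y|)}.
    by apply: (@continuous_comp _ _ _ A (fun y : 'rV[R]_n => `|y|)); [exact: cA|exact: norm_continuous].
  exact: (continuousM cn cn).
have [M M0 hM] := bounded_away r0; have [L hL] := bD.
exists (Num.max (M ^+ 2) (L + 1)); split=> x; last first.
  rewrite ge_max => /andP[_ h]; rewrite /A2r res_out// => -[/hL Dx _]; lra.
rewrite le_max; apply/orP; left; rewrite ger0_norm ?A2r_ge0// /A2r.
have [h|h] := pselect (annulus r x); last by rewrite res_out// exprn_ge0// ltW.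
rewrite res_in//; have [Dx /andP[/ltW dx _]] := h; have [h1 _] := hM x Dx dx.
by rewrite lerXn2r// ?nnegrE// ltW.
Qed.

(** Each point eventually lies outside the shrinking annuli, and the integrable function [|A|^2]
    dominates. *)
Lemma A2r_cvg : Lint (A2r k.+1%:R^-1) @[k --> \oo] --> 0.
Proof.
apply: (Lint_dominated _ A2).
- by move=> k; apply: BM_A2r; rewrite invr_gt0.
- move=> k x; rewrite ger0_norm ?A2r_ge0// /A2r.
  have [h|h] := pselect (annulus k.+1%:R^-1 x); first by rewrite !res_in//; case: h.
  rewrite res_out//; have [Dx|nDx] := pselect (D x); last by rewrite res_out.
  by rewrite res_in// exprn_ge0.
- move=> x; apply: cvg_near_cst; exists (Num.bound (2 / dot x x)) => // k /= hk.
  have k0 : 0 < k.+1%:R :> R by rewrite ltr0n.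
  rewrite /A2r res_out// => -[_ /andP[h1 h2]].
  have d0 : 0 < dot x x by apply: lt_trans h1; rewrite exprn_gt0// invr_gt0.
  have h3 : 2 / dot x x < k.+1%:R.
    apply: lt_le_trans (archi_boundP _) _; first by rewrite divr_ge0// ltW.
    by rewrite ler_nat; exact: leqW.
  rewrite ltr_pdivrMr// in h3.
  have k1 : k.+1%:R^-1 ^+ 2 <= k.+1%:R^-1 :> R.
    by rewrite expr2 ler_piMl ?invr_ge0// invf_le1// ler1n.
  move: h2; apply/negP; rewrite -leNgt.
  apply: (@le_trans _ _ (2 * k.+1%:R^-1)); first by rewrite ler_pM2l.
  by rewrite ler_pdivrMr// mulrC ltW.
Qed.

(** The part of the flux of [test e r] in which the derivative falls on [z]; monotonicity makes it
    nonnegative. In [remainder] it falls on the cutoff. *)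
Let energy e r := (fun x => cutoff r x * dflat1 (z x - e) * dot (grad z x) (A x)) \_ D.

Let remainder e r := (fun x => flat1 (z x - e) * (dstep (r ^- 2 * dot x x - 1) * (r ^- 2 * 2)) *
  dot x (A x)) \_ D.

Lemma energyE e r x : energy e r x = flux D A (test e r) x - remainder e r x.
Proof.
rewrite /energy /remainder /flux; have [Dx|nDx] := pselect (D x); last by rewrite !res_out// subrr.
by rewrite !res_in// grad_test// dotDl !dotZl addrK.
Qed.

Lemma measurable_remainder e r : measurable_fun setT (remainder e r).
Proof.
apply: measurable_restrict_open => // x Dx.
have c1 : {for x, continuous (fun y => flat1 (z y - e))}.
  exact: (C1_continuous (C1_on_flat1 oD (C1_on_levels e)) Dx).
have c2 : {for x, continuous (fun y : 'rV[R]_n => dot y y)}.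
  exact: (C1_continuous (@dot_self_C1 _ _ setT)).
have c3 : {for x, continuous (fun y => r ^- 2 * dot y y - 1)}.
  exact: (C1_continuous (C1_onB openT (C1_onZ (r ^- 2) openT (@dot_self_C1 _ _ setT))
    (@C1_on_cst _ _ setT 1))).
have c4 : {for x, continuous (fun y => dstep (r ^- 2 * dot y y - 1))}.
  by apply: (@continuous_comp _ _ _ (fun y => r ^- 2 * dot y y - 1) dstep) => //; exact: continuous_dstep.
have c5 : {for x, continuous (fun y => dot y (A y))}.
  by apply: continuous_dot2; [exact: cvg_id|exact: cA].
have c6 : {for x, continuous (fun=> r ^- 2 * 2 : R)} by exact: cst_continuous.
exact: (continuousM (continuousM c1 (continuousM c4 c6)) c5).
Qed.

(* Young's inequality: the cutoff costs lam |A|^2 on an annulus, which tends to 0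
   with r, plus r^-2 / lam times the volume of a ball of radius 2 r. *)
Lemma energy_le : exists2 C, 0 < C & forall e r lam, 0 < e -> 0 < r -> r <= 1 -> 0 < lam ->
  BM (energy e r) /\ Lint (energy e r) <= lam * Lint (A2r r) + C / lam.
Proof.
have [B B0 hB] := @dstep_bounded R.
have n0 : 0 < n%:R :> R by rewrite ltr0n; exact: leq_trans n2.
exists ((4 * B * n%:R) ^+ 2 * 4 ^+ n); first by rewrite mulr_gt0// ?exprn_gt0// !mulr_gt0.
move=> e r lam e0 r0 r1 lam0; have [bf If] := flux_test_le0 e0 r0.
(* Bounds the remainder by [a * |A x|]: the derivative of the cutoff contributes [2 * B / r^2], and
   [dot x (A x)] at most [n * (2 * r) * |A x|] on the annulus. *)
pose a := 4 * B * n%:R / r.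
have a0 : 0 < a by rewrite divr_gt0// !mulr_gt0.
pose Q : set 'rV[R]_n := box (const_mx (- (2 * r))) (const_mx (2 * r)).
have bQ : BM (\1_Q : 'rV[R]_n -> R) by exact: BM_box.
have bmaj : BM (fun x => lam * A2r r x + a ^+ 2 / lam * \1_Q x).
  by apply: BMD; apply: BMZ => //; exact: BM_A2r.
have rem_le x : `|remainder e r x| <= lam * A2r r x + a ^+ 2 / lam * \1_Q x.
  have maj0 : 0 <= lam * A2r r x + a ^+ 2 / lam * \1_Q x.
    rewrite addr_ge0// mulr_ge0 ?A2r_ge0// ?(ltW lam0)//.
    by rewrite divr_ge0 ?exprn_ge0// ltW.
  rewrite /remainder; have [Dx|nDx] := pselect (D x); last by rewrite res_out// normr0.
  rewrite res_in//; have [h|h] := boolP (0 < r ^- 2 * dot x x - 1 < 1); last first.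
    by rewrite dstep_out// !(mul0r, mulr0) normr0.
  have r20 : 0 < r ^+ 2 by rewrite exprn_gt0.
  have hx : r ^+ 2 < dot x x < 2 * r ^+ 2.
    have E2 : dot x x = r ^+ 2 * (r ^- 2 * dot x x) by rewrite mulrA divff ?mul1r// gt_eqF.
    by case/andP : h => g1 g2; rewrite E2; apply/andP; split; nra.
  have x2r : `|x| < 2 * r.
    have := dot_self_ge x; case/andP : hx => _ g1 g2.
    rewrite -(@ltr_pXn2r _ 2)// ?nnegrE ?mulr_ge0// ?(ltW r0)//.
    by rewrite exprMn; lra.
  have Qx : Q x by apply/cubeP => //; rewrite mulr_gt0.
  rewrite indicE mem_set// mulr1 /A2r res_in//.
  apply: (@le_trans _ _ (a * `|A x|)).
    rewrite normrM normrM (_ : a * `|A x| = 1 * (B * (r ^- 2 * 2)) * (n%:R * (2 * r) * `|A x|)).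
      have h1 : `|flat1 (z x - e)| <= 1 by rewrite ger0_norm ?flat1_ge0// flat1_le1.
      have h2 : `|dstep (r ^- 2 * dot x x - 1) * (r ^- 2 * 2)| <= B * (r ^- 2 * 2).
        rewrite normrM (ger0_norm (dstep_ge0 _)) ger0_norm ?mulr_ge0 ?invr_ge0 ?(ltW r20)//.
        by rewrite ler_wpM2r// mulr_ge0// invr_ge0 ltW.
      apply: ler_pM => //; first exact: ler_pM.
      apply: le_trans (dot_norm_le _ _) _; apply: ler_wpM2r => //.
      by apply: ler_wpM2l => //; exact: ltW.
    by rewrite /a; field; rewrite gt_eqF.
  have := sqr_ge0 (lam * `|A x| - a); rewrite sqrrB => h3.
  have h4 : 0 <= `|A x| by [].
  have h5 : 0 <= lam * `|A x| * a by exact: (mulr_ge0 (mulr_ge0 (ltW lam0) h4) (ltW a0)).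
  have -> : lam * `|A x| ^+ 2 + a ^+ 2 / lam = ((lam * `|A x|) ^+ 2 + a ^+ 2) / lam.
    by field; rewrite gt_eqF.
  rewrite ler_pdivlMr// (_ : a * `|A x| * lam = lam * `|A x| * a); last by ring.
  lra.
have brem : BM (remainder e r) by apply: BM_le bmaj rem_le; exact: measurable_remainder.
have -> : energy e r = fun x => flux D A (test e r) x - remainder e r x.
  by apply/funext => x; exact: energyE.
split; first exact: BMB.
rewrite LintB//.
have h1 : `|Lint (remainder e r)| <= Lint (fun x => lam * A2r r x + a ^+ 2 / lam * \1_Q x).
  exact: Lint_abs_le.
have h2 : Lint (fun x => lam * A2r r x + a ^+ 2 / lam * \1_Q x) =
    lam * Lint (A2r r) + a ^+ 2 / lam * Lint (\1_Q : 'rV[R]_n -> R).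
  rewrite LintD; [|by apply: BMZ; exact: BM_A2r|exact: BMZ].
  by rewrite !LintZ//; exact: BM_A2r.
have h3 : Lint (\1_Q : 'rV[R]_n -> R) = (4 * r) ^+ n.
  rewrite Lint_box; last by move=> i; rewrite !mxE; lra.
  rewrite (eq_bigr (fun=> 4 * r)); last by move=> i _; rewrite !mxE; lra.
  by rewrite prodr_const card_ord.
have h4 : a ^+ 2 / lam * (4 * r) ^+ n <= (4 * B * n%:R) ^+ 2 * 4 ^+ n / lam.
  (* The place where the dimension matters: [r^-2] from the gradient against [r^n] from the volume
     leaves a factor at most 1 as soon as [n >= 2]. *)
  rewrite (_ : _ * _ = (4 * B * n%:R) ^+ 2 * 4 ^+ n / lam * r ^+ (n - 2)).
    rewrite ler_piMr//; last by rewrite exprn_ile1// ltW.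
    by apply: divr_ge0 (ltW lam0); apply: mulr_ge0 (exprn_ge0 _ _); rewrite ?sqr_ge0.
  have -> : (4 * r) ^+ n = 4 ^+ n * (r ^+ (n - 2) * r ^+ 2) by rewrite exprMn -exprD subnK.
  rewrite /a; move: (r ^+ (n - 2)) (4 ^+ n) => c1 c2; field.
  by rewrite !gt_eqF.
move: h1; rewrite ler_norml h2 h3 => /andP[g1 g2]; lra.
Qed.

Hypothesis strict : forall x, D x -> dot (grad z x) (A x) = 0 -> grad z x = 0.

(** If the gradient did not vanish, strict monotonicity would make the energy density positive near
    [x0], so the energy would have a lower bound [kp] independent of [r], whereas [energy_le] makes
    it arbitrarily small. *)
Lemma comparison x0 : D x0 -> x0 != 0 -> 0 < z x0 -> grad z x0 = 0.
Proof.
move=> Dx0 x00 z0; apply: contrapT => gz.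
pose e := z x0 / 2; have e0 : 0 < e by rewrite divr_gt0.
pose g x := dflat1 (z x - e) * dot (grad z x) (A x).
have gx0 : 0 < g x0.
  rewrite mulr_gt0 ?dflat1_gt0//; first by rewrite /e; lra.
  by rewrite lt_neqAle mono// andbT eq_sym; apply/eqP => /(strict Dx0).
have cg : {for x0, continuous g}.
  have c1 : {for x0, continuous (fun x => dflat1 (z x - e))}.
    apply: (@continuous_comp _ _ _ (fun x => z x - e) dflat1); last exact: continuous_dflat1.
    exact: (C1_continuous (C1_on_levels e) Dx0).
  have c2 : {for x0, continuous (fun x => dot (grad z x) (A x))}.
    by apply: continuous_dot2; [exact: C1_grad_continuous cz Dx0|exact: cA].
  exact: (continuousM c1 c2).
have d0 : 0 < dot x0 x0.
  by apply: lt_le_trans (dot_self_ge x0); rewrite exprn_gt0// normr_gt0.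
have cd : {for x0, continuous (fun y : 'rV[R]_n => dot y y)}.
  exact: (C1_continuous (@dot_self_C1 _ _ setT)).
have gx2 : 0 < g x0 / 2 by rewrite divr_gt0.
have dx2 : 0 < dot x0 x0 / 2 by rewrite divr_gt0.
have : nbhs x0 (D `&` [set x | g x0 / 2 < g x /\ dot x0 x0 / 2 < dot x x]).
  apply: filterI; first exact: open_near.
  have /cvgrPdist_lt/(_ _ gx2) h1 := cg; have /cvgrPdist_lt/(_ _ dx2) h2 := cd.
  apply: filterS2 h1 h2 => x; rewrite !ltr_norml => /andP[_ h1] /andP[_ h2].
  split; lra.
move=> /nbhs_ballP[s /= s0 hs].
pose kp := g x0 / 2 * (2 * s) ^+ n.
have kp0 : 0 < kp by rewrite mulr_gt0// exprn_gt0// mulr_gt0.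
have [C C0 hC] := energy_le.
(* Makes [C / lam] equal to [kp / 4]. Only then is the radius taken so small that the annulus term
   is also below [kp / 4]. *)
pose lam := 4 * C / kp; have lam0 : 0 < lam by rewrite divr_gt0// mulr_gt0.
have lam4 : 0 < kp / (4 * lam) by rewrite divr_gt0// mulr_gt0.
have /cvgrPdist_lt/(_ _ lam4)[k1 _ hk1] := A2r_cvg.
(* The second bound gives [2 * r^2 <= dot x0 x0 / 2], so the cutoff equals 1 near [x0]. *)
pose k := maxn k1 (Num.bound (4 / dot x0 x0)).
pose r : R := k.+1%:R^-1.
have r0 : 0 < r by rewrite invr_gt0.
have r1 : r <= 1 by rewrite invf_le1// ler1n.
have hA : Lint (A2r r) < kp / (4 * lam).
  have := hk1 k; rewrite /= leq_maxl sub0r normrN => /(_ isT).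
  by apply: le_lt_trans; exact: ler_norm.
have rd : 2 * r ^+ 2 <= dot x0 x0 / 2.
  have h3 : 4 / dot x0 x0 < k.+1%:R.
    apply: lt_le_trans (archi_boundP _) _; first by rewrite divr_ge0// ltW.
    by rewrite ler_nat; apply: leqW; rewrite leq_maxr.
  rewrite ltr_pdivrMr// in h3.
  have h4 : r ^+ 2 <= r by rewrite expr2 ler_piMl// ltW.
  have h5 : 4 * r < dot x0 x0 by rewrite ltr_pdivrMr// mulrC.
  lra.
have [bE IE] := hC e r lam e0 r0 r1 lam0.
have hlow : kp <= Lint (energy e r).
  apply: (@Lint_gt0 _ _ _ x0) => // x.
    rewrite /energy; have [Dx|nDx] := pselect (D x); last by rewrite res_out.
    by rewrite res_in// mulr_ge0 ?mono// mulr_ge0 ?step_ge0 ?dflat1_ge0.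
  move=> /hs[Dx [gx dx]]; rewrite /energy res_in// /cutoff step_ge1 ?mul1r; first exact: ltW.
  rewrite lerBrDr ler_pdivlMl ?exprn_gt0//; lra.
have e1 : C / lam = kp / 4 by rewrite /lam; field; rewrite !gt_eqF.
have e2 : lam * (kp / (4 * lam)) = kp / 4 by field; rewrite gt_eqF.
have := ltr_pM2l lam0 (Lint (A2r r)) (kp / (4 * lam)); rewrite hA e2 => e3.
lra.
Qed.

End comparison.

(** * Segments, cones and their boundaries *)

Section euclidean_geometry.
Context {R : realType} {n : nat}.
Implicit Types (A O P : set 'rV[R]_n) (x y v : 'rV[R]_n).

Lemma closure_normP A x : closure A x <-> forall e, 0 < e -> exists2 y, A y & `|y - x| < e.
Proof.
split=> [cx e e0|h B /nbhs_ballP[e /= e0 eB]].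
  have [y [Ay]] := cx _ (nbhsx_ballx x e e0); rewrite -ball_normE /ball_/= distrC => h.
  by exists y.
have [y Ay yx] := h e e0; exists y; split=> //; apply: eB.
by rewrite -ball_normE /ball_/= distrC.
Qed.

Lemma open_normP O x : open O -> O x -> exists2 e, 0 < e & forall y, `|y - x| < e -> O y.
Proof.
move=> oO Ox; have /nbhs_ballP[e /= e0 eO] := open_near oO Ox.
by exists e => // y h; apply: eO; rewrite -ball_normE /ball_/= distrC.
Qed.

Lemma near_normP x (P : 'rV[R]_n -> Prop) : (\forall y \near x, P y) <->
  exists2 e, 0 < e & forall y, `|y - x| < e -> P y.
Proof.
split=> [/nbhs_ballP[e /= e0 eO]|[e e0 h]].
  by exists e => // y h; apply: eO; rewrite -ball_normE /ball_/= distrC.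
by apply/nbhs_ballP; exists e => // y; rewrite -ball_normE /ball_/= distrC => /h.
Qed.

Lemma within_continuous_normP A (V : normedModType R) (f : 'rV[R]_n -> V) x :
  {within A, continuous f} -> A x ->
  forall e, 0 < e -> exists2 d, 0 < d & forall y, A y -> `|y - x| < d -> `|f y - f x| < e.
Proof.
move=> /subspace_continuousP/(_ x) cf Ax e e0.
have /cvgrPdist_lt/(_ e e0) := cf Ax; rewrite near_withinE => /near_normP[d d0 h].
by exists d => // y Ay yx; rewrite distrC; exact: h.
Qed.

Lemma boundary_openP A x : open A -> boundary A x <-> closure A x /\ ~ A x.
Proof. by move=> oA; rewrite /boundary (interior_id A).1. Qed.

(** The exit time is the infimum of the parameters outside [O]. Openness of [O] makes it positive
    and puts the exit point itself outside [O]. *)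
Lemma segment_exit O x y : open O -> O x -> ~ O y ->
  exists t, [/\ 0 < t <= 1, boundary O (x + t *: (y - x)) &
    forall s, 0 <= s < t -> O (x + s *: (y - x))].
Proof.
move=> oO Ox nOy; pose S := [set s : R | 0 <= s <= 1 /\ ~ O (x + s *: (y - x))].
have S1 : S 1 by split; [rewrite ler01 lexx|rewrite scale1r addrC subrK].
have hS : has_inf S by split; [exists 1|exists 0 => s [/andP[]]].
pose t := inf S.
have t0 : 0 <= t by apply: lb_le_inf; [exists 1|move=> s [/andP[]]].
have t1 : t <= 1 by apply: ge_inf => //; case: hS.
have below s : 0 <= s < t -> O (x + s *: (y - x)).
  move=> /andP[s0 st]; apply: contrapT => h.
  have : t <= s by apply: ge_inf; [case: hS|split=> //; rewrite s0/= ltW// (lt_le_trans st)].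
  by rewrite leNgt st.
have dist s : `|x + s *: (y - x) - (x + t *: (y - x))| = `|s - t| * `|y - x|.
  by rewrite opprD addrACA subrr add0r -scalerBl normrZ.
have c0 : 0 < `|y - x| + 1 by rewrite ltr_wpDl.
have nOt : ~ O (x + t *: (y - x)).
  move=> /(open_normP oO)[e e0 he].
  have e1 : 0 < e / (`|y - x| + 1) by rewrite divr_gt0.
  have [s [s01 nOs] st] := inf_adherent e1 hS.
  have ts : t <= s by apply: ge_inf; [case: hS|split].
  apply: nOs; apply: he; rewrite dist.
  rewrite ger0_norm ?subr_ge0//; move: st; rewrite -/t -ltrBlDl ltr_pdivlMr// => h.
  apply: le_lt_trans h; rewrite ler_wpM2l// ?subr_ge0// lerDl//.
have t00 : 0 < t.
  by rewrite lt_neqAle t0 andbT; apply/eqP => defE; apply: nOt; rewrite -defE scale0r addr0.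
exists t; split=> //; first by rewrite t00.
apply/boundary_openP => //; split=> //; apply/closure_normP => e e0.
pose d := Num.min (t / 2) (e / (2 * (`|y - x| + 1))).
have d0 : 0 < d by rewrite lt_min !divr_gt0// mulr_gt0.
have dt : d <= t / 2 by rewrite ge_min lexx.
have de : d <= e / (2 * (`|y - x| + 1)) by rewrite ge_min lexx orbT.
exists (x + (t - d) *: (y - x)); first by apply: below; apply/andP; split; lra.
rewrite dist addrAC subrr sub0r normrN gtr0_norm//.
have h1 : d * (2 * (`|y - x| + 1)) <= e by rewrite -ler_pdivlMr// mulr_gt0.
have h2 : 0 <= `|y - x| by [].
nra.
Qed.

Lemma segment_stays O P x y : open O -> O x ->
  (forall t, 0 <= t <= 1 -> P (x + t *: (y - x))) ->
  (forall z, P z -> ~ boundary O z) -> O y.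
Proof.
move=> oO Ox Pxy PO; apply: contrapT => /(segment_exit oO Ox)[t [/andP[t0 t1] bt _]].
by apply: PO bt; apply: Pxy; rewrite ltW.
Qed.

Lemma is_derive_line (f : 'rV[R]_n -> R) x v (t : R) : differentiable f (x + t *: v) ->
  is_derive t (1 : R) (fun s => f (x + s *: v)) (dot (grad f (x + t *: v)) v).
Proof.
move=> df; have defE : (fun h : R => h^-1 *: (f (x + (h *: (1 : R) + t) *: v) - f (x + t *: v))) =
    (fun h : R => h^-1 *: (f (h *: v + (x + t *: v)) - f (x + t *: v))).
  apply/funext => h; congr (_ *: (f _ - _)).
  by rewrite scalerDl [h *: 1]mulr1 addrCA.
have h : derivable f (x + t *: v) v by exact: diff_derivable.
apply: DeriveDef; first by move: h; rewrite /derivable/= -defE.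
by rewrite -derive_grad// /derive/= defE.
Qed.

End euclidean_geometry.

Section cones.
Context {R : realType} {n : nat}.
Implicit Types (om : set 'rV[R]_n).

Lemma cone_scale om t x : 0 < t -> cone om x -> cone om (t *: x).
Proof.
move=> t0 [->|[s [y [s0 oy ->]]]]; first by left.
by right; exists (t * s), y; rewrite mulr_gt0// scalerA.
Qed.

Lemma cone_unit_sphere : cone (unit_sphere : set 'rV[R]_n) = setT.
Proof. by apply/seteqP; split=> // x _; left. Qed.

Lemma sqrt_dot_continuous (x : 'rV[R]_n) : {for x, continuous (fun y : 'rV[R]_n => Num.sqrt (dot y y))}.
Proof.
apply: (@continuous_comp _ _ _ (fun y : 'rV[R]_n => dot y y) Num.sqrt).
  exact: (C1_continuous (@dot_self_C1 _ _ setT)).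
exact: sqrt_continuous.
Qed.

Lemma dot_self_gt0 (x : 'rV[R]_n) : x != 0 -> 0 < dot x x.
Proof. by move=> x0; apply: lt_le_trans (dot_self_ge x); rewrite exprn_gt0// normr_gt0. Qed.

(** Unless it is the whole space, the cone is the preimage of [U] under radial projection to the
    sphere, which is continuous off the origin. *)
Lemma cone_open om : sphere_domain om -> open (cone om).
Proof.
move=> [[U oU omE] _ _]; have [->|nom] := pselect (om = unit_sphere).
  by rewrite cone_unit_sphere; exact: openT.
pose f (x : 'rV[R]_n) := (Num.sqrt (dot x x))^-1 *: x.
have coneE : cone om = [set x | x != 0 /\ U (f x)].
  apply/seteqP; split=> [x [//|[t [y [t0]]]]|x [x0 Ux]].
    rewrite omE => -[Uy y1] -> /=; split.
      rewrite scaler_eq0 negb_or gt_eqF//=; apply: contra_eqN y1 => /eqP ->.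
      by rewrite dot0l eq_sym oner_eq0.
    rewrite /f dotZl dotZr y1 mulr1 -expr2 sqrtr_sqr gtr0_norm// scalerA mulVf ?scale1r//.
    by rewrite gt_eqF.
  have d0 := dot_self_gt0 x0; right; exists (Num.sqrt (dot x x)), (f x).
  rewrite sqrtr_gt0 d0 omE; split=> //; last first.
    by rewrite scalerA divff ?scale1r// gt_eqF// sqrtr_gt0.
  split=> //; rewrite /unit_sphere/= dotZl dotZr mulrA -expr2 exprVn sqr_sqrtr ?(ltW d0)//.
  by rewrite mulVf// gt_eqF.
rewrite coneE openE => x [x0 Ux]; apply: filterI.
  apply/near_normP; exists `|x|; first by rewrite normr_gt0.
  by move=> y; apply: contraTneq => ->; rewrite sub0r normrN ltxx.
have cf : {for x, continuous f}.
  apply: continuousZ; last exact: cvg_id.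
  apply: continuousV; last exact: sqrt_dot_continuous.
  by rewrite gt_eqF// sqrtr_gt0 dot_self_gt0.
by apply: cf; exact: open_near.
Qed.

Lemma closure_cone_scale om t x : 0 < t -> closure (cone om) x -> closure (cone om) (t *: x).
Proof.
move=> t0 /closure_normP cx; apply/closure_normP => e e0.
have [y cy yx] := cx (e / t) (divr_gt0 e0 t0).
exists (t *: y); first exact: cone_scale.
by rewrite -scalerBr normrZ gtr0_norm// mulrC -ltr_pdivlMr.
Qed.

Lemma boundary_cone_scale om t x : sphere_domain om -> 0 < t -> boundary (cone om) x ->
  boundary (cone om) (t *: x).
Proof.
move=> hom t0; have oc := cone_open hom.
move=> /(boundary_openP _ oc)[cx ncx]; apply/(boundary_openP _ oc); split.
  exact: closure_cone_scale.
move=> ctx; apply: ncx; have ti : 0 < t^-1 by rewrite invr_gt0.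
by have := cone_scale ti ctx; rewrite scalerA mulVf ?scale1r// gt_eqF.
Qed.

(** The boundary of a cone is invariant under dilations, so [psi] vanishes on the ray through [x]
    near [x] and its derivative in the radial direction is 0. *)
Lemma cone_normal om U psi x : sphere_domain om -> defining_function (cone om) U psi ->
  U x -> psi x = 0 -> dot (grad psi x) x = 0.
Proof.
move=> hom [oU cpsi _ bE _] Ux px; have dpsi := C1_differentiable cpsi Ux.
have [bx _] : (boundary (cone om) `&` U) x by rewrite bE.
have [e e0 he] := open_normP oU Ux.
have c0 : 0 < `|x| + 1 by rewrite ltr_wpDl.
pose d := Num.min 1 (e / (`|x| + 1)).
have d0 : 0 < d by rewrite lt_min ltr01 divr_gt0.
have psi0 s : `|s| < d -> psi (x + s *: x) = 0.
  rewrite lt_min => /andP[s1 sd].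
  have defE : x + s *: x = (1 + s) *: x by rewrite scalerDl scale1r.
  have s0 : 0 < 1 + s by move: s1; rewrite ltr_norml => /andP[]; lra.
  have : (boundary (cone om) `&` U) (x + s *: x).
    split; first by rewrite defE; exact: boundary_cone_scale.
    apply: he; rewrite addrAC subrr add0r normrZ.
    rewrite ltr_pdivlMr// in sd; apply: le_lt_trans sd.
    by rewrite ler_wpM2l// lerDl.
  by rewrite bE => -[].
apply/eqP; rewrite eq_le; apply/andP; split.
  apply: dot_derivative_le => //; exists d => // s /andP[s0 sd].
  by rewrite psi0 ?gtr0_norm// px subrr mulr0.
apply: dot_derivative_ge => //; exists d => // s /andP[s0 sd].
by rewrite psi0 ?gtr0_norm// px subrr mulr0.
Qed.

End cones.

Lemma cvg_dot {R : realType} {n : nat} (T : Type) (F : set_system T) (f g : T -> 'rV[R]_n) a b :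
  Filter F -> f @ F --> a -> g @ F --> b -> dot (f x) (g x) @[x --> F] --> dot a b.
Proof.
move=> FF fa gb; rewrite /dot.
have cc i (c : 'rV[R]_n) (h : T -> 'rV[R]_n) : h @ F --> c -> h x ord0 i @[x --> F] --> c ord0 i.
  move=> hc; apply/cvgrPdist_lt => e e0; have /cvgrPdist_lt/(_ e e0) := hc.
  apply: filterS => x; apply: le_lt_trans.
  by have := normr_coord_le (c - h x) i; rewrite !mxE.
elim: (index_enum 'I_n) => [|i s ih].
  by rewrite big_nil; under eq_fun do rewrite big_nil; exact: cvg_cst.
rewrite big_cons; under eq_fun do rewrite big_cons.
by apply: cvgD => //; apply: cvgM; exact: cc.
Qed.

(** * The explicit solution in a Wulff sector *)

Section torsion.
Context {R : realType} {n : nat} {H H0 : 'rV[R]_n -> R}.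
Hypotheses (n0 : (0 < n)%N) (hH : is_norm H) (hHC1 : C1_on [set~ 0] H)
  (hV : strictly_convex (half_sqr H)) (hH0 : is_norm H0)
  (hdual : forall xi, H xi = dual_norm H0 xi).
Local Notation DV := (grad (half_sqr H)).
Local Notation G := (Wulff_dual hH hHC1).

(* The solution of the problem in the Wulff sector of radius [rho]. *)
Definition torsion (rho : R) (x : 'rV[R]_n) : R := n%:R^-1 * (rho ^+ 2 / 2 - half_sqr H0 x).

Lemma torsionE rho x : torsion rho x = (rho ^+ 2 - H0 x ^+ 2) / (2 * n%:R).
Proof. by rewrite /torsion /half_sqr; field; rewrite pnatr_eq0 -lt0n. Qed.

Lemma torsion_C1 rho P : open P -> C1_on P (torsion rho).
Proof.
move=> oP; apply: C1_onZ => //.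
exact: (C1_onB oP (@C1_on_cst _ _ P (rho ^+ 2 / 2)) (half_sqr_dual_C1 n0 hH hHC1 hV hH0 hdual (D := P))).
Qed.

Lemma grad_torsion rho x : grad (torsion rho) x = - n%:R^-1 *: G x.
Proof.
have [d g] := half_sqr_dual_grad n0 hH hHC1 hV hH0 hdual x.
have d1 : differentiable (fun=> rho ^+ 2 / 2 : R) x by exact: differentiable_cst.
rewrite /torsion (gradZ _ (differentiableB d1 d)).
by rewrite (gradB d1 d) g [grad (fun=> _) x]grad_cst sub0r scalerN scaleNr.
Qed.

(** Since [G] inverts [DV], the nonlinear flux of [torsion] is a linear field, whatever [H] is. *)
Lemma DV_grad_torsion rho x : DV (grad (torsion rho) x) = - n%:R^-1 *: x.
Proof. by rewrite grad_torsion DVZ// DV_G. Qed.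

Lemma DV_le : exists2 C, 0 < C & forall xi, `|DV xi| <= C * `|xi|.
Proof.
have [C C0 hC] := norm_le_mx hH; have [c c0 hc] := norm_ge_mx hH0.
exists (C / c) => [|xi]; first exact: divr_gt0.
have := hc (DV xi); rewrite (norm_DV n0 hH hHC1 hV hH0 hdual) mulrC -ler_pdivlMr// => h.
by apply: le_trans h _; rewrite mulrAC ler_pM2r ?invr_gt0.
Qed.

Lemma Wulff_dual_le : exists2 C, 0 < C & forall x, `|G x| <= C * `|x|.
Proof.
have [C C0 hC] := norm_le_mx hH0; have [c c0 hc] := norm_ge_mx hH.
exists (C / c) => [|x]; first exact: divr_gt0.
have := hc (G x); rewrite (norm_G n0 hH hHC1 hV hH0 hdual) mulrC -ler_pdivlMr// => h.
by apply: le_trans h _; rewrite mulrAC ler_pM2r ?invr_gt0.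
Qed.

End torsion.

(** At [rho = r] the difference of the two sides is [P0], which is positive because
    [m * r <= r - a]; [eta] quantifies continuity in [rho]. It serves to bound [torsion r] from
    below at [1 - m] times a point where [H0] equals [rho]. *)
Lemma torsion_margin {R : realType} (r a m : R) : 0 < r -> 0 < a -> 0 < m -> m <= 1 / 2 ->
  m * r <= r - a -> exists2 eta, 0 < eta &
    forall rho, r <= rho < r + eta -> 2 * a * m * rho < r ^+ 2 - (1 - m) ^+ 2 * rho ^+ 2.
Proof.
move=> r0 a0 m0 m1 m2; have mr : 0 < m * r by exact: mulr_gt0.
pose P0 := m * r * ((2 - m) * r - 2 * a).
have P00 : 0 < P0 by rewrite /P0; apply: mulr_gt0 => //; lra.
pose k := 2 * r + 1 + 2 * a; have k0 : 0 < 2 * k by rewrite /k; lra.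
exists (Num.min 1 (P0 / (2 * k))); first by rewrite lt_min ltr01 divr_gt0.
move=> rho /andP[h1]; rewrite -ltrBlDl lt_min => /andP[h2]; rewrite ltr_pdivlMr// => h3.
rewrite -subr_gt0 (_ : _ - _ = P0 - ((1 - m) ^+ 2 * ((rho - r) * (rho + r)) + 2 * a * (m * (rho - r))));
  last by rewrite /P0; ring.
have s2 : (1 - m) ^+ 2 <= 1 by rewrite expr_le1//; lra.
have d0 : 0 <= rho - r by lra.
have g0 : 0 <= (rho - r) * (rho + r) by apply: mulr_ge0; lra.
have g1 : (rho - r) * (rho + r) <= (rho - r) * (2 * r + 1) by apply: ler_wpM2l; lra.
have g2 : (1 - m) ^+ 2 * ((rho - r) * (rho + r)) <= (rho - r) * (rho + r) by rewrite ler_piMl.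
have g3 : m * (rho - r) <= 1 * (rho - r) by apply: ler_wpM2r; lra.
have g4 : 2 * a * (m * (rho - r)) <= 2 * a * (1 * (rho - r)) by apply: ler_wpM2l; lra.
move: h3; rewrite (_ : (rho - r) * (2 * k) = 2 * ((rho - r) * (2 * r + 1) + 2 * a * (1 * (rho - r))));
  last by rewrite /k; ring.
have g5 : 0 <= 2 * a * (1 * (rho - r)) by apply: mulr_ge0; lra.
lra.
Qed.

Section comparison_with_torsion.
Context {R : realType} {n : nat}.

Lemma C1c_flux_id (P : set 'rV[R]_n) w (B : 'rV[R]_n -> 'rV[R]_n) : C1c P w ->
  (fun x => dot (grad w x) (B x)) \_ P = fun x => dot (grad w x) (B x).
Proof.
move=> [_ [K [cK KP w0]]]; apply: (restrict_support KP) => x nKx.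
by rewrite (grad_eq0_out cK w0 nKx) dot0l.
Qed.

(** Integration by parts of each coordinate against [w] yields [- Lint w]; the [n] equal terms
    cancel the factor [n%:R^-1]. *)
Lemma weak_torsion (P : set 'rV[R]_n) w : (0 < n)%N -> C1c P w ->
  BM (fun x => dot (grad w x) (- n%:R^-1 *: x)) /\
  Lint (fun x => dot (grad w x) (- n%:R^-1 *: x)) = Lint w.
Proof.
move=> n0 cw; have cwT := C1c_sub (@subsetT _ P) cw.
have ibp (i : 'I_n) : BM (fun x => x ord0 i * partial i w x) /\
    Lint (fun x => x ord0 i * partial i w x) = - Lint w.
  have [b1 [b2 e]] := integration_by_parts_C1c i openT (@C1_on_coord _ _ setT i) cwT.
  rewrite patch_setT in b1; rewrite !patch_setT in e; split=> //; rewrite e; congr (- Lint _).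
  by apply/funext => x; rewrite -gradE grad_coord mxE !eqxx mul1r.
have E1 : (fun x => dot (grad w x) (- n%:R^-1 *: x)) =
    fun x => - n%:R^-1 * \sum_(i < n) (x ord0 i * partial i w x).
  apply/funext => x; rewrite dotZr; congr (_ * _); apply: eq_bigr => i _.
  by rewrite gradE mulrC.
have bS : BM (fun x => \sum_(i < n) (x ord0 i * partial i w x)).
  by apply: BM_sum => i; case: (ibp i).
rewrite E1; split; first exact: BMZ.
rewrite LintZ// Lint_sum; last by move=> i; case: (ibp i).
rewrite (eq_bigr (fun=> - Lint w)); last by move=> i _; case: (ibp i).
rewrite sumr_const card_ord -mulr_natl; move: (Lint w) => c.
by field; rewrite pnatr_eq0 -lt0n.
Qed.

End comparison_with_torsion.

(** * The overdetermined problem *)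

Section overdetermined.
Context {R : realType} {N : nat}.
Hypothesis hN : (2 <= N)%N.
Variables (Om om Sig Gamma0 Gamma1 : set 'rV[R]_N).
Hypotheses (oOm : open Om) (hbd : exists M, forall x, Om x -> `|x| <= M) (hO : Om 0).
Hypotheses (hom : sphere_domain om) (hSig : Sig = cone om).
Hypothesis hC1 : forall z, boundary Sig z -> z != 0 -> C1_boundary_at Sig z.
Hypothesis hG0 : Gamma0 = Sig `&` boundary Om.
Hypothesis hG1 : Gamma1 = boundary (Sig `&` Om) `\` closure Gamma0.
Variables (H H0 : 'rV[R]_N -> R) (u : 'rV[R]_N -> R) (Du : 'rV[R]_N -> 'rV[R]_N).
Hypotheses (hH : is_norm H) (hHC1 : C1_on [set~ 0] H) (hV : strictly_convex (half_sqr H)).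
Hypotheses (hH0 : is_norm H0) (hdual : forall xi, H xi = dual_norm H0 xi).
Hypothesis huC1 : C1_upto (Sig `&` Om) (Gamma1 `\ 0) u Du.
Hypothesis huC0 : {within closure (Sig `&` Om) `\ 0, continuous u}.
Hypothesis hsol : weak_solution H Om Sig (fun=> 1) u.
Hypothesis hu0 : forall z, Gamma0 z -> u z = 0.
Hypothesis hnu : forall z nu, (Gamma1 `\ 0) z -> outward_normal Sig z nu ->
  dot (grad (half_sqr H) (Du z)) nu = 0.
Variable q : R -> R.
Hypothesis hgrad : forall z, closure Gamma0 z ->
  H (Du x) @[x --> within (Sig `&` Om) (nbhs z)] --> q (H0 z).

Local Notation D := (Sig `&` Om).
Local Notation DV := (grad (half_sqr H)).
Local Notation torsion := (@torsion R N H0).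

Let n0 : (0 < N)%N. Proof. exact: leq_trans hN. Qed.

Let cDV := continuous_DV n0 hH hHC1 hV hH0 hdual.

Lemma open_Sig : open Sig. Proof. by rewrite hSig; exact: cone_open. Qed.

Lemma open_sector : open D. Proof. exact: openI open_Sig oOm. Qed.

Lemma Sig_scale t x : 0 < t -> Sig x -> Sig (t *: x).
Proof. by rewrite hSig; exact: cone_scale. Qed.

Lemma C1_u : C1_on D u. Proof. by case: huC1. Qed.

Lemma Du_grad x : D x -> Du x = grad u x. Proof. by case: huC1 => _ h _ _; exact: h. Qed.

Lemma Gamma0_nOm z : closure Gamma0 z -> ~ Om z.
Proof.
move=> cz Oz; have [y []] := cz _ (open_near oOm Oz).
by rewrite hG0 => -[_ /(boundary_openP _ oOm)[]].
Qed.

Lemma Gamma0_neq0 z : closure Gamma0 z -> z != 0.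
Proof. by move=> /Gamma0_nOm h; apply/eqP => z0; apply: h; rewrite z0. Qed.

Lemma Gamma0_closure : Gamma0 `<=` closure D.
Proof.
rewrite hG0 => z [Sz /(boundary_openP _ oOm)[cz _]] B Bz.
have [y [Oy [By Sy]]] := cz _ (filterI Bz (open_near open_Sig Sz)).
by exists y.
Qed.

Lemma closure_Gamma0_closure : closure Gamma0 `<=` closure D.
Proof.
have /closure_id -> := @closed_closure _ D.
by apply: closureS; exact: Gamma0_closure.
Qed.

(** The Dirichlet condition extends by continuity, since [Om] is a neighbourhood of the origin and
    so keeps the closure of [Gamma0] away from the only point where continuity may fail. *)
Lemma u_closure_Gamma0 z : closure Gamma0 z -> u z = 0.
Proof.
move=> cz; have z0 := Gamma0_neq0 cz.
have zD : (closure D `\ 0) z by split; [exact: closure_Gamma0_closure|exact/eqP].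
apply/eqP; rewrite -normr_eq0; apply/eqP/le_anti; rewrite normr_ge0 andbT.
apply/ler_addgt0Pl => e e0; rewrite addr0.
have [d d0 hd] := within_continuous_normP huC0 zD e0.
have d'0 : 0 < Num.min d `|z| by rewrite lt_min d0 normr_gt0.
have /closure_normP/(_ _ d'0)[y Gy] := cz; rewrite lt_min => /andP[yz yz0].
have yD : (closure D `\ 0) y.
  split; first exact: Gamma0_closure.
  by move=> y0; move: yz0; rewrite y0 sub0r normrN ltxx.
by have := hd y yD yz; rewrite hu0// sub0r normrN => /ltW.
Qed.

Lemma u_near_Gamma0 z : closure Gamma0 z -> forall e, 0 < e ->
  \forall x \near z, D x -> `|u x| < e.
Proof.
move=> cz e e0; have z0 := Gamma0_neq0 cz.
have zD : (closure D `\ 0) z by split; [exact: closure_Gamma0_closure|exact/eqP].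
have [d d0 hd] := within_continuous_normP huC0 zD e0.
apply/near_normP; exists (Num.min d `|z|); first by rewrite lt_min d0 normr_gt0.
move=> y; rewrite lt_min => /andP[yz yz0] Dy.
have yD : (closure D `\ 0) y.
  split; first exact: subset_closure.
  by move=> y0; move: yz0; rewrite y0 sub0r normrN ltxx.
by have := hd y yD yz; rewrite (u_closure_Gamma0 cz) subr0.
Qed.

Lemma boundary_cases z : closure D z -> ~ D z -> closure Gamma0 z \/ Gamma1 z.
Proof.
move=> cz nz; have [|ng] := pselect (closure Gamma0 z); first by left.
by right; rewrite hG1; split=> //; apply/(boundary_openP _ open_sector).
Qed.

Lemma Gamma1_closure z : Gamma1 z -> closure D z /\ ~ D z.
Proof. by rewrite hG1 => -[/(boundary_openP _ open_sector)]. Qed.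

(** A point of the open cone in the boundary of the sector is a boundary point of [Om], hence
    belongs to [Gamma0]. *)
Lemma Gamma1_nSig z : Gamma1 z -> ~ Sig z.
Proof.
move=> gz Sz; have [cz nz] := Gamma1_closure gz.
move: gz; rewrite hG1 => -[_]; apply; apply: subset_closure; rewrite hG0; split=> //.
apply/(boundary_openP _ oOm); split; last by move=> Oz; exact: nz.
by apply: closureS cz => x [].
Qed.

Lemma Gamma1_boundary z : Gamma1 z -> boundary Sig z.
Proof.
move=> gz; apply/(boundary_openP _ open_Sig); split; last exact: Gamma1_nSig.
by have [cz _] := Gamma1_closure gz; apply: closureS cz => x [].
Qed.

Lemma Du_near_Gamma1 z : Gamma1 z -> z != 0 -> forall e, 0 < e ->
  exists2 d, 0 < d & forall x, D x -> `|x - z| < d -> `|grad u x - Du z| < e.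
Proof.
move=> gz z0 e e0; have [_ _ _ cDu] := huC1.
have zD : (D `|` Gamma1 `\ 0) z by right; split=> //; exact/eqP.
have [d d0 hd] := within_continuous_normP cDu zD e0.
by exists d => // x Dx xz; rewrite -Du_grad//; apply: hd => //; left.
Qed.

Lemma DVDu_near_Gamma1 z : Gamma1 z -> z != 0 -> forall e, 0 < e ->
  exists2 d, 0 < d & forall x, D x -> `|x - z| < d -> `|DV (grad u x) - DV (Du z)| < e.
Proof.
move=> gz z0 e e0; have /continuous_atP/(_ e e0)[d1 d10 h1] := @cDV (Du z).
have [d d0 hd] := Du_near_Gamma1 gz z0 d10.
by exists d => // x Dx xz; apply: h1; exact: hd.
Qed.

(** Near the closure of [Gamma0] the bound comes from the overdetermined condition itself, even
    where [Gamma0] meets the lateral boundary; near [Gamma1] it comes from the continuous extension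
    of the gradient. *)
Lemma grad_u_bounded y : closure D y -> y != 0 -> exists2 W, nbhs y W &
  exists2 M, 0 < M & forall x, D x -> W x -> `|grad u x| <= M.
Proof.
move=> cy y0; have [Dy|nDy] := pselect (D y).
  have /continuous_atP/(_ 1 ltr01)[d d0 hd] := C1_grad_continuous C1_u Dy.
  exists [set x | `|x - y| < d]; first by apply/near_normP; exists d.
  exists (`|grad u y| + 1) => [|x _ /hd h]; first by rewrite ltr_wpDl.
  have := ler_normD (grad u x - grad u y) (grad u y); rewrite subrK; lra.
have [gy|gy] := boundary_cases cy nDy.
  have /cvgrPdist_lt/(_ 1 ltr01) := hgrad gy; rewrite near_withinE => h.
  have [c c0 hc] := norm_ge_mx hH.
  have q1 : 0 < `|q (H0 y)| + 1 by rewrite ltr_wpDl.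
  exists [set x | D x -> `|q (H0 y) - H (Du x)| < 1] => //.
  exists ((`|q (H0 y)| + 1) / c) => [|x Dx /(_ Dx)]; first by rewrite divr_gt0.
  rewrite Du_grad// ltr_norml => /andP[h1 h2]; rewrite ler_pdivlMr// mulrC.
  apply: le_trans (hc _) _; have := ler_norm (q (H0 y)); lra.
have [d d0 hd] := Du_near_Gamma1 gy y0 ltr01.
exists [set x | `|x - y| < d]; first by apply/near_normP; exists d.
exists (`|Du y| + 1) => [|x Dx /hd h]; first by rewrite ltr_wpDl.
have := ler_normD (grad u x - Du y) (Du y); rewrite subrK; have := h Dx; lra.
Qed.

(** Shrinking the chart away from [closure Gamma0] and the origin ensures that the boundary points
    of the sector in it belong to [Gamma1]. *)
Lemma Gamma1_chart y : Gamma1 y -> y != 0 -> exists U psi,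
  [/\ defining_function Sig U psi, U y & forall x, U x -> ~ closure Gamma0 x /\ x != 0].
Proof.
move=> gy y0; have [U [psi [[oU cpsi gpsi bE SE] Uy]]] := hC1 (Gamma1_boundary gy) y0.
pose P := ~` closure Gamma0 `&` [set~ 0].
have oP : open P.
  apply: openI; first by apply: closed_openC; exact: closed_closure.
  rewrite openE => x x0; apply/near_normP; exists `|x|; first by rewrite normr_gt0; exact/eqP.
  by move=> z h z0; move: h; rewrite z0 sub0r normrN ltxx.
exists (U `&` P), psi; split.
- split; [exact: openI|by apply: C1_on_sub cpsi => x []|by move=> x []/gpsi| |].
    by rewrite setIA bE setIA.
  by rewrite setIA SE setIA.
- split=> //; split; last exact/eqP.
  by move: gy; rewrite hG1 => -[].
- by move=> x [_ [nx x0]]; split=> //; exact/eqP.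
Qed.

Lemma Neumann_condition U psi x : defining_function Sig U psi -> U x -> Gamma1 x -> x != 0 ->
  dot (DV (Du x)) (grad psi x) = 0.
Proof.
move=> df Ux gx x0; have [_ _ gpsi bE _] := df.
have [px _] : ([set x | psi x = 0] `&` U) x by rewrite -bE; split=> //; exact: Gamma1_boundary.
have := hnu (conj gx (fun e => negP x0 (introT eqP e))) (ex_intro _ U (ex_intro _ psi (And4 df Ux px erefl))).
rewrite dotZr => /eqP; rewrite mulf_eq0 invr_eq0 gt_eqF ?sqrtr_gt0 ?dot_self_gt0 ?gpsi//.
by move=> /eqP.
Qed.

(** * Comparison of u with a multiple of the torsion function *)

Section truncated_sector.
Variables (O : set 'rV[R]_N) (sg b rho : R).
Hypotheses (oO : open O) (OOm : Sig `&` O `<=` Om).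
Hypotheses (sg2 : sg * sg = 1) (sgb : sg * (1 - b) <= 0).
Let Dp := Sig `&` O.
(** The sign [sg] selects upper or lower bounds for [u]; [b = 0] compares with the zero function and
    [b = 1] with [torsion]. The right-hand side of the equation for [z] is then [sg * (1 - b)],
    nonpositive by [sgb]. *)
Let z x := sg * (u x - b * torsion rho x).
Let A x := sg *: (DV (grad u x) - b *: (- N%:R^-1 *: x)).
(** In the second alternative the truncation by [O] is inactive near [y], so [y] must be a point of
    [Gamma1]. *)
Hypothesis bdry : forall y, closure Dp y -> ~ Dp y -> y != 0 ->
  (forall e, 0 < e -> \forall x \near y, Dp x -> z x < e) \/
  (~ closure Gamma0 y /\ exists2 W, open W /\ W y & forall x, W x -> Sig x -> Om x -> O x).

Let ct := torsion_C1 n0 hH hHC1 hV hH0 hdual rho.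

Let DpD : Dp `<=` D. Proof. by move=> x Dx; split; [case: Dx|exact: OOm]. Qed.

Let oDp : open Dp. Proof. exact: openI open_Sig oO. Qed.

Let cz : C1_on Dp z.
Proof.
have c1 := C1_on_sub DpD C1_u.
exact: (C1_onZ sg oDp (C1_onB oDp c1 (C1_onZ b oDp (ct oDp)))).
Qed.

Let grad_z x : D x -> grad z x = sg *: (grad u x - b *: grad (torsion rho) x).
Proof.
move=> Dx; have du := C1_differentiable C1_u Dx.
have dt : differentiable (torsion rho) x by exact: (C1_differentiable (ct openT)).
have dbt : differentiable (fun y => b * torsion rho y) x.
  by apply: differentiableM => //; exact: differentiable_cst.
by rewrite /z (gradZ _ (differentiableB du dbt)) (gradB du dbt) (gradZ _ dt).
Qed.

Let AE x : A x = sg *: (DV (grad u x) - DV (b *: grad (torsion rho) x)).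
Proof. by rewrite DVZ// (DV_grad_torsion n0 hH hHC1 hV hH0 hdual). Qed.

Let cA x : D x -> {for x, continuous A}.
Proof.
move=> Dx; have c1 : {for x, continuous (fun y => DV (grad u y))}.
  apply: (@continuous_comp _ _ _ (grad u) DV); last exact: cDV.
  exact: C1_grad_continuous C1_u Dx.
have c2 : {for x, continuous (fun y : 'rV[R]_N => b *: (- N%:R^-1 *: y))}.
  rewrite (_ : (fun y => _) = fun y => (b * - N%:R^-1) *: y); last first.
    by apply/funext => y; rewrite scalerA.
  by apply: (@continuousZ _ _ _ (cst _) id); [exact: cst_continuous|exact: cvg_id].
by apply: (@continuousZ _ _ _ (cst sg)); [exact: cst_continuous|exact: continuousB c1 c2].
Qed.

Let weakA w : C1c Dp w -> (forall x, 0 <= w x) -> Lint ((fun x => dot (grad w x) (A x)) \_ Dp) <= 0.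
Proof.
move=> cw w0; have cwD := C1c_sub DpD cw.
have sO : open (Om `&` Sig) by rewrite setIC; exact: open_sector.
have [hweak _] := weak_solution_C1 oOm open_Sig cDV (eq_rect _ (fun P => C1_on P u) C1_u _ (setIC _ _)) hsol.
rewrite setIC in hweak.
have [b1 e1] := weak_torsion n0 cw.
have e2 := hweak w cwD; rewrite (C1c_flux_id _ cwD) in e2.
have b2 : BM (fun x => dot (grad w x) (DV (grad u x))).
  suff cF : forall x, D x -> {for x, continuous (fun y => DV (grad u y))}.
    by have := BM_dot_C1c open_sector cF cwD; rewrite (C1c_flux_id _ cwD).
  move=> x Dx; apply: (@continuous_comp _ _ _ (grad u) DV); last exact: cDV.
  exact: C1_grad_continuous C1_u Dx.
rewrite (C1c_flux_id _ cw) (_ : (fun x => _) = fun x => sg * (dot (grad w x) (DV (grad u x)) -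
    b * dot (grad w x) (- N%:R^-1 *: x))); last first.
  by apply/funext => x; rewrite dotZr dotBr [dot _ (b *: _)]dotZr.
have b3 := BMZ b b1; rewrite LintZ; last exact: BMB.
rewrite LintB// LintZ// e1 e2; move: (Lint_ge0 w0) => Iw0.
rewrite (_ : sg * _ = sg * (1 - b) * Lint w); last by ring.
exact: mulr_le0_ge0.
Qed.

Let bddA y : closure Dp y -> y != 0 -> exists2 W, nbhs y W &
  exists2 M, 0 < M & forall x, Dp x -> W x -> `|A x| <= M /\ `|grad z x| <= M.
Proof.
move=> cy y0; have [W yW [M M0 hM]] := grad_u_bounded (closureS DpD cy) y0.
have [L hL] := hbd; have L0 : 0 <= L by apply: le_trans (hL 0 hO).
have [C C0 hC] := DV_le n0 hH hHC1 hV hH0 hdual.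
have [C' C'0 hC'] := Wulff_dual_le n0 hH hHC1 hV hH0 hdual.
have sg1 : `|sg| = 1.
  by apply/eqP; rewrite -(@eqrXn2 _ 2)// expr1n -normrX expr2 sg2 normr1.
pose k := `|b| * (N%:R^-1 * L); pose k' := `|b| * (N%:R^-1 * (C' * L)).
have ni : 0 <= N%:R^-1 :> R by rewrite invr_ge0.
have k0 : 0 <= k by rewrite !mulr_ge0.
have k'0 : 0 <= k' by rewrite !mulr_ge0// ltW.
exists W => //; exists (C * M + k + (M + k')).
  by have : 0 < C * M by [exact: mulr_gt0]; lra.
move=> x Dx Wx; have [_ Ox] := DpD Dx; have h1 := hM x (DpD Dx) Wx; have h2 := hL x Ox.
have CM : 0 < C * M by exact: mulr_gt0.
split.
  rewrite normrZ sg1 mul1r; apply: le_trans (ler_normB _ _) _.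
  have g1 : `|DV (grad u x)| <= C * M by apply: le_trans (hC _) _; rewrite ler_pM2l.
  have g2 : `|b *: (- N%:R^-1 *: x)| <= k.
    rewrite !normrZ normrN (ger0_norm ni); apply: ler_wpM2l => //; exact: ler_wpM2l.
  lra.
rewrite (grad_z (DpD Dx)) normrZ sg1 mul1r; apply: le_trans (ler_normB _ _) _.
have g2 : `|b *: grad (torsion rho) x| <= k'.
  rewrite (grad_torsion n0 hH hHC1 hV hH0 hdual) !normrZ normrN (ger0_norm ni).
  apply: ler_wpM2l => //; apply: ler_wpM2l => //; apply: le_trans (hC' _) _.
  by rewrite ler_pM2l.
lra.
Qed.

(** Both fluxes have zero normal component in the limit: that of [u] by the Neumann condition and
    the continuous extension of its gradient, that of [torsion] because it is radial and the
    boundary is conical. *)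
Let neumannA y : closure Dp y -> ~ Dp y -> y != 0 -> ~ closure Gamma0 y ->
  (exists2 W, open W /\ W y & forall x, W x -> Sig x -> Om x -> O x) -> neumann_chart Dp A y.
Proof.
move=> cy nDy y0 ny [W [oW Wy] hW].
have G1 x : W x -> closure Dp x -> ~ Dp x -> ~ closure Gamma0 x -> Gamma1 x.
  move=> Wx cx nx ngx; have nDx : ~ D x by move=> [Sx Ox]; apply: nx; split=> //; exact: hW.
  by have [] := boundary_cases (closureS DpD cx) nDx.
have gy := G1 y Wy cy nDy ny.
have [U [psi [df Uy hU]]] := Gamma1_chart gy y0.
have [oU cpsi gpsi bE SE] := df.
exists (U `&` W), psi; split.
- by split; [exact: openI|split].
- by apply: C1_on_sub cpsi => x [].
- exact: gpsi.
- split=> [x [Sx _] [Ux _]|x cx nx [Ux Wx]].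
    by have [] : ([set x | psi x < 0] `&` U) x by rewrite -SE.
  have gx := G1 x Wx cx nx (hU x Ux).1.
  have [] // : ([set x | psi x = 0] `&` U) x.
  by rewrite -bE; split=> //; exact: Gamma1_boundary.
- move=> x cx nx [Ux Wx]; have [ngx x0] := hU x Ux.
  have gx := G1 x Wx cx nx ngx.
  pose B t := sg *: (DV (Du x) - b *: (- N%:R^-1 *: t)) : 'rV[R]_N.
  have px0 : psi x = 0.
    have [] // : ([set x | psi x = 0] `&` U) x.
    by rewrite -bE; split=> //; exact: Gamma1_boundary.
  have e0 : dot (B x) (grad psi x) = 0.
    rewrite dotZl dotBl (Neumann_condition df Ux gx x0) dotZl dotZl (dotC x).
    by rewrite (cone_normal hom _ Ux px0) ?mulr0 ?subrr ?mulr0// -hSig.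
  rewrite -e0.
  have cg : {for x, continuous (grad psi)} by exact: C1_grad_continuous cpsi Ux.
  have cB : A t @[t --> within Dp (nbhs x)] --> B x.
    have c2 : {for x, continuous (fun y : 'rV[R]_N => b *: (- N%:R^-1 *: y))}.
      rewrite (_ : (fun y => _) = fun y => (b * - N%:R^-1) *: y); last first.
        by apply/funext => t; rewrite scalerA.
      by apply: (@continuousZ _ _ _ (cst _) id); [exact: cst_continuous|exact: cvg_id].
    apply: cvgZr; apply: cvgB; last exact: cvg_within_filter c2.
    apply/cvgrPdist_lt => e e0'; rewrite near_withinE; apply/near_normP.
    have [d d0 hd] := DVDu_near_Gamma1 gx x0 e0'.
    by exists d => // t tx Dt; rewrite distrC; apply: hd => //; exact: DpD.
  have cgw : grad psi t @[t --> within Dp (nbhs x)] --> grad psi x by exact: cvg_within_filter cg.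
  exact: cvg_dot.
Qed.

Let A2 : (lebesgue_rV N : {measure set 'rV[R]_N -> \bar R}).-integrable setT
  (EFin \o ((fun x => `|A x| ^+ 2) \_ Dp)).
Proof.
have [_ iu] := weak_solution_C1 oOm open_Sig cDV (eq_rect _ (fun P => C1_on P u) C1_u _ (setIC _ _)) hsol.
rewrite setIC in iu.
have [L hL] := hbd; have L0 : 0 <= L by apply: le_trans (hL 0 hO).
have [C C0 hC] := DV_le n0 hH hHC1 hV hH0 hdual.
have sg1 : `|sg| = 1.
  by apply/eqP; rewrite -(@eqrXn2 _ 2)// expr1n -normrX expr2 sg2 normr1.
pose k := `|b| * (N%:R^-1 * L).
have ni : 0 <= N%:R^-1 :> R by rewrite invr_ge0.
have k0 : 0 <= k by rewrite !mulr_ge0.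
pose Q : set 'rV[R]_N := cube (L + 1).
have bQ : BM (fun x : 'rV[R]_N => 2 * k ^+ 2 * \1_Q x) by apply: BMZ; exact: BM_box.
pose F x := ((2 * C ^+ 2)%:E * (\sum_(i < N) (((partial i u) \_ D) x ^+ 2)%:E) +
  (2 * k ^+ 2 * \1_Q x)%:E)%E.
have iF : (lebesgue_rV N : {measure set 'rV[R]_N -> \bar R}).-integrable setT F.
  apply: integrableD => //; last exact: BM_integrable.
  apply: integrableZl => //.
  by apply: (@integrable_sum _ _ _ _ setT measurableT _ _ _
    (fun i x => (((partial i u) \_ D) x ^+ 2)%:E)) => i _; exact: iu.
have mA : measurable_fun setT ((fun x => `|A x| ^+ 2) \_ Dp).
  apply: measurable_restrict_open => // x Dx; have Ax := cA (DpD Dx).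
  have cn : {for x, continuous (fun y => `|A y|)}.
    by apply: (@continuous_comp _ _ _ A (fun y : 'rV[R]_N => `|y|)) => //; exact: norm_continuous.
  exact: (continuousM cn cn).
apply: le_integrable iF => //; first exact/measurable_EFinP.
move=> x _; rewrite /F sumEFin -EFinM -EFinD !abse_EFin lee_fin.
have S0 : 0 <= \sum_(i < N) ((partial i u) \_ D) x ^+ 2 by apply: sumr_ge0 => i _; exact: sqr_ge0.
have i0 : 0 <= (\1_Q x : R) by rewrite indicE.
have r0 : 0 <= 2 * C ^+ 2 * (\sum_(i < N) ((partial i u) \_ D) x ^+ 2) + 2 * k ^+ 2 * \1_Q x.
  by rewrite addr_ge0// mulr_ge0// mulr_ge0// sqr_ge0.
rewrite [leRHS]ger0_norm//; have [Dx|nDx] := pselect (Dp x); last by rewrite res_out// normr0.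
rewrite res_in// ger0_norm ?sqr_ge0//; have [Sx Ox] := DpD Dx.
have -> : \1_Q x = 1 :> R.
  rewrite indicE mem_set//; apply/cubeP; first by rewrite ltr_wpDl.
  have := hL x Ox; lra.
have -> : \sum_(i < N) ((partial i u) \_ D) x ^+ 2 = dot (grad u x) (grad u x).
  by apply: eq_bigr => i _; rewrite res_in// gradE expr2.
have h1 : `|A x| <= C * `|grad u x| + k.
  rewrite normrZ sg1 mul1r; apply: le_trans (ler_normB _ _) _; apply: lerD; first exact: hC.
  by rewrite !normrZ normrN (ger0_norm ni); apply: ler_wpM2l => //; apply: ler_wpM2l => //; exact: hL.
have h2 := dot_self_ge (grad u x).
have h3 : `|A x| ^+ 2 <= (C * `|grad u x| + k) ^+ 2.
  by rewrite lerXn2r ?nnegrE// addr_ge0// mulr_ge0// ltW.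
have h4 : C ^+ 2 * `|grad u x| ^+ 2 <= C ^+ 2 * dot (grad u x) (grad u x).
  by rewrite ler_wpM2l ?sqr_ge0.
have := sqr_ge0 (C * `|grad u x| - k); move: h3; rewrite sqrrD sqrrB exprMn.
move: h4; set p := C ^+ 2 * _; set p' := C ^+ 2 * _; set m := C * _ * k => h4 h3 h5.
suff : `|A x| ^+ 2 <= 2 * p' + 2 * k ^+ 2 by rewrite mulr1 /p' mulrA.
clearbody p p' m; rewrite !mulr2n in h3 h5; lra.
Qed.

Lemma comparison_torsion x : Dp x -> x != 0 -> 0 < z x -> grad z x = 0.
Proof.
have bDp : exists M, forall x, Dp x -> `|x| <= M.
  by have [L hL] := hbd; exists L => y /DpD[_]; exact: hL.
apply: (comparison oDp bDp (fun x Dx => cA (DpD Dx)) weakA hN cz bddA) => //.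
- move=> y cy nDy y0; have [|[h1 h2]] := bdry cy nDy y0; first by left.
  by right; exact: neumannA.
- move=> y Dy; rewrite AE (grad_z (DpD Dy)) dotZl dotZr mulrA sg2 mul1r dotC.
  exact: DV_monotone.
- move=> y Dy; rewrite AE (grad_z (DpD Dy)) dotZl dotZr mulrA sg2 mul1r dotC => h.
  have [->|ne] := eqVneq (grad u y) (b *: grad (torsion rho) y); first by rewrite subrr scaler0.
  by have := DV_strictly_monotone hH hHC1 hV ne; rewrite h ltxx.
Qed.

(* On the ray through x the derivative of flat1(z) vanishes, so z stays positive
   until the ray leaves O, where z must become nonpositive. *)
Lemma comparison_ray x : (exists M, forall x, O x -> `|x| <= M) -> Dp x -> x != 0 ->
  sg * (u x - b * torsion rho x) <= 0.
Proof.
move=> [M hM] Dx x0; rewrite leNgt -/(z x); apply/negP => zx.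
have Sx : Sig x by case: Dx.
(* Any factor that carries [x] beyond the bounded set [O]; it exceeds 1, so the segment runs
   outwards along the ray. *)
pose tM := (`|M| + 1) / `|x| + 1.
have xp : 0 < `|x| by rewrite normr_gt0.
have tM0 : 0 < tM by rewrite ltr_wpDl// divr_ge0// addr_ge0.
have nOy : ~ O (tM *: x).
  move=> /hM; rewrite normrZ gtr0_norm// mulrDl mul1r divfK ?gt_eqF//.
  have := ler_norm M; lra.
have Ox : O x by case: Dx.
have [t [/andP[t0 t1] bt below]] := segment_exit oO Ox nOy.
have lineE s : x + s *: (tM *: x - x) = (1 + s * (tM - 1)) *: x.
  by rewrite -[X in _ - X]scale1r -scalerBl scalerA scalerDl scale1r.
have tM1 : 0 <= tM - 1 by rewrite addrK divr_ge0// addr_ge0.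
pose v := tM *: x - x; pose y := x + t *: v.
have fac s : 0 <= s -> 0 < 1 + s * (tM - 1) by move=> s0; rewrite ltr_pwDl// mulr_ge0.
have Sl s : 0 <= s -> Sig (x + s *: v) by move=> s0; rewrite lineE; apply: Sig_scale => //; exact: fac.
have Dl s : 0 <= s < t -> Dp (x + s *: v).
  by move=> /andP[s0 st]; split; [exact: Sl|apply: below; rewrite s0].
have nl0 s : 0 <= s -> x + s *: v != 0.
  by move=> s0; rewrite lineE scaler_eq0 negb_or x0 gt_eqF// fac.
have Ez : C1_on Dp (fun p => flat1 (z p)) by exact: C1_on_flat1.
(* Where [z] is positive its gradient vanishes by the comparison principle; elsewhere [dflat1]
   vanishes. Composing with [flat1] avoids tracking the set where [z] is positive. *)
have der s : 0 <= s < t -> is_derive s (1 : R) (fun s => flat1 (z (x + s *: v))) 0.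
  move=> hs; have Ds := Dl s hs; have s0 : 0 <= s by case/andP : hs.
  have dz := C1_differentiable cz Ds.
  have := @is_derive_line _ _ (fun p => flat1 (z p)) x v s (C1_differentiable Ez Ds).
  rewrite grad_flat1// dotZl; have [zp|zn] := ltP 0 (z (x + s *: v)); last by rewrite dflat1_le0// mul0r.
  by rewrite (comparison_torsion Ds (nl0 s s0) zp) dot0l mulr0.
have cst s : 0 < s < t -> flat1 (z (x + s *: v)) = flat1 (z x).
  move=> /andP[s0 st].
  have c1 : {within `[0, s], continuous (fun s => flat1 (z (x + s *: v)))}.
    apply: continuous_in_subspaceT => r /set_mem/=; rewrite in_itv/= => /andP[r0 rs].
    have hr : 0 <= r < t by rewrite r0 (le_lt_trans rs).
    by have [d _] := der r hr; apply: differentiable_continuous; apply/derivable1_diffP.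
  have d1 r : r \in `]0, s[%R -> is_derive r (1 : R) (fun s => flat1 (z (x + s *: v))) ((fun=> 0) r).
    rewrite in_itv/= => /andP[r0 rs]; apply: der; rewrite (ltW r0)/=; exact: lt_trans st.
  have [c _] := MVT s0 d1 c1; rewrite mul0r => /subr0_eq ->.
  by rewrite scale0r addr0.
have cy : closure Dp y.
  apply/closure_normP => e e0; have [v0|v0] := eqVneq v 0.
    exists x => //; by rewrite /y v0 scaler0 addr0 subrr normr0.
  have vp : 0 < `|v| by rewrite normr_gt0.
  pose d := Num.min (t / 2) (e / (2 * `|v|)).
  have d0 : 0 < d by rewrite lt_min !divr_gt0// mulr_gt0.
  have dt : d <= t / 2 by rewrite ge_min lexx.
  have de : d <= e / (2 * `|v|) by rewrite ge_min lexx orbT.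
  exists (x + (t - d) *: v); first by apply: Dl; apply/andP; split; lra.
  rewrite /y opprD addrACA subrr add0r -scalerBl normrZ addrAC subrr add0r normrN gtr0_norm//.
  rewrite ler_pdivlMr ?mulr_gt0// in de; lra.
have nDy : ~ Dp y by move=> [_]; case: ((boundary_openP _ oO).1 bt).
(* The exit point stays in the open cone, so it cannot belong to [Gamma1], which rules out the
   second alternative. *)
have [hz|[ngy [W [oW Wy] hW]]] := bdry cy nDy (nl0 t (ltW t0)); last first.
  have nDDy : ~ D y by move=> [Sy Oy]; apply: nDy; split=> //; exact: hW.
  have [//|gy] := boundary_cases (closureS DpD cy) nDDy; exact: (Gamma1_nSig gy (Sl t (ltW t0))).
have k0 : 0 < flat1 (z x) by exact: flat1_gt0.
have /cvgrPdist_lt/(_ _ k0)/nbhs_ballP[e /= e0 he] := @continuous_flat1 R 0.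
have /near_normP[d d0 hd] := hz e e0.
pose s := t - Num.min (t / 2) (d / (2 * (`|v| + 1))).
have v1 : 0 < `|v| + 1 by rewrite ltr_wpDl.
have m0 : 0 < Num.min (t / 2) (d / (2 * (`|v| + 1))) by rewrite lt_min !divr_gt0// mulr_gt0.
have m1 : Num.min (t / 2) (d / (2 * (`|v| + 1))) <= t / 2 by rewrite ge_min lexx.
have m2 : Num.min (t / 2) (d / (2 * (`|v| + 1))) <= d / (2 * (`|v| + 1)) by rewrite ge_min lexx orbT.
have hs : 0 < s < t by rewrite /s; apply/andP; split; lra.
have hs' : 0 <= s < t by case/andP : hs => h1 ->; rewrite ltW.
have sy : `|x + s *: v - y| < d.
  rewrite /y opprD addrACA subrr add0r -scalerBl normrZ distrC ger0_norm; last by rewrite /s; lra.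
  rewrite ler_pdivlMr ?mulr_gt0// in m2; have := normr_ge0 v; rewrite /s; nra.
have zs := hd _ sy (Dl s hs').
have := cst s hs; have [zn|zp] := leP (z (x + s *: v)) 0; first by rewrite (flat1_le0 zn) => h; rewrite -h ltxx in k0.
move=> h; have := he (z (x + s *: v)); rewrite -ball_normE /ball_/= sub0r normrN gtr0_norm// => /(_ zs).
by rewrite (flat1_le0 (lexx 0)) sub0r normrN h gtr0_norm// ltxx.
Qed.

End truncated_sector.

(** * Bounds on u and the extremal points of Gamma0 *)

Lemma u_ge0 x : D x -> x != 0 -> 0 <= u x.
Proof.
move=> Dx x0.
have hb y : closure D y -> ~ D y -> y != 0 ->
    (forall e, 0 < e -> \forall x \near y, D x -> -1 * (u x - 0 * torsion 0 x) < e) \/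
    (~ closure Gamma0 y /\ exists2 W, open W /\ W y & forall x, W x -> Sig x -> Om x -> Om x).
  move=> cy nDy _; have [gy|gy] := boundary_cases cy nDy.
    left=> e e0; apply: filterS (u_near_Gamma0 gy e0) => p h Dp.
    by rewrite mul0r subr0 mulN1r; have := h Dp; rewrite ltr_norml => /andP[]; lra.
  right; split; first by move: gy; rewrite hG1 => -[].
  by exists setT => //; split=> //; exact: openT.
have s2 : -1 * -1 = 1 :> R by rewrite mulrNN mulr1.
have sb : -1 * (1 - 0) <= 0 :> R by rewrite subr0 mulr1; lra.
have := comparison_ray oOm (fun x h => h.2) s2 sb hb hbd Dx x0.
by rewrite mul0r subr0 mulN1r oppr_le0.
Qed.

(** The segment from the origin to [x] could leave [Om] only at a point of [Gamma0] with
    [H0 < r]. *)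
Lemma sector_sub r x : (forall z, closure Gamma0 z -> r <= H0 z) -> Sig x -> H0 x < r -> Om x.
Proof.
move=> hr Sx xr; apply: contrapT => nOx.
have [t [/andP[t0 t1] bt _]] := segment_exit oOm hO nOx.
rewrite subr0 add0r in bt; have /hr : closure Gamma0 (t *: x).
  by apply: subset_closure; rewrite hG0; split=> //; exact: Sig_scale.
rewrite (normZ hH0) gtr0_norm// leNgt => /negP; apply; apply: le_lt_trans xr.
by rewrite ler_piMl// norm_nonneg.
Qed.

Lemma norm_ball_open r : open [set x | H0 x < r].
Proof.
apply: (@open_comp _ _ H0 [set t | t < r]); last exact: open_lt.
by move=> x _; exact: norm_continuous_rV.
Qed.

Lemma norm_ball_bounded r : exists M, forall x, H0 x < r -> `|x| <= M.
Proof.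
have [c c0 hc] := norm_ge_mx hH0; exists (r / c) => x xr.
by rewrite ler_pdivlMr// mulrC ltW// (le_lt_trans (hc x)).
Qed.

Lemma torsion_near r y e : 0 < e -> \forall x \near y, `|torsion r x - torsion r y| < e.
Proof.
move=> e0; have ct : {for y, continuous (torsion r)}.
  exact: (C1_continuous (torsion_C1 n0 hH hHC1 hV hH0 hdual r openT)).
by have /cvgrPdist_lt/(_ e e0) := ct; apply: filterS => x; rewrite distrC.
Qed.

(** Here the truncating set is the Wulff ball. Where [H0 y >= r] the torsion function is nonpositive
    and [u_ge0] suffices; other boundary points are away from the closure of [Gamma0]. *)
Lemma torsion_le_u r x : 0 < r -> (forall z, closure Gamma0 z -> r <= H0 z) ->
  Sig x -> H0 x < r -> x != 0 -> torsion r x <= u x.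
Proof.
move=> r0 hr Sx xr x0; pose O := [set x | H0 x < r].
have OOm : Sig `&` O `<=` Om by move=> p [Sp Op]; exact: sector_sub hr Sp Op.
have hb y : closure (Sig `&` O) y -> ~ (Sig `&` O) y -> y != 0 ->
    (forall e, 0 < e -> \forall x \near y, (Sig `&` O) x -> -1 * (u x - 1 * torsion r x) < e) \/
    (~ closure Gamma0 y /\ exists2 W, open W /\ W y & forall x, W x -> Sig x -> Om x -> O x).
  move=> cy nDy y0; have [ry|yr] := leP r (H0 y); last first.
    right; split; first by move=> /hr; rewrite leNgt yr.
    by exists O => //; split=> //; exact: norm_ball_open.
  left=> e e0.
  have ty : torsion r y <= 0.
    rewrite torsionE//; apply: mulr_le0_ge0; last by rewrite invr_ge0 mulr_ge0.
    by rewrite subr_le0 lerXn2r ?nnegrE ?norm_nonneg// ltW.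
  have near0 : \forall x \near y, x != 0.
    apply/near_normP; exists `|y|; first by rewrite normr_gt0.
    by move=> p; apply: contraTneq => ->; rewrite sub0r normrN ltxx.
  apply: filterS2 near0 (torsion_near r y e0) => p p0 h Dp.
  have up := u_ge0 (conj Dp.1 (OOm _ Dp)) p0.
  by move: h; rewrite ltr_norml => /andP[]; lra.
have s2 : -1 * -1 = 1 :> R by rewrite mulrNN mulr1.
have sb : -1 * (1 - 1) <= 0 :> R by rewrite subrr mulr0.
have := comparison_ray (norm_ball_open (r := r)) OOm s2 sb hb (norm_ball_bounded r) (conj Sx xr) x0.
by rewrite mul1r mulN1r oppr_le0 subr_ge0.
Qed.

Lemma u_le_torsion r x : (forall z, closure Gamma0 z -> H0 z <= r) -> D x -> x != 0 ->
  u x <= torsion r x.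
Proof.
move=> hr Dx x0.
have hb y : closure D y -> ~ D y -> y != 0 ->
    (forall e, 0 < e -> \forall x \near y, D x -> 1 * (u x - 1 * torsion r x) < e) \/
    (~ closure Gamma0 y /\ exists2 W, open W /\ W y & forall x, W x -> Sig x -> Om x -> Om x).
  move=> cy nDy _; have [gy|gy] := boundary_cases cy nDy; last first.
    right; split; first by move: gy; rewrite hG1 => -[].
    by exists setT => //; split=> //; exact: openT.
  left=> e e0; have e20 : 0 < e / 2 by rewrite divr_gt0.
  have ty : 0 <= torsion r y.
    rewrite torsionE//; apply: mulr_ge0; last by rewrite invr_ge0 mulr_ge0.
    have H0y := norm_nonneg hH0 y; have ry := hr y gy.
    by rewrite subr_ge0 lerXn2r ?nnegrE// (le_trans H0y).
  apply: filterS2 (u_near_Gamma0 gy e20) (torsion_near r y e20) => p h1 h2 Dp.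
  by move: (h1 Dp) h2; rewrite !ltr_norml => /andP[g1 g2] /andP[g3 g4]; lra.
have s2 : 1 * 1 = 1 :> R by rewrite mulr1.
have sb : 1 * (1 - 1) <= 0 :> R by rewrite subrr mulr0.
have := comparison_ray oOm (fun x h => h.2) s2 sb hb hbd Dx x0.
by rewrite !mul1r subr_le0.
Qed.

Lemma ray_exit_Gamma0 x : D x -> x != 0 -> exists2 t, 1 < t & Gamma0 (t *: x).
Proof.
move=> [Sx Ox] x0; have [M hM] := hbd; have xp : 0 < `|x| by rewrite normr_gt0.
pose k := (`|M| + 1) / `|x|.
have k0 : 0 < k by rewrite divr_gt0// ltr_wpDl.
have nOy : ~ Om ((k + 1) *: x).
  move=> /hM; rewrite normrZ gtr0_norm ?addr_gt0// mulrDl mul1r divfK ?gt_eqF//.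
  have := ler_norm M; lra.
have [t [/andP[t0 t1] bt _]] := segment_exit oOm Ox nOy.
exists (1 + t * k); first by rewrite ltrDl mulr_gt0.
have E1 : x + t *: ((k + 1) *: x - x) = (1 + t * k) *: x.
  by rewrite scalerDl scale1r addrK scalerA [RHS]scalerDl scale1r.
rewrite hG0 -E1; split=> //; rewrite E1; apply: Sig_scale => //.
by rewrite addr_gt0// mulr_gt0.
Qed.

(** A ray may cross [Gamma0] several times; the first crossing is used because the whole open
    segment from the origin to it lies in the sector. *)
Lemma first_exit_Gamma0 y : Gamma0 y ->
  exists t, [/\ 0 < t <= 1, Gamma0 (t *: y) & forall s, 0 < s < t -> D (s *: y)].
Proof.
move=> gy; have nOy := Gamma0_nOm (subset_closure gy).
have Sy : Sig y by move: gy; rewrite hG0 => -[].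
have [t [t01 bt hs]] := segment_exit oOm hO nOy; exists t; split=> //.
  have t0 : 0 < t by case/andP : t01.
  by move: bt; rewrite subr0 add0r hG0 => bt; split=> //; exact: Sig_scale.
move=> s /andP[s0 st]; split; first exact: Sig_scale.
by have := hs s; rewrite subr0 add0r; apply; rewrite ltW.
Qed.

Lemma D_point : exists2 x, D x & x != 0.
Proof.
have [_ _ [x ox]] := hom; have xs : dot x x = 1.
  by case: hom => -[U _ omE] _ _; move: ox; rewrite omE => -[].
have x0 : x != 0 by apply: contra_eqN xs => /eqP ->; rewrite dot0l eq_sym oner_eq0.
have Sx : Sig x by rewrite hSig; right; exists 1, x; rewrite scale1r.
have [e e0 he] := open_normP oOm hO; have xp : 0 < `|x| by rewrite normr_gt0.
have k0 : 0 < e / (2 * `|x|) by rewrite divr_gt0// mulr_gt0.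
exists ((e / (2 * `|x|)) *: x); last by rewrite scaler_eq0 negb_or x0 gt_eqF.
split; first exact: Sig_scale.
apply: he; rewrite subr0 normrZ gtr0_norm// invfM mulrA divfK ?gt_eqF//; lra.
Qed.

Lemma Gamma0_extremal : exists z1 z2, [/\ closure Gamma0 z1, closure Gamma0 z2,
  forall z, closure Gamma0 z -> H0 z1 <= H0 z & forall z, closure Gamma0 z -> H0 z <= H0 z2].
Proof.
have [x Dx x0] := D_point; have [t _ gt] := ray_exit_Gamma0 Dx x0.
have bD : exists M, forall x, D x -> `|x| <= M by have [M hM] := hbd; exists M => y [_ /hM].
have cK : compact (closure Gamma0).
  apply: (subclosed_compact _ (compact_closure_bounded bD)); first exact: closed_closure.
  exact: closure_Gamma0_closure.
have cH : {within closure Gamma0, continuous H0}.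
  exact: continuous_subspaceT (norm_continuous_rV hH0).
have ne : closure Gamma0 !=set0 by exists (t *: x); exact: subset_closure.
have [z1 /set_mem h1 m1] := compact_EVT_min ne cK cH.
have [z2 /set_mem h2 m2] := compact_EVT_max ne cK cH.
by exists z1, z2; split=> // z cz; [apply: m1|apply: m2]; exact/mem_set.
Qed.

(** * Slope estimates at the extremal points *)

Lemma grad_u_near_Gamma0 z : closure Gamma0 z -> forall e, 0 < e ->
  exists2 d, 0 < d & forall x, D x -> `|x - z| < d -> `|H (grad u x) - q (H0 z)| < e.
Proof.
move=> gz e e0; have /cvgrPdist_lt/(_ e e0) := hgrad gz.
rewrite near_withinE => /near_normP[d d0 hd].
by exists d => // x Dx xz; rewrite distrC -Du_grad//; exact: hd.
Qed.

(** Endpoints may lie on [Gamma0] or [Gamma1], where only continuity of [u] is used. *)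
Lemma u_line_MVT x v (a b : R) : a < b ->
  (forall s, a <= s <= b -> (closure D `\ 0) (x + s *: v)) ->
  (forall s, a < s < b -> D (x + s *: v)) ->
  exists2 c, a < c < b & u (x + b *: v) - u (x + a *: v) = dot (grad u (x + c *: v)) v * (b - a).
Proof.
move=> ab cl Dl; have v1 : 0 < `|v| + 1 by rewrite ltr_wpDl.
have cf : {within `[a, b], continuous (fun s => u (x + s *: v))}.
  apply/subspace_continuousP => s; rewrite /= in_itv/= => hs.
  apply/cvgrPdist_lt => e e0; have [d d0 hd] := within_continuous_normP huC0 (cl s hs) e0.
  rewrite near_withinE; apply/nbhs_ballP; exists (d / (`|v| + 1)); first exact: divr_gt0.
  move=> t; rewrite -ball_normE /ball_/= in_itv/= => st ht; rewrite distrC.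
  apply: hd; first exact: cl.
  rewrite opprD addrACA subrr add0r -scalerBl normrZ distrC.
  rewrite ltr_pdivlMr// in st; apply: le_lt_trans st; rewrite ler_wpM2l// lerDl//.
have df s : s \in `]a, b[%R -> is_derive s (1 : R) (fun s => u (x + s *: v)) (dot (grad u (x + s *: v)) v).
  by rewrite in_itv/= => hs; apply: is_derive_line; exact: C1_differentiable C1_u (Dl s hs).
have [c] := MVT ab df cf; rewrite in_itv/= => hc E1.
by exists c.
Qed.

(** The ray to [z] itself may run in the lateral boundary, so the argument uses the first exit point
    [y'] of the ray through a nearby point of [Gamma0]. It is close to [z] because [H0] is minimal
    at [z]. *)
Lemma q_ge z : (forall r, 0 < r -> 0 < q r) -> closure Gamma0 z ->
  (forall y, closure Gamma0 y -> H0 z <= H0 y) -> H0 z / N%:R <= q (H0 z).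
Proof.
move=> hq gz zmin; rewrite leNgt; apply/negP => qr.
have z0 := Gamma0_neq0 gz; have rp := norm_pos hH0 z0.
pose r := H0 z; rewrite -/r in qr rp zmin.
have N0 : 0 < N%:R :> R by rewrite ltr0n.
(* A slope strictly between the supposed limit of [H (grad u)] and the slope [r / N] of the torsion
   function. *)
pose q1 := (q r + r / N%:R) / 2.
have qq := hq r rp.
have q1p : 0 < q1 by rewrite /q1; have : 0 < r / N%:R by [exact: divr_gt0]; lra.
have rN : N%:R * (r / N%:R) = r by rewrite mulrC divfK// gt_eqF.
have q1r : N%:R * q1 < r by rewrite -[ltRHS]rN ltr_pM2l// /q1; lra.
have e0 : 0 < q1 - q r by rewrite /q1; lra.
have [d d0 hd] := grad_u_near_Gamma0 gz e0.
have [C C0 hC] := norm_le_mx hH0; have [c c0 hc] := norm_ge_mx hH0.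
have z10 : 0 < `|z| + 1 by rewrite ltr_wpDl.
(* Relative length of the last piece of the ray: the first two bounds are the hypotheses of
   [torsion_margin], the third keeps the piece within [d / 4] of its end. *)
pose m := Num.min (1 / 2) (Num.min ((r - N%:R * q1) / r) (d / (4 * (`|z| + 1)))).
have m0 : 0 < m.
  by rewrite !lt_min; apply/and3P; split; rewrite divr_gt0 ?subr_gt0// mulr_gt0.
have m1 : m <= 1 / 2 by rewrite ge_min lexx.
have m2 : m * r <= r - N%:R * q1 by rewrite -ler_pdivlMr// !ge_min lexx orbT.
have m3 : m * (4 * (`|z| + 1)) <= d by rewrite -ler_pdivlMr ?mulr_gt0// !ge_min lexx !orbT.
pose s := 1 - m.
have s0 : 0 < s by rewrite /s; lra.
have s1 : s < 1 by rewrite /s; lra.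
have [eta eta0 Ppos] := torsion_margin rp (mulr_gt0 N0 q1p) m0 m1 m2.
(* Lipschitz factor for passing from [|y - z|] to [|y' - z|]. The three terms of [del] then give
   [H0 y' < r + eta], [|y'| <= |z| + 1] and [|y' - z| < d / 4]. *)
pose w := 1 + C / c; have w0 : 0 < w by rewrite /w; have : 0 < C / c by [exact: divr_gt0]; lra.
pose del := Num.min (eta / C) (Num.min (1 / w) (d / (4 * w))).
have del0 : 0 < del by rewrite !lt_min; apply/and3P; split; rewrite divr_gt0// mulr_gt0.
have /closure_normP/(_ del del0)[y gy] := gz; rewrite !lt_min => /and3P[y1 y2 y3].
rewrite ltr_pdivlMr// in y1; rewrite ltr_pdivlMr// in y2; rewrite ltr_pdivlMr ?mulr_gt0// in y3.
have [t [/andP[t0 t1] gy' hy']] := first_exit_Gamma0 gy.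
pose y' := t *: y; rewrite -/y' in gy'.
have rho_le : H0 y' <= H0 y.
  by rewrite /y' (normZ hH0) gtr0_norm// ler_piMl// norm_nonneg.
have Hyz : H0 y <= r + C * `|y - z|.
  have := norm_triangle hH0 z (y - z); rewrite addrC subrK => h; apply: le_trans h _.
  by rewrite lerD2l hC.
have rho1 : r <= H0 y' by apply: zmin; exact: subset_closure.
have rho2 : H0 y' < r + eta by rewrite [C * _]mulrC in Hyz; lra.
have rhop : 0 < H0 y' by lra.
(* Going back from [y] to the first exit lowers [H0] by at most [H0 y - r], since [H0 y' >= r], and
   this excess is at most [C * |y - z|]. *)
have yy' : `|y' - y| <= C / c * `|y - z|.
  rewrite /y' -{2}[y]scale1r -scalerBl normrZ distrC ger0_norm ?subr_ge0//.
  rewrite mulrAC ler_pdivlMr//; apply: (@le_trans _ _ ((1 - t) * H0 y)).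
    by rewrite -mulrA ler_wpM2l ?subr_ge0// mulrC.
  have -> : (1 - t) * H0 y = H0 y - H0 y' by rewrite /y' (normZ hH0) gtr0_norm//; ring.
  lra.
have y'z : `|y' - z| <= `|y - z| * w.
  have := ler_normD (y' - y) (y - z); rewrite addrA subrK => h; apply: le_trans h _.
  by rewrite /w mulrDr mulr1 [`|y - z| * (C / c)]mulrC; lra.
have y'z1 : `|y'| <= `|z| + 1.
  have := ler_normD (y' - z) z; rewrite subrK; lra.
have Dl tau : 0 < tau < 1 -> D (0 + tau *: y').
  move=> /andP[h1 h2]; rewrite add0r scalerA; apply: hy'.
  by rewrite mulr_gt0//= gtr_pMl.
have y'0 : y' != 0 by apply: Gamma0_neq0; exact: subset_closure.
have cl tau : s <= tau <= 1 -> (closure D `\ 0) (0 + tau *: y').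
  move=> /andP[h1 h2]; have tau0 : 0 < tau by lra.
  split; last by rewrite add0r; apply/eqP; rewrite scaler_eq0 negb_or y'0 gt_eqF.
  move: h2; rewrite le_eqVlt => /orP[/eqP ->|h2].
    by rewrite add0r scale1r; exact: Gamma0_closure.
  by apply: subset_closure; apply: Dl; rewrite tau0.
have Dl' tau : s < tau < 1 -> D (0 + tau *: y').
  by move=> /andP[h1 h2]; apply: Dl; rewrite h2 andbT; lra.
have [a /andP[a1 a2]] := u_line_MVT s1 cl Dl'.
have -> : 1 - s = m by rewrite /s; ring.
rewrite !add0r scale1r (hu0 gy') sub0r => E1.
have Pr : 2 * (N%:R * q1) * m * H0 y' < r ^+ 2 - s ^+ 2 * H0 y' ^+ 2 by apply: Ppos; rewrite rho1.
have N20 : 0 < 2 * N%:R :> R by rewrite mulr_gt0.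
have sy : H0 (s *: y') = s * H0 y' by rewrite (normZ hH0) gtr0_norm.
have lowu : torsion r (s *: y') <= u (s *: y').
  apply: torsion_le_u => //.
  - by apply: Sig_scale => //; move: gy'; rewrite hG0 => -[].
  - rewrite sy -(@ltr_pXn2r _ 2)// ?nnegrE ?mulr_ge0// ?(ltW s0) ?(ltW rp) ?(ltW rhop)//.
    have := mulr_gt0 (mulr_gt0 (mulr_gt0 (@ltr0Sn R 1) (mulr_gt0 N0 q1p)) m0) rhop.
    rewrite exprMn; lra.
  - by rewrite scaler_eq0 negb_or y'0 gt_eqF.
have low : q1 * m * H0 y' < u (s *: y').
  apply: lt_le_trans lowu; rewrite torsionE// sy exprMn ltr_pdivlMr//.
  have -> : q1 * m * H0 y' * (2 * N%:R) = 2 * (N%:R * q1) * m * H0 y' by ring.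
  exact: Pr.
have Day : D (a *: y') by have := Dl' a; rewrite add0r a1 a2; apply.
(* Over a piece of [H0]-length [m * H0 y'] the function [u] drops by more than [q1] times that
   length, so somewhere on it [H (grad u)] exceeds [q1]. *)
have cs := cauchy_schwarz hH0 hdual (- y') (grad u (a *: y')).
rewrite (norm_opp hH0) dotNl dotC in cs.
have hHa : q1 < H (grad u (a *: y')).
  rewrite -(ltr_pM2l (mulr_gt0 m0 rhop)).
  have g1 := ler_wpM2l (ltW m0) cs.
  have -> : m * H0 y' * q1 = q1 * m * H0 y' by ring.
  apply: lt_le_trans low _.
  have -> : u (s *: y') = m * - dot (grad u (a *: y')) y' by rewrite mulrN mulrC -E1 opprK.
  by rewrite -mulrA.
have az : `|a *: y' - z| < d.
  have h1 := ler_normD (a *: y' - y') (y' - z).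
  have e1 : a *: y' - y' = (a - 1) *: y' by rewrite scalerBl scale1r.
  rewrite addrA subrK e1 normrZ in h1.
  have h2 : `|a - 1| <= m by rewrite distrC ger0_norm; rewrite /s in a1; lra.
  have h3 : `|a - 1| * `|y'| <= m * (`|z| + 1) by apply: ler_pM.
  lra.
have := hd _ Day az; rewrite ltr_norml => /andP[_]; lra.
Qed.

Lemma u_le_torsion_closure r x : (forall z, closure Gamma0 z -> H0 z <= r) -> closure D x ->
  x != 0 -> u x <= torsion r x.
Proof.
move=> hr cx x0; rewrite leNgt; apply/negP => h.
pose e := (u x - torsion r x) / 2; have e0 : 0 < e by rewrite divr_gt0// subr_gt0.
have xD : (closure D `\ 0) x by split=> //; exact/eqP.
have [d d0 hd] := within_continuous_normP huC0 xD e0.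
have /near_normP[d' d'0 hd'] := torsion_near r x e0.
have m0 : 0 < Num.min (Num.min d d') `|x| by rewrite !lt_min d0 d'0 normr_gt0.
have /closure_normP/(_ _ m0)[y Dy] := cx; rewrite !lt_min => /andP[/andP[yd yd'] yx].
have y0 : y != 0 by apply: contraTneq yx => ->; rewrite sub0r normrN ltxx.
have yD : (closure D `\ 0) y by split; [exact: subset_closure|exact/eqP].
have := hd y yD yd; have := hd' y yd'; have := u_le_torsion hr Dy y0.
by rewrite !ltr_norml /e => ? /andP[? ?] /andP[? ?]; lra.
Qed.

(* Near a smooth point of Gamma1 every point of the cone can be joined to a
   point of Om inside the cone: go down along - grad psi, across, and back up. *)
Lemma Gamma1_local y : Gamma1 y -> y != 0 ->
  exists2 d, 0 < d & forall x, Sig x -> `|x - y| < d -> Om x.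
Proof.
move=> gy y0; have [U [psi [df Uy hU]]] := Gamma1_chart gy y0.
have [oU cpsi gpsi bE SE] := df; have [cy nDy] := Gamma1_closure gy.
have py : psi y = 0.
  by have [] // : ([set x | psi x = 0] `&` U) y; rewrite -bE; split=> //; exact: Gamma1_boundary.
have SU x : U x -> psi x < 0 -> Sig x.
  by move=> Ux px; have [] : (Sig `&` U) x by rewrite SE.
have UG x : Sig x /\ U x -> ~ boundary Om x.
  move=> [Sx Ux] bx; have [ng _] := hU x Ux.
  by apply: ng; apply: subset_closure; rewrite hG0.
pose nu := grad psi y; pose kap := dot nu nu.
have kap0 : 0 < kap by exact/dot_self_gt0/gpsi.
have nu1 : 0 < `|nu| + 1 by rewrite ltr_wpDl.
(* Near [y] the function [psi] decreases along [- nu] at rate at least [kap / 2]. *)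
have [d1 d10 h1] : exists2 d1, 0 < d1 & forall x, `|x - y| < d1 -> U x /\ kap / 2 <= dot (grad psi x) nu.
  have k20 : 0 < kap / 2 by rewrite divr_gt0.
  have cg : {for y, continuous (fun x => dot (grad psi x) nu)}.
    by apply: continuous_dot2; [exact: C1_grad_continuous cpsi Uy|exact: cst_continuous].
  have /continuous_atP/(_ _ k20)[d d0 hd] := cg; have [e e0 he] := open_normP oU Uy.
  exists (Num.min d e); first by rewrite lt_min d0.
  move=> x; rewrite lt_min => /andP[/hd h /he Ux]; split=> //.
  by move: h; rewrite -/nu -/kap ltr_norml => /andP[h _]; lra.
(* The descent by [lam *: nu] has length at most [d1 / 2], so a point within [d1 / 2] of [y] stays
   in the good ball. *)
pose lam := d1 / (2 * (`|nu| + 1)); have lam0 : 0 < lam by rewrite divr_gt0// mulr_gt0.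
have lnu : lam * `|nu| <= d1 / 2.
  rewrite /lam invfM mulrA mulrAC ler_pdivrMr// ler_wpM2l ?divr_ge0 ?(ltW d10)//.
  by rewrite lerDl.
have lk0 : 0 < lam * (kap / 2) by rewrite mulr_gt0// divr_gt0.
(* Within [d2] of [y] the value of [psi] is less than what the full descent removes. *)
have /continuous_atP/(_ _ lk0)[d2 d20 h2] := C1_continuous cpsi Uy.
pose d := Num.min (d1 / 2) d2.
have d0 : 0 < d by rewrite lt_min d20 divr_gt0.
have dd1 : d <= d1 / 2 by rewrite ge_min lexx.
have dd2 : d <= d2 by rewrite ge_min lexx orbT.
have near x tau : `|x - y| < d -> 0 <= tau <= lam -> `|x - tau *: nu - y| < d1.
  move=> xy /andP[t0 t1]; rewrite addrAC; apply: le_lt_trans (ler_normB _ _) _.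
  rewrite normrZ ger0_norm//; have : tau * `|nu| <= lam * `|nu| by rewrite ler_wpM2r.
  lra.
have down x tau : `|x - y| < d -> 0 <= tau <= lam ->
    U (x - tau *: nu) /\ psi (x - tau *: nu) <= psi x - tau * (kap / 2).
  move=> xy ht; split; first by have [] := h1 _ (near x tau xy ht).
  have [tau0 taul] := andP ht.
  move: tau0; rewrite le_eqVlt => /orP[/eqP <-|tau0]; first by rewrite scale0r mul0r !subr0.
  have dl s : 0 <= s <= tau -> is_derive s (1 : R) (fun s => psi (x + s *: - nu)) (dot (grad psi (x + s *: - nu)) (- nu)).
    move=> /andP[s0 s1]; apply: is_derive_line; apply: (C1_differentiable cpsi).
    rewrite scalerN; apply: (h1 _ (near x s xy _)).1; rewrite s0/=; lra.
  have cf : {within `[0, tau], continuous (fun s => psi (x + s *: - nu))}.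
    apply: continuous_in_subspaceT => s /set_mem/=; rewrite in_itv/= => hs.
    by have [d' _] := dl s hs; apply: differentiable_continuous; apply/derivable1_diffP.
  have df' s : s \in `]0, tau[%R -> is_derive s (1 : R) (fun s => psi (x + s *: - nu))
      ((fun s => dot (grad psi (x + s *: - nu)) (- nu)) s).
    by rewrite in_itv/= => /andP[s0 s1]; apply: dl; rewrite (ltW s0) ltW.
  have [c] := MVT tau0 df' cf; rewrite in_itv/= => /andP[c0 c1].
  rewrite scale0r addr0 subr0 !scalerN dotNr => E1.
  have hc : 0 <= c <= lam by rewrite (ltW c0)/=; lra.
  have [_ g] := h1 _ (near x c xy hc).
  have : tau * (kap / 2) <= tau * dot (grad psi (x - c *: nu)) nu by rewrite ler_wpM2l// ltW.
  lra.
exists d => // x Sx xy; have /closure_normP/(_ d d0)[p Dp py'] := cy.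
have lamI t : 0 <= t <= 1 -> 0 <= lam * t <= lam.
  by move=> /andP[t0 t1]; rewrite mulr_ge0 ?(ltW lam0)//= ler_piMr// ltW.
have neg x' : Sig x' -> `|x' - y| < d -> psi x' < 0.
  move=> Sx' x'y; have l0 : (0 : R) <= 0 <= lam by apply/andP; split=> //; exact: ltW.
  have [Ux' _] := down x' 0 x'y l0; rewrite scale0r subr0 in Ux'.
  by have [] : ([set x | psi x < 0] `&` U) x' by rewrite -SE.
have lam1 : 0 <= lam <= lam by rewrite lexx ltW.
pose P := [set x' | Sig x' /\ U x'].
have vert x' t : Sig x' -> `|x' - y| < d -> 0 <= t <= 1 -> P (x' - (lam * t) *: nu).
  move=> Sx' x'y ht; have [Uz pz] := down x' _ x'y (lamI t ht); split=> //; apply: SU => //.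
  apply: le_lt_trans pz _; have := neg x' Sx' x'y.
  have : 0 <= lam * t * (kap / 2) by apply: mulr_ge0; [have /andP[] := lamI t ht|rewrite divr_ge0// ltW].
  lra.
have Op : Om (p - lam *: nu).
  apply: (segment_stays (P := P) oOm Dp.2 _ UG) => t ht.
  rewrite addrAC subrr add0r scalerN scalerA mulrC; apply: vert => //; exact: Dp.1.
(* The straight segment from [p] to [x] may leave the cone; lowered by [lam *: nu] it has negative
   [psi] throughout and stays inside. *)
have Ox : Om (x - lam *: nu).
  apply: (segment_stays (P := P) oOm Op _ UG) => t /andP[t0 t1].
  have -> : p - lam *: nu + t *: (x - lam *: nu - (p - lam *: nu)) =
      (p + t *: (x - p)) - lam *: nu.
    by rewrite opprB addrA subrK addrAC.
  have py1 : `|p + t *: (x - p) - y| < d.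
    have -> : p + t *: (x - p) - y = (1 - t) *: (p - y) + t *: (x - y).
      apply/rowP => i; rewrite !mxE; ring.
    apply: le_lt_trans (ler_normD _ _) _; rewrite !normrZ !ger0_norm ?subr_ge0//.
    have g1 : (1 - t) * `|p - y| <= (1 - t) * Num.max `|p - y| `|x - y|.
      by rewrite ler_wpM2l ?subr_ge0// le_max lexx.
    have g2 : t * `|x - y| <= t * Num.max `|p - y| `|x - y| by rewrite ler_wpM2l// le_max lexx orbT.
    have g3 : Num.max `|p - y| `|x - y| < d by rewrite gt_max py'.
    lra.
  have [Uz pz] := down _ _ py1 lam1; split=> //; apply: SU => //; apply: le_lt_trans pz _.
  have := h2 _ (lt_le_trans py1 dd2); rewrite py subr0 ltr_norml => /andP[_]; lra.
apply: (segment_stays (P := P) oOm Ox _ UG) => t /andP[t0 t1].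
have -> : x - lam *: nu + t *: (x - (x - lam *: nu)) = x - (lam * (1 - t)) *: nu.
  by apply/rowP => i; rewrite !mxE; ring.
by apply: vert => //; apply/andP; split; lra.
Qed.

(** Otherwise [u], being nonnegative, would vanish near [z] in the sector, and its gradient could
    not approach the positive slope [q (H0 z)]. *)
Lemma u_positive_near z : closure Gamma0 z -> 0 < q (H0 z) -> forall e, 0 < e ->
  exists x, [/\ D x, `|x - z| < e & 0 < u x].
Proof.
move=> gz q0 e e0; have z0 := Gamma0_neq0 gz; have [d d0 hd] := grad_u_near_Gamma0 gz q0.
apply: contrapT => /forallNP h.
pose m := Num.min (Num.min e d) `|z|; have m0 : 0 < m by rewrite !lt_min e0 d0 normr_gt0.
have u0 x : D x -> `|x - z| < m -> u x = 0.
  move=> Dx; rewrite !lt_min => /andP[/andP[xe _] xz].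
  have x0 : x != 0 by apply: contraTneq xz => ->; rewrite sub0r normrN ltxx.
  apply/eqP; rewrite eq_le u_ge0// andbT leNgt; apply/negP => ux; exact: (h x).
have /closure_normP/(_ m m0)[p Dp pz] := closure_Gamma0_closure gz.
have gp : grad u p = 0.
  rewrite (@grad_eq _ _ u (cst 0)) ?grad_cst//.
  have : \forall x \near p, `|x - z| < m.
    apply/near_normP; exists (m - `|p - z|); first by rewrite subr_gt0.
    move=> x xp; have := ler_normD (x - p) (p - z); rewrite addrA subrK; lra.
  by apply: filterS2 (open_near open_sector Dp) => x; exact: u0.
have pd : `|p - z| < d by apply: lt_le_trans pz _; rewrite !ge_min lexx orbT.
have := hd p Dp pd; rewrite gp (norm_zero hH) sub0r normrN.
by rewrite gtr0_norm// ltxx.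
Qed.

(* At a contact point on Gamma1 the Neumann condition makes DV (Du x) tangential,
   hence admissible after an arbitrarily small tilt towards the inside. *)
Lemma contact_slope x k : closure D x -> x != 0 -> ~ closure Gamma0 x -> 0 < k ->
  (forall v, exists2 t1, 0 < t1 & forall t, 0 < t < t1 -> closure D (x + t *: v) ->
     u (x + t *: v) - u x <= t * (k * H0 v)) ->
  H (Du x) <= k.
Proof.
move=> cx x0 nG k0 growth; have Hpos y : 0 <= H0 y by exact: norm_nonneg.
have [Dx|nDx] := pselect (D x).
  (* In this direction Euler's identity gives slope [H (grad u x)^2], while [H0 w = H (grad u x)],
     so the growth bound reads [H^2 <= k * H]. *)
  rewrite Du_grad// leNgt; apply/negP => hk; pose w := DV (grad u x).
  have : dot (grad u x) w <= k * H0 w.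
    apply: dot_derivative_le; first exact: C1_differentiable C1_u Dx.
    have [t1 t10 ht1] := growth w; have [e e0 he] := open_normP open_sector Dx.
    have w1 : 0 < `|w| + 1 by rewrite ltr_wpDl.
    exists (Num.min t1 (e / (`|w| + 1))); first by rewrite lt_min t10 divr_gt0.
    move=> t /andP[t0]; rewrite lt_min => /andP[tt1 te].
    apply: ht1; first by rewrite t0.
    apply: subset_closure; apply: he; rewrite addrAC subrr add0r normrZ gtr0_norm//.
    rewrite ltr_pdivlMr// in te; apply: le_lt_trans te; rewrite ler_pM2l// lerDl//.
  rewrite dotC (DV_euler hH hHC1) (norm_DV n0 hH hHC1 hV hH0 hdual) expr2.
  by rewrite ler_pM2r; lra.
have [//|gx] := boundary_cases cx nDx.
rewrite leNgt; apply/negP => hk.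
have [dl dl0 hloc] := Gamma1_local gx x0.
have [U [psi [df Ux hU]]] := Gamma1_chart gx x0; have [oU cpsi gpsi bE SE] := df.
have px : psi x = 0.
  by have [] // : ([set x | psi x = 0] `&` U) x; rewrite -bE; split=> //; exact: Gamma1_boundary.
pose xi := Du x; rewrite -/xi in hk; pose nu := grad psi x.
have kap0 : 0 < dot nu nu by exact/dot_self_gt0/gpsi.
pose B := `|dot xi nu| + k * H0 nu + 1.
have B0 : 0 < B by rewrite ltr_wpDl// addr_ge0// mulr_ge0// ltW.
have Hxip : 0 < H xi by lra.
(* The numerator is the excess of [dot xi (DV xi)] over [k * H0 (DV xi)]; with this size of tilt the
   total loss, controlled by [tau * B], is half of it. *)
pose tau := H xi * (H xi - k) / (2 * B).
have g0 : 0 < H xi * (H xi - k) by rewrite mulr_gt0//; lra.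
have tau0 : 0 < tau by rewrite divr_gt0// mulr_gt0.
pose v := DV xi - tau *: nu.
have vxi : k * H0 v < dot xi v.
  rewrite dotBr dotZr dotC (DV_euler hH hHC1).
  have h1 : H0 v <= H xi + tau * H0 nu.
    have := norm_triangle hH0 (DV xi) (- (tau *: nu)).
    by rewrite (norm_opp hH0) (normZ hH0) gtr0_norm// (norm_DV n0 hH hHC1 hV hH0 hdual).
  have h2 : k * H0 v <= k * H xi + tau * (k * H0 nu).
    apply: (@le_trans _ _ (k * (H xi + tau * H0 nu))); first by rewrite ler_pM2l.
    by rewrite mulrDr mulrCA.
  have h3 : tau * dot xi nu <= tau * `|dot xi nu| by rewrite ler_pM2l// ler_norm.
  have h4 : tau * (2 * B) = H xi * (H xi - k) by rewrite /tau divfK// gt_eqF// mulr_gt0.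
  have h5 : tau * B = tau * `|dot xi nu| + tau * (k * H0 nu) + tau by rewrite /B; ring.
  have h6 : H xi * (H xi - k) = H xi ^+ 2 - k * H xi by ring.
  have h7 : tau * (2 * B) = 2 * (tau * B) by ring.
  lra.
(* The tangential part contributes nothing by the Neumann condition, so [v] points strictly into the
   cone and short steps remain in the sector. *)
have psiv : dot nu v = - (tau * dot nu nu).
  by rewrite dotBr dotZr dotC (Neumann_condition df Ux gx x0) sub0r.
have v10 : 0 < `|v| + 1 by rewrite ltr_wpDl.
pose a := dot xi v - k * H0 v; have a0 : 0 < a by rewrite subr_gt0.
have n10 : 0 < N%:R * (`|v| + 1) by rewrite mulr_gt0// ltr0n.
have [d3 d30 h3] := Du_near_Gamma1 gx x0 (divr_gt0 a0 n10).
have tk0 : 0 < tau * dot nu nu by rewrite mulr_gt0.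
have [d4 d40 h4] := differentiable_expansion (C1_differentiable cpsi Ux) (divr_gt0 tk0 v10).
have [d5 d50 h5] := open_normP oU Ux.
have [t1 t10 ht1] := growth v.
pose m := Num.min `|x| (Num.min (Num.min dl d3) (Num.min d4 d5)).
have m0 : 0 < m by rewrite !lt_min normr_gt0 x0 dl0 d30 d40 d50.
pose T := Num.min t1 (m / (`|v| + 1)).
have T0 : 0 < T by rewrite lt_min t10 divr_gt0.
have hloc0 t : 0 < t < T -> `|x + t *: v - x| < m.
  move=> /andP[t0]; rewrite lt_min => /andP[_]; rewrite ltr_pdivlMr// => tm.
  rewrite addrAC subrr add0r normrZ gtr0_norm//; apply: le_lt_trans tm.
  by rewrite ler_pM2l// lerDl.
have inD t : 0 < t < T -> D (x + t *: v) /\ `|x + t *: v - x| < d3.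
  move=> ht; have E1 : x + t *: v - x = t *: v by rewrite addrAC subrr add0r.
  have [t0 _] := andP ht; have := hloc0 t ht.
  rewrite E1 !lt_min => /andP[_ /andP[/andP[tl t3] /andP[t4 t5]]].
  split=> //; have Sv : Sig (x + t *: v).
    have [] // : (Sig `&` U) (x + t *: v).
    rewrite SE; split; last by apply: h5; rewrite E1.
    have := h4 _ t4; rewrite px subr0 -/nu dotZr psiv [t *: v + x]addrC normrZ gtr0_norm//.
    rewrite ler_norml mulrN opprK => /andP[_ h6] /=.
    have h7 : tau * dot nu nu / (`|v| + 1) * (t * `|v|) < t * (tau * dot nu nu).
      rewrite mulrAC ltr_pdivrMr// mulrCA -[ltRHS]mulrA ltr_pM2l// ltr_pM2l// ltrDl//.
    apply: le_lt_trans (_ : _ <= _ - t * (tau * dot nu nu)) _; first by rewrite lerBrDr; exact: h6.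
    by rewrite subr_lt0.
  by split=> //; apply: hloc; rewrite ?E1.
have tT : 0 < T / 2 < T by apply/andP; split; lra.
have [t0 t2] := andP tT.
have xD : (closure D `\ 0) x by split=> //; exact/eqP.
have cl t : 0 <= t <= T / 2 -> (closure D `\ 0) (x + t *: v).
  move=> /andP[]; rewrite le_eqVlt => /orP[/eqP <- _|ta tb]; first by rewrite scale0r addr0.
  have tt : 0 < t < T by rewrite ta/=; lra.
  have [Dt _] := inD t tt; split; first exact: subset_closure.
  have : x + t *: v != 0; last by move/eqP.
  by apply/eqP => e0; have := hloc0 t tt; rewrite e0 sub0r normrN /m lt_min ltxx.
have Dl t : 0 < t < T / 2 -> D (x + t *: v).
  by move=> /andP[ta tb]; have [] // := inD t _; rewrite ta/=; lra.
have [b /andP[b0 b1]] := u_line_MVT t0 cl Dl; rewrite subr0 scale0r addr0 => E1.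
have hb : 0 < b < T by rewrite b0/=; lra.
have [Db bd3] := inD b hb.
have h6 := h3 _ Db bd3.
have h7 : dot xi v - a < dot (grad u (x + b *: v)) v.
  have : `|dot (grad u (x + b *: v) - xi) v| < a.
    apply: le_lt_trans (dot_norm_le _ _) _.
    rewrite ltr_pdivlMr// in h6; apply: le_lt_trans h6.
    rewrite -mulrA mulrCA; apply: ler_wpM2l => //; apply: ler_wpM2l => //; rewrite lerDl//.
  by rewrite dotBl ltr_norml => /andP[]; lra.
have h8 : u (x + T / 2 *: v) - u x <= T / 2 * (k * H0 v).
  apply: ht1; last by apply: subset_closure; case: (inD _ tT).
  by rewrite t0/=; apply: lt_le_trans t2 _; rewrite ge_min lexx.
have : T / 2 * (dot xi v - a) < T / 2 * dot (grad u (x + b *: v)) v by rewrite ltr_pM2l.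
have : dot xi v - a = k * H0 v by rewrite /a; ring.
move=> ->; rewrite [T / 2 * dot _ _]mulrC -E1; lra.
Qed.

(** Works on a small [H0]-ball about an interior point [x0], since [z] may be a corner. The maximum
    of [phi] cannot lie on the closure of [Gamma0], where [u] is 0, nor on the sphere, where the
    torsion bound makes [phi] nonpositive; at any other contact the slope is at most [qa], against
    the limit [q r] near [z]. *)
Lemma q_le z : 0 < q (H0 z) -> closure Gamma0 z ->
  (forall y, closure Gamma0 y -> H0 y <= H0 z) -> q (H0 z) <= H0 z / N%:R.
Proof.
move=> qz gz zmax; rewrite leNgt; apply/negP => qr.
have z0 := Gamma0_neq0 gz; have rp := norm_pos hH0 z0.
pose r := H0 z; rewrite -/r in qr rp zmax qz.
have N0 : 0 < N%:R :> R by rewrite ltr0n.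
(* The gap is cut into thirds: [qa] is the slope of the comparison cone and [qb] a lower bound for
   [H (grad u)] near [z]. *)
pose qa := r / N%:R + (q r - r / N%:R) / 3; pose qb := r / N%:R + (q r - r / N%:R) / 3 * 2.
have rN0 : 0 < r / N%:R by exact: divr_gt0.
have qa1 : r / N%:R < qa by rewrite /qa; lra.
have qab : qa < qb by rewrite /qa /qb; lra.
have qb1 : 0 < q r - qb by rewrite /qb; lra.
have qap : 0 < qa by lra.
have [d d0 hd] := grad_u_near_Gamma0 gz qb1.
have [C C0 hC] := norm_le_mx hH0; have [c c0 hc] := norm_ge_mx hH0.
(* The first bound keeps the ball within [d / 4] of [x0]; the second, with the same bound on [eps],
   keeps it away from the origin, since [H0 >= r - eps - s] there. *)
pose s := Num.min (c * d / 4) (r / 4).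
have s0 : 0 < s by rewrite lt_min !divr_gt0// mulr_gt0.
have s1 : s <= c * d / 4 by rewrite ge_min lexx.
have s2 : s <= r / 4 by rewrite ge_min lexx orbT.
(* On the sphere [torsion r] is at most [r * (eps + s) / N]; the excess of [qa] over [r / N] must
   pay for the term in [eps], and here it does so with a factor 2 to spare. *)
pose eps := Num.min ((qa - r / N%:R) * s / (2 * (r / N%:R))) (r / 4).
have eps0 : 0 < eps.
  have h : 0 < qa - r / N%:R by rewrite subr_gt0.
  by rewrite lt_min; apply/andP; split; apply: divr_gt0 => //; exact: mulr_gt0.
have eps1 : eps * (2 * (r / N%:R)) <= (qa - r / N%:R) * s.
  have h : 0 < 2 * (r / N%:R) by exact: mulr_gt0.
  by rewrite -(ler_pdivlMr _ _ h) /eps ge_min lexx.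
have eps2 : eps <= r / 4 by rewrite ge_min lexx orbT.
have del0 : 0 < Num.min (d / 4) (eps / C) by rewrite lt_min !divr_gt0.
have [x0 [Dx0]] := u_positive_near gz qz del0; rewrite lt_min => /andP[x0z x0e] ux0.
rewrite ltr_pdivlMr// in x0e.
have Hx0 : r - eps <= H0 x0.
  have := norm_triangle hH0 x0 (z - x0); rewrite addrC subrK -/r.
  have := hC (z - x0); rewrite distrC mulrC; lra.
have Hsub x : H0 x0 - H0 (x - x0) <= H0 x.
  have := norm_triangle hH0 x (x0 - x); rewrite addrC subrK -[x0 - x]opprB (norm_opp hH0); lra.
pose K := closure D `&` [set x | H0 (x - x0) <= s].
have cH (x : 'rV[R]_N) : {for x, continuous (fun x : 'rV[R]_N => H0 (x - x0))}.
  apply: (@continuous_comp _ _ _ (fun x : 'rV[R]_N => x - x0) H0); last exact: norm_continuous_rV.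
  by apply: continuousB; [exact: cvg_id|exact: cst_continuous].
have bD : exists M, forall x, D x -> `|x| <= M by have [M hM] := hbd; exists M => y [_ /hM].
have cK : compact K.
  have := @compact_sublevel _ _ (closure D) (fun x : 'rV[R]_N => s - H0 (x - x0)) (compact_closure_bounded bD).
  rewrite (_ : mkset _ = K); last by apply/seteqP; split=> x [h1 h2]; split; rewrite //= ?subr_ge0// -subr_ge0.
  by apply=> x _; apply: continuousB => //; exact: cst_continuous.
have K0 x : K x -> (closure D `\ 0) x.
  move=> [cx xs]; split=> // x00; have := Hsub x; rewrite x00 (norm_zero hH0).
  move: xs; rewrite /= x00; lra.
pose phi x := u x - qa * H0 (x - x0).
have cphi : {within K, continuous phi}.
  apply/subspace_continuousP => x Kx; apply: cvgB.
    have /subspace_continuousP/(_ x (K0 x Kx)) := huC0.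
    by apply: cvg_trans; apply: cvg_app; exact: within_subset.
  apply: cvgM; first exact: cvg_cst.
  by apply: cvg_within_filter; exact: cH.
have neK : K !=set0.
  by exists x0; split; [exact: subset_closure|rewrite /= subrr (norm_zero hH0) ltW].
have [xh /set_mem Kx hmax] := compact_EVT_max neK cK cphi.
have phi0 : 0 < phi xh.
  have Kx0 : x0 \in K.
    by apply/mem_set; split; [exact: subset_closure|rewrite /= subrr (norm_zero hH0) ltW].
  by apply: lt_le_trans (hmax _ Kx0); rewrite /phi subrr (norm_zero hH0) mulr0 subr0.
have [cx xs] := Kx; have [_ xh0'] := K0 xh Kx; have xh0 : xh != 0 by exact/eqP.
have Hpos x : 0 <= H0 x by exact: norm_nonneg.
(* On the sphere [H0 (xh - x0) = s] the bound by [torsion r] gives [u xh <= qa * s], against the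
   positive value of [phi] at its maximum. *)
have xs' : H0 (xh - x0) < s.
  rewrite lt_neqAle xs andbT; apply/eqP => E1; move: phi0; apply/negP; rewrite -leNgt.
  rewrite /phi E1 subr_le0; apply: le_trans (u_le_torsion_closure zmax cx xh0) _.
  rewrite torsionE// ler_pdivrMr ?mulr_gt0//.
  have h1 := Hsub xh; rewrite E1 in h1.
  have h2 : (r - eps - s) ^+ 2 <= H0 xh ^+ 2 by rewrite lerXn2r ?nnegrE ?Hpos//; lra.
  have h3 : qa * s * (2 * N%:R) = 2 * N%:R * ((qa - r / N%:R) * s) + 2 * (r * s).
    by field; rewrite gt_eqF.
  have h4 : 2 * N%:R * (eps * (2 * (r / N%:R))) = 4 * (r * eps) by field; rewrite gt_eqF.
  have h5 : 2 * N%:R * (eps * (2 * (r / N%:R))) <= 2 * N%:R * ((qa - r / N%:R) * s).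
    by rewrite ler_wpM2l// mulr_ge0// ltW.
  have h6 : r ^+ 2 - (r - eps - s) ^+ 2 = 2 * (r * eps) + 2 * (r * s) - (eps + s) ^+ 2 by ring.
  have h7 := sqr_ge0 (eps + s); have h8 : 0 < r * eps by exact: mulr_gt0.
  lra.
have nG : ~ closure Gamma0 xh.
  move=> /u_closure_Gamma0 E1; move: phi0; rewrite /phi E1 sub0r oppr_gt0 ltNge mulr_ge0//.
  exact: ltW.
have xz : `|xh - z| < d / 2.
  have := ler_normD (xh - x0) (x0 - z); rewrite addrA subrK.
  have h1 : c * `|xh - x0| <= c * (d / 4) by apply: le_trans (hc _) _; lra.
  rewrite ler_pM2l// in h1; lra.
have Hgrad x : D x -> `|x - z| < d -> qb < H (grad u x).
  by move=> Dx /(hd x Dx); rewrite ltr_norml => /andP[h _]; rewrite -/r in h; lra.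
have growth v t : 0 < t -> closure D (xh + t *: v) -> H0 (xh + t *: v - x0) < s ->
    u (xh + t *: v) - u xh <= t * (qa * H0 v).
  move=> t0 cv vs; have Kv : xh + t *: v \in K by apply/mem_set; split=> //; exact: ltW.
  have := hmax _ Kv; rewrite /phi.
  have h1 : H0 (xh + t *: v - x0) <= H0 (xh - x0) + t * H0 v.
    have := norm_triangle hH0 (xh - x0) (t *: v); rewrite (normZ hH0) gtr0_norm// addrAC.
    by apply: le_trans.
  have : qa * H0 (xh + t *: v - x0) <= qa * (H0 (xh - x0) + t * H0 v) by rewrite ler_pM2l.
  have -> : qa * (H0 (xh - x0) + t * H0 v) = qa * H0 (xh - x0) + t * (qa * H0 v) by ring.
  lra.
have vs v : exists2 t1, 0 < t1 & forall t, 0 < t < t1 -> H0 (xh + t *: v - x0) < s.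
  have v1 : 0 < H0 v + 1 by have := Hpos v; lra.
  exists ((s - H0 (xh - x0)) / (H0 v + 1)); first by rewrite divr_gt0// subr_gt0.
  move=> t /andP[t0]; rewrite ltr_pdivlMr// => h1.
  have := norm_triangle hH0 (xh - x0) (t *: v); rewrite (normZ hH0) gtr0_norm// addrAC.
  have := Hpos v; nra.
have Hk : H (Du xh) <= qa.
  apply: contact_slope => // v; have [t1 t10 ht1] := vs v; exists t1 => // t tt cv.
  by apply: growth => //; [case/andP : tt|exact: ht1].
have [Dx|nDx] := pselect (D xh).
  have : qb < H (grad u xh) by apply: Hgrad => //; lra.
  rewrite -Du_grad//; lra.
have [//|gx] := boundary_cases cx nDx.
(* On [Gamma1] the extended gradient is a limit of gradients in the sector, so only the weak
   inequality survives; the gap between [qa] and [qb] still gives the contradiction. *)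
suff : qb <= H (Du xh) by lra.
rewrite leNgt; apply/negP => h1.
have [C' C'0 hC'] := norm_le_mx hH.
have e0 : 0 < (qb - H (Du xh)) / C' by rewrite divr_gt0// subr_gt0.
have [d1 d10 hd1] := Du_near_Gamma1 gx xh0 e0.
have m0 : 0 < Num.min d1 (d / 2) by rewrite lt_min d10 divr_gt0.
have /closure_normP/(_ _ m0)[p Dp] := cx; rewrite lt_min => /andP[pd1 pd].
have g1 := hd1 p Dp pd1; rewrite ltr_pdivlMr// mulrC in g1.
have g2 : qb < H (grad u p).
  apply: Hgrad => //; have := ler_normD (p - xh) (xh - z); rewrite addrA subrK; lra.
have := norm_triangle hH (grad u p - (Du xh)) (Du xh); rewrite subrK; have := hC' (grad u p - (Du xh)); lra.
Qed.

Lemma sector_eq_wulff : (forall r, 0 < r -> 0 < q r) ->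
  (forall r s, 0 < r -> r < s -> q r / r < q s / s) ->
  exists2 r : R, 0 < r & Sig `&` Om = Sig `&` wulff H0 0 r.
Proof.
move=> hq hqr; have [z1 [z2 [g1 g2 m1 m2]]] := Gamma0_extremal.
have p1 := norm_pos hH0 (Gamma0_neq0 g1); have p2 := norm_pos hH0 (Gamma0_neq0 g2).
have N0 : 0 < N%:R :> R by rewrite ltr0n.
have E12 : H0 z1 = H0 z2.
  apply/eqP; rewrite eq_le m1//= leNgt; apply/negP => h.
  have := hqr _ _ p1 h; apply/negP; rewrite -leNgt.
  apply: (@le_trans _ _ N%:R^-1).
    by rewrite ler_pdivrMr// mulrC; exact: q_le (hq _ p2) g2 m2.
  by rewrite ler_pdivlMr// mulrC; exact: q_ge hq g1 m1.
exists (H0 z1) => //; apply/seteqP; split=> x [Sx].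
  (* A nonzero point of the sector can be pushed outwards along its ray to [Gamma0], where [H0] is
     at most the common extreme value; before that point it is strictly smaller. *)
  move=> Ox; split=> //; rewrite /wulff/= subr0.
  have [->|x0] := eqVneq x 0; first by rewrite norm_zero.
  have [t t1 gt] := ray_exit_Gamma0 (conj Sx Ox) x0.
  have := m2 _ (subset_closure gt); rewrite -E12 (normZ hH0) gtr0_norm; last lra.
  by apply: lt_le_trans; rewrite ltr_pMl// norm_pos.
by rewrite /wulff/= subr0 => xr; split=> //; exact: sector_sub m1 Sx xr.
Qed.

End overdetermined.

Theorem theorem1p1 (R : realType) (N : nat) (hN : (2 <= N)%N)
  (Om : set 'rV[R]_N) (hOm : domain Om) (hbd : bounded_set Om) (hO : Om 0)
  (om Sig : set 'rV[R]_N) (hom : sphere_domain om) (hSig : Sig = cone om)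
  (hC1 : om <> unit_sphere ->
    forall z : 'rV[R]_N, (boundary Sig `\ 0) z -> C1_boundary_at Sig z)
  (Gamma0 Gamma1 : set 'rV[R]_N)
  (hG0 : Gamma0 = Sig `&` boundary Om)
  (hG1 : Gamma1 = boundary (Sig `&` Om) `\` closure Gamma0)
  (H H0 : 'rV[R]_N -> R) (hH : is_norm H) (hHC1 : C1_on [set~ 0] H)
  (hV : strictly_convex (half_sqr H))
  (hH0 : is_norm H0) (hdual : forall xi, H xi = dual_norm H0 xi)
  (q : R -> R) (hq : forall r : R, 0 < r -> 0 < q r)
  (hqr : forall r s : R, 0 < r -> r < s -> q r / r < q s / s)
  (u : 'rV[R]_N -> R) (Du : 'rV[R]_N -> 'rV[R]_N)
  (huC1 : C1_upto (Sig `&` Om) (Gamma1 `\ 0) u Du)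
  (huC0 : {within closure (Sig `&` Om) `\ 0, continuous u})
  (hsol : weak_solution H Om Sig (fun=> 1) u)
  (hu0 : forall z : 'rV[R]_N, Gamma0 z -> u z = 0)
  (hnu : forall z nu : 'rV[R]_N, (Gamma1 `\ 0) z -> outward_normal Sig z nu ->
    dot (grad (half_sqr H) (Du z)) nu = 0)
  (hgrad : forall z : 'rV[R]_N, closure Gamma0 z ->
    H (Du x) @[x --> within (Sig `&` Om) (nbhs z)] --> q (H0 z)) :
  exists2 r : R, 0 < r & Sig `&` Om = Sig `&` wulff H0 0 r.

Proof.
case: hOm => oOm _ _.
have bOm : exists M, forall x, Om x -> `|x| <= M.
  have [M [_ hM]] := hbd; exists (`|M| + 1) => x Ox; apply: (hM (`|M| + 1)) => //.
  by rewrite (le_lt_trans (ler_norm _))// ltrDl.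
have hC1' z : boundary Sig z -> z != 0 -> C1_boundary_at Sig z.
  move=> bz z0; have [omE|nom] := pselect (om = unit_sphere); last first.
    by apply: hC1 => //; split=> //; exact/eqP.
  (* For the full sphere the cone is the whole space, whose boundary is empty. *)
  by move: bz; rewrite hSig omE cone_unit_sphere => -[_ []]; rewrite interiorT.
exact: (sector_eq_wulff hN oOm bOm hO hom hSig hC1' hG0 hG1 hH hHC1 hV hH0 hdual huC1 huC0 hsol
  hu0 hnu hgrad hq hqr).
Qed.
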